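(* Let $\Lambda=\Lambda_{(\phi,\psi)}=\begin{pmatrix} A & {}_AN_B \\ {}_BM_A & B\end{pmatrix}$ be a Morita ring, and let $(\mathcal{U}',\mathcal{V}')$ and $(\mathcal{U}'',\mathcal{V}'')$ be cotorsion pairs in $(B/\operatorname{Im}\phi)\text{-}\mathrm{Mod}$ and $A\text{-}\mathrm{Mod}$, respectively. Assume that $\phi$ is a monomorphism. Define the following classes of left $\Lambda$-modules: $$\mathcal{M}^{\mathcal{U}'}_{\mathcal{U}''}=\Big\{\begin{pmatrix} X \\ Y \end{pmatrix}_{f,g}\ \Big|\ B/\operatorname{Im}\phi\otimes_B\operatorname{Coker} f\in\mathcal{U}',\ X\in\mathcal{U}'',\ f\text{ is a monomorphism}\Big\},$$ $$\mathcal{N}^{\mathcal{V}'}_{\mathcal{V}''}=\Big\{\begin{pmatrix} X \\ Y \end{pmatrix}_{f,g}\ \Big|\ B/\operatorname{Im}\phi\otimes_B\operatorname{Ker}\tilde g\in\mathcal{V}',\ X\in\mathcal{V}'',\ \tilde g\text{ is an epimorphism}\Big\}.$$ (1) If $\operatorname{Tor}^A_1(M,\mathcal{U}'')=0$, then $({}^\perp\mathcal{N}^{\mathcal{V}'}_{\mathcal{V}''},\mathcal{N}^{\mathcal{V}'}_{\mathcal{V}''})$ is a cotorsion pair in $\Lambda\text{-}\mathrm{Mod}$; if $\operatorname{Ext}_A^1(N,\mathcal{V}'')=0$, then $(\mathcal{M}^{\mathcal{U}'}_{\mathcal{U}''},(\mathcal{M}^{\mathcal{U}'}_{\mathcal{U}''})^\perp)$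 is a cotorsion pair in $\Lambda\text{-}\mathrm{Mod}$. (2) If $\operatorname{Tor}^A_1(M,\mathcal{U}'')=0$ and $\operatorname{Ext}_A^1(N,\mathcal{V}'')=0$, then $(\mathcal{M}^{\mathcal{U}'}_{\mathcal{U}''},\mathcal{N}^{\mathcal{V}'}_{\mathcal{V}''})$ is a cotorsion pair in $\Lambda\text{-}\mathrm{Mod}$; and it is complete and hereditary if so are $(\mathcal{U}',\mathcal{V}')$ and $(\mathcal{U}'',\mathcal{V}'')$.
   Context: Morita rings. Let $A,B$ be rings, ${}_BM_A$ and ${}_AN_B$ bimodules, $\phi:M\otimes_AN\to B$ a $B$-bimodule map and $\psi:N\otimes_BM\to A$ an $A$-bimodule map such that $m'\psi(n\otimes m)=\phi(m'\otimes n)m$ and $n'\phi(m\otimes n)=\psi(n'\otimes m)n$ for all $m,m'\in M$, $n,n'\in N$. The Morita ring $\Lambda_{(\phi,\psi)}=\begin{pmatrix} A & N \\ M & B \end{pmatrix}$ has componentwise addition and multiplication $\begin{pmatrix} a & n \\ m & b \end{pmatrix}\begin{pmatrix} a' & n' \\ m' & b' \end{pmatrix}=\begin{pmatrix} aa'+\psi(n\otimes m') & an'+nb' \\ ma'+bm' & \phi(m\otimes n')+bb' \end{pmatrix}$. Left $\Lambda$-modules are identified with quadruples $\begin{pmatrix} X \\ Y \end{pmatrix}_{f,g}$, where $X\in A\text{-}\mathrm{Mod}$, $Y\in B\text{-}\mathrm{Mod}$, $f\in\operatorname{Hom}_B(M\otimes_AX,Y)$, $g\in\operatorname{Hom}_A(N\otimes_BY,X)$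 satisfy $g(n\otimes f(m\otimes x))=\psi(n\otimes m)x$ and $f(m\otimes g(n\otimes y))=\phi(m\otimes n)y$ for all $m\in M,n\in N,x\in X,y\in Y$; homomorphisms are pairs $(a,b)$ of an $A$-map and a $B$-map compatible with the $f$'s and $g$'s. $\tilde f:X\to\operatorname{Hom}_B(M,Y)$ and $\tilde g:Y\to\operatorname{Hom}_A(N,X)$ denote the maps corresponding to $f$ and $g$ under the tensor-Hom adjunctions. All classes of modules are closed under isomorphisms; $\operatorname{Tor}_1^A(M,\mathcal{C})=0$ means vanishing on every object of $\mathcal{C}$, and similarly for $\operatorname{Ext}$. Cotorsion pairs. For a class $\mathcal{C}$ of modules, $\mathcal{C}^\perp=\{X\mid\operatorname{Ext}^1(C,X)=0\ \forall C\in\mathcal{C}\}$ and ${}^\perp\mathcal{C}=\{X\mid\operatorname{Ext}^1(X,C)=0\ \forall C\in\mathcal{C}\}$. $(\mathcal{C},\mathcal{D})$ is a cotorsion pair if $\mathcal{C}^\perp=\mathcal{D}$ and ${}^\perp\mathcal{D}=\mathcal{C}$. It is complete if for each module $Z$ there are short exact sequences $0\to D_1\to C_1\to Z\to0$ and $0\to Z\to D_2\to C_2\to0$ with $C_i\in\mathcal{C}$, $D_i\in\mathcal{D}$. It is hereditary if $\mathcal{C}$ is closed under kernels of epimorphisms and $\mathcal{D}$ is closed under cokernels of monomorphisms. *)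

(* Defs.v *)
From HB Require Import structures.
From mathcomp Require Import all_boot all_order all_algebra.
From mathcomp Require Import generic_quotient.
From mathcomp Require Import boolp.

Set Implicit Arguments.
Unset Strict Implicit.
Unset Printing Implicit Defensive.

Import GRing.Theory.
Local Open Scope ring_scope.
Local Open Scope quotient_scope.

(* Rings are associative and unital; the zero ring is allowed (pzRingType),
   since B / Im phi below may vanish. Modules are left modules (lmodType). *)

Lemma linear_ext (R : pzRingType) (V W : lmodType R) (f g : {linear V -> W}) :
  f =1 g -> f = g.
Proof.
move=> fg.
have {}fg : (f : V -> W) = g by apply/funext.
case: f fg => f cf; case: g => g cg /= fg; rewrite fg in cf *.
congr (GRing.Linear.Pack _).
case: cf => a b; case: cg => c d.
congr (GRing.Linear.Class _ _).
- case: a => a; case: c => c; congr (GRing.isNmodMorphism.Axioms_ _).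
  exact: Prop_irrelevance.
- case: b => b; case: d => d; congr (GRing.isScalable.Axioms_ _).
  exact: Prop_irrelevance.
Qed.

Definition surjective (T U : Type) (f : T -> U) : Prop :=
  forall u, exists t, f t = u.

Definition exact_at (T : Type) (U V : zmodType) (f : T -> U) (g : U -> V) : Prop :=
  forall u, g u = 0 <-> exists t, f t = u.

Definition short_exact (R : pzRingType) (U V W : lmodType R)
    (f : {linear U -> V}) (g : {linear V -> W}) : Prop :=
  [/\ injective f, exact_at f g & surjective g].

Definition lmod_iso (R : pzRingType) (V W : lmodType R) : Prop :=
  exists f : {linear V -> W}, bijective f.

Section Ker.
Variables (R : pzRingType) (V W : lmodType R) (f : {linear V -> W}).

Definition ker_pred : {pred V} := fun v => f v == 0.

Fact ker_pred_submod : submod_closed ker_pred.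
Proof.
split=> [|a u v]; rewrite !unfold_in ?linear0 // => /eqP fu /eqP fv.
by rewrite linearP fu fv scaler0 addr0.
Qed.

HB.instance Definition _ := GRing.isSubmodClosed.Build R V ker_pred ker_pred_submod.

Record ker : Type := Ker { ker_val : V; _ : ker_val \in ker_pred }.
HB.instance Definition _ := [isSub for ker_val].
HB.instance Definition _ := [Choice of ker by <:].
HB.instance Definition _ := [SubChoice_isSubLmodule of ker by <:].
End Ker.

Section Coker.
Variables (R : pzRingType) (V W : lmodType R) (f : {linear V -> W}).

Definition coker_rel (w w' : W) : bool := `[< exists v, f v = w - w' >].

Fact coker_rel_equiv : equiv_class_of coker_rel.
Proof.
split=> [w|w w'|w2 w1 w3].
- by apply/asboolP; exists 0; rewrite linear0 subrr.
- suff h a b : coker_rel a b -> coker_rel b a by apply/idP/idP; exact: h.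
  by move=> /asboolP[v fv]; apply/asboolP; exists (- v); rewrite linearN fv opprB.
- move=> /asboolP[v fv] /asboolP[u fu]; apply/asboolP; exists (v + u).
  by rewrite linearD fv fu addrA subrK.
Qed.
Canonical coker_equiv := EquivRelPack coker_rel_equiv.

Definition coker : Type := {eq_quot coker_equiv}.
HB.instance Definition _ := Choice.on coker.
HB.instance Definition _ : EqQuotient W coker_equiv coker :=
  EqQuotient.on coker.

Definition to_coker (w : W) : coker := \pi w.

Lemma to_cokerK (c : coker) : to_coker (repr c) = c.
Proof. exact: reprK. Qed.

Lemma to_cokerP w w' : to_coker w = to_coker w' <-> exists v, f v = w - w'.
Proof.
split=> [/eqP|h]; first by rewrite eqmodE => /asboolP.
by apply/eqP; rewrite eqmodE; apply/asboolP.
Qed.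

Lemma coker_reprP w : exists v, f v = repr (to_coker w) - w.
Proof. by apply/to_cokerP; rewrite to_cokerK. Qed.

Definition coker_zero := to_coker 0.
Definition coker_opp (c : coker) := to_coker (- repr c).
Definition coker_add (c d : coker) := to_coker (repr c + repr d).
Definition coker_scale (r : R) (c : coker) := to_coker (r *: repr c).

Lemma coker_oppE w : coker_opp (to_coker w) = to_coker (- w).
Proof.
have [v fv] := coker_reprP w; apply/to_cokerP; exists (- v).
by rewrite linearN fv opprB opprK addrC.
Qed.

Lemma coker_addE w w' : coker_add (to_coker w) (to_coker w') = to_coker (w + w').
Proof.
have [v fv] := coker_reprP w; have [u fu] := coker_reprP w'.
by apply/to_cokerP; exists (v + u); rewrite linearD fv fu opprD addrACA.
Qed.

Lemma coker_scaleE r w : coker_scale r (to_coker w) = to_coker (r *: w).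
Proof.
have [v fv] := coker_reprP w; apply/to_cokerP; exists (r *: v).
by rewrite linearZ /= fv scalerBr.
Qed.

Fact coker_addA : associative coker_add.
Proof.
move=> a b c; rewrite -(to_cokerK a) -(to_cokerK b) -(to_cokerK c).
by rewrite !coker_addE addrA.
Qed.
Fact coker_addC : commutative coker_add.
Proof.
by move=> a b; rewrite -(to_cokerK a) -(to_cokerK b) !coker_addE addrC.
Qed.
Fact coker_add0 : left_id coker_zero coker_add.
Proof. by move=> a; rewrite -(to_cokerK a) coker_addE add0r. Qed.
Fact coker_addN : left_inverse coker_zero coker_opp coker_add.
Proof. by move=> a; rewrite -(to_cokerK a) coker_oppE coker_addE addNr. Qed.
HB.instance Definition _ :=
  GRing.isZmodule.Build coker coker_addA coker_addC coker_add0 coker_addN.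

Lemma to_cokerD : {morph to_coker : x y / x + y}.
Proof. by move=> x y; rewrite -coker_addE. Qed.

Fact coker_scaleA a b c :
  coker_scale a (coker_scale b c) = coker_scale (a * b) c.
Proof. by rewrite -(to_cokerK c) !coker_scaleE scalerA. Qed.
Fact coker_scale1 : left_id 1 coker_scale.
Proof. by move=> c; rewrite -(to_cokerK c) coker_scaleE scale1r. Qed.
Fact coker_scaleDr : right_distributive coker_scale +%R.
Proof.
move=> r c d; rewrite -(to_cokerK c) -(to_cokerK d).
by rewrite -to_cokerD !coker_scaleE -to_cokerD scalerDr.
Qed.
Fact coker_scaleDl c : {morph coker_scale^~ c : a b / a + b}.
Proof.
by move=> a b; rewrite -(to_cokerK c) !coker_scaleE -to_cokerD scalerDl.
Qed.
HB.instance Definition _ := GRing.Zmodule_isLmodule.Build R coker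
  coker_scaleA coker_scale1 coker_scaleDr coker_scaleDl.
End Coker.

Record bimodType (R S : pzRingType) := Bimod {
  bimod_lmod :> lmodType R;
  ract : bimod_lmod -> S -> bimod_lmod;
  ractA : forall m s t, ract (ract m s) t = ract m (s * t);
  ractr1 : forall m, ract m 1 = m;
  ractDr : forall m s t, ract m (s + t) = ract m s + ract m t;
  ractDl : forall m m' s, ract (m + m') s = ract m s + ract m' s;
  ractZ : forall r m s, ract (r *: m) s = r *: ract m s
}.

Section Tensor.
Variables (R S : pzRingType) (M : bimodType R S) (X : lmodType S).

(* The sequence [:: (m1, x1); ...; (mk, xk)] stands for the formal sum
   m1 ⊗ x1 + ... + mk ⊗ xk. Inverses need no relation of their own, as
   (- m) ⊗ x is the inverse of m ⊗ x. *)
Inductive tens_eq : seq (M * X) -> seq (M * X) -> Prop :=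
| tens_refl s : tens_eq s s
| tens_sym s t : tens_eq s t -> tens_eq t s
| tens_trans s t u : tens_eq s t -> tens_eq t u -> tens_eq s u
| tens_cat s s' t t' : tens_eq s s' -> tens_eq t t' -> tens_eq (s ++ t) (s' ++ t')
| tens_comm s t : tens_eq (s ++ t) (t ++ s)
| tens_0 x : tens_eq [:: (0, x)] [::]
| tens_Dl m m' x : tens_eq [:: (m + m', x)] [:: (m, x); (m', x)]
| tens_Dr m x x' : tens_eq [:: (m, x + x')] [:: (m, x); (m, x')]
| tens_bal m s x : tens_eq [:: (ract m s, x)] [:: (m, s *: x)].

Definition tens_rel (s t : seq (M * X)) : bool := `[< tens_eq s t >].

Fact tens_rel_equiv : equiv_class_of tens_rel.
Proof.
split=> [s|s t|t s u].
- by apply/asboolP; exact: tens_refl.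
- by apply/idP/idP => /asboolP h; apply/asboolP; exact: tens_sym.
- by move=> /asboolP h /asboolP k; apply/asboolP; exact: tens_trans k.
Qed.
Canonical tens_equiv := EquivRelPack tens_rel_equiv.

Definition tens : Type := {eq_quot tens_equiv}.
HB.instance Definition _ := Choice.on tens.
HB.instance Definition _ : EqQuotient (seq (M * X)) tens_equiv tens :=
  EqQuotient.on tens.

Definition to_tens (s : seq (M * X)) : tens := \pi s.
Definition pure (m : M) (x : X) : tens := to_tens [:: (m, x)].

Lemma to_tensK (t : tens) : to_tens (repr t) = t.
Proof. exact: reprK. Qed.

Lemma to_tensP s t : to_tens s = to_tens t <-> tens_eq s t.
Proof.
split=> [/eqP|h]; first by rewrite eqmodE => /asboolP.
by apply/eqP; rewrite eqmodE; apply/asboolP.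
Qed.

Definition tens_opp (t : tens) : tens :=
  to_tens [seq (- p.1, p.2) | p <- repr t].
Definition tens_add (t u : tens) : tens := to_tens (repr t ++ repr u).

Lemma tens_addE s t : tens_add (to_tens s) (to_tens t) = to_tens (s ++ t).
Proof. by apply/to_tensP; apply: tens_cat; apply/to_tensP; rewrite to_tensK. Qed.

Fact tens_addA : associative tens_add.
Proof.
move=> a b c; rewrite -(to_tensK a) -(to_tensK b) -(to_tensK c).
by rewrite !tens_addE catA.
Qed.
Fact tens_addC : commutative tens_add.
Proof.
move=> a b; rewrite -(to_tensK a) -(to_tensK b) !tens_addE.
by apply/to_tensP; exact: tens_comm.
Qed.
Fact tens_add0 : left_id (to_tens [::]) tens_add.
Proof. by move=> a; rewrite -(to_tensK a) tens_addE. Qed.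
Fact tens_addN : left_inverse (to_tens [::]) tens_opp tens_add.
Proof.
move=> a; rewrite -{2}(to_tensK a) /tens_opp.
elim: (repr a) => [|[m x] s ih] /=; first by rewrite tens_addE.
rewrite -ih !tens_addE; apply/to_tensP.
set s' := map _ _.
apply: (@tens_trans _ ([:: (m, x)] ++ ([:: (- m, x)] ++ s') ++ s)).
  rewrite -cat1s -[(m, x) :: s]cat1s !catA; apply: tens_cat; last exact: tens_refl.
  exact: tens_comm.
rewrite catA -[s' ++ s]cat0s catA; apply: tens_cat; last exact: tens_refl.
rewrite catA; apply: tens_cat; last exact: tens_refl.
by apply: tens_trans (tens_0 x); apply: tens_sym; rewrite -(subrr m); exact: tens_Dl.
Qed.
HB.instance Definition _ :=
  GRing.isZmodule.Build tens tens_addA tens_addC tens_add0 tens_addN.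

Lemma to_tensE s : to_tens s = \sum_(p <- s) pure p.1 p.2.
Proof.
elim: s => [|[m x] s ih]; first by rewrite big_nil.
by rewrite big_cons -ih -[(m, x) :: s]cat1s -tens_addE.
Qed.

Lemma pureDl m m' x : pure (m + m') x = pure m x + pure m' x.
Proof. by rewrite [RHS]tens_addE; apply/to_tensP; exact: tens_Dl. Qed.
Lemma pureDr m x x' : pure m (x + x') = pure m x + pure m x'.
Proof. by rewrite [RHS]tens_addE; apply/to_tensP; exact: tens_Dr. Qed.
Lemma pure_bal m s x : pure (ract m s) x = pure m (s *: x).
Proof. by apply/to_tensP; exact: tens_bal. Qed.

Lemma tensE (t : tens) : exists s, t = \sum_(p <- s) pure p.1 p.2.
Proof. by exists (repr t); rewrite -to_tensE to_tensK. Qed.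

Record balanced (T : zmodType) (b : M -> X -> T) : Prop := Balanced {
  balancedDl : forall m m' x, b (m + m') x = b m x + b m' x;
  balancedDr : forall m x x', b m (x + x') = b m x + b m x';
  balancedA : forall m s x, b (ract m s) x = b m (s *: x)
}.

(* Meaningful when b is balanced. *)
Definition tens_lift (T : zmodType) (b : M -> X -> T) (t : tens) : T :=
  \sum_(p <- repr t) b p.1 p.2.

Lemma tens_lift_sum (T : zmodType) (b : M -> X -> T) s : balanced b ->
  tens_lift b (to_tens s) = \sum_(p <- s) b p.1 p.2.
Proof.
case=> bDl bDr bA; rewrite /tens_lift.
have : tens_eq (repr (to_tens s)) s by apply/to_tensP; rewrite to_tensK.
move: (repr _) => s'; elim=> {s s'}.
- by [].
- by move=> s t _ ->.
- by move=> s t u _ -> _ ->.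
- by move=> s s' t t' _ es _ et; rewrite !big_cat /= es et.
- by move=> s t; rewrite !big_cat /= addrC.
- move=> x; rewrite big_seq1 big_nil /=.
  by apply: (addIr (b 0 x)); rewrite -bDl addr0 add0r.
- by move=> m m' x; rewrite !unlock /= !addr0.
- by move=> m x x'; rewrite !unlock /= !addr0.
- by move=> m r x; rewrite !big_seq1 /=.
Qed.

Lemma tens_liftE (T : zmodType) (b : M -> X -> T) m x : balanced b ->
  tens_lift b (pure m x) = b m x.
Proof. by move=> bb; rewrite tens_lift_sum // big_seq1. Qed.

Lemma tens_liftD (T : zmodType) (b : M -> X -> T) : balanced b ->
  {morph tens_lift b : t u / t + u}.
Proof.
move=> bb t u; rewrite -(to_tensK t) -(to_tensK u) [_ + _]tens_addE.
by rewrite !tens_lift_sum // big_cat.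
Qed.

Lemma tens_ext (T : zmodType) (h k : tens -> T) :
    {morph h : t u / t + u} -> {morph k : t u / t + u} ->
  (forall m x, h (pure m x) = k (pure m x)) -> h =1 k.
Proof.
move=> hD kD hk t; rewrite -(to_tensK t); elim: (repr t) => [|[m x] s ih].
  have z (l : tens -> T) : {morph l : t u / t + u} -> l (to_tens [::]) = 0.
    by move=> lD; apply: (addIr (l 0)); rewrite -lD !add0r.
  by rewrite !z.
by rewrite -cat1s -tens_addE hD kD ih hk.
Qed.

Definition tens_scale (r : R) : tens -> tens :=
  tens_lift (fun m x => pure (r *: m) x).

Lemma tens_scale_bal r : balanced (fun m x => pure (r *: m) x).
Proof.
split=> [m m' x|m x x'|m s x]; first by rewrite scalerDr pureDl.
  exact: pureDr.
by rewrite -ractZ pure_bal.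
Qed.

Lemma tens_scaleE r m x : tens_scale r (pure m x) = pure (r *: m) x.
Proof. by rewrite [LHS]tens_liftE //; exact: tens_scale_bal. Qed.

Fact tens_scaleDr : right_distributive tens_scale +%R.
Proof. by move=> r; apply: tens_liftD; exact: tens_scale_bal. Qed.
Fact tens_scaleA a b t : tens_scale a (tens_scale b t) = tens_scale (a * b) t.
Proof.
move: t; apply: tens_ext => [t u|t u|m x]; rewrite ?tens_scaleDr //.
by rewrite !tens_scaleE scalerA.
Qed.
Fact tens_scale1 : left_id 1 tens_scale.
Proof.
by apply: tens_ext => [t u|t u|m x]; rewrite ?tens_scaleDr // tens_scaleE scale1r.
Qed.
Fact tens_scaleDl t : {morph tens_scale^~ t : a b / a + b}.
Proof.
move=> a b; move: t; apply: tens_ext => [t u|t u|m x].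
- exact: tens_scaleDr.
- by rewrite !tens_scaleDr addrACA.
- by rewrite !tens_scaleE scalerDl pureDl.
Qed.
HB.instance Definition _ := GRing.Zmodule_isLmodule.Build R tens
  tens_scaleA tens_scale1 tens_scaleDr tens_scaleDl.

Lemma scale_pure r m x : r *: pure m x = pure (r *: m) x.
Proof. exact: tens_scaleE. Qed.
End Tensor.

Section TensorMap.
Variables (R S : pzRingType) (M : bimodType R S) (X Y : lmodType S).
Variable h : {linear X -> Y}.

Definition tens_map : tens M X -> tens M Y := tens_lift (fun m x => pure m (h x)).

Lemma tens_map_bal : balanced (fun (m : M) x => pure m (h x)).
Proof.
split=> [m m' x|m x x'|m s x]; first exact: pureDl.
  by rewrite linearD pureDr.
by rewrite linearZ pure_bal.
Qed.

Lemma tens_mapE m x : tens_map (pure m x) = pure m (h x).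
Proof. by rewrite [LHS]tens_liftE //; exact: tens_map_bal. Qed.

Fact tens_map_linear : linear tens_map.
Proof.
have tD := tens_liftD tens_map_bal.
move=> r t u; rewrite [LHS]tD; congr (_ + _).
move: t; apply: tens_ext => [t t'|t t'|m x].
- by rewrite scalerDr [LHS]tD.
- by rewrite -scalerDr; congr (_ *: _); exact: tD.
- by rewrite scale_pure tens_mapE scale_pure -tens_mapE.
Qed.
HB.instance Definition _ :=
  GRing.isLinear.Build R (tens M X) (tens M Y) *:%R tens_map tens_map_linear.
End TensorMap.
Arguments tens_map {R S} M {X Y} h.

Section Hom.
Variables (R S : pzRingType) (N : bimodType R S) (X : lmodType R).

(* Hom_R(N, X) for an R-S-bimodule N, a left S-module through
   (s h)(n) = h (n s). *)
Definition lhom : Type := {linear N -> X}.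
Definition lhom_fun (h : lhom) : {linear N -> X} := h.
HB.instance Definition _ := gen_eqMixin lhom.
HB.instance Definition _ := gen_choiceMixin lhom.

Definition lhom_zero : lhom := \0%R : {linear N -> X}.
Definition lhom_opp (h : lhom) : lhom := (\- lhom_fun h)%R : {linear N -> X}.
Definition lhom_add (h k : lhom) : lhom :=
  (lhom_fun h \+ lhom_fun k)%R : {linear N -> X}.

Fact lhom_addA : associative lhom_add.
Proof. by move=> f g h; apply: linear_ext => n /=; rewrite addrA. Qed.
Fact lhom_addC : commutative lhom_add.
Proof. by move=> f g; apply: linear_ext => n /=; rewrite addrC. Qed.
Fact lhom_add0 : left_id lhom_zero lhom_add.
Proof. by move=> f; apply: linear_ext => n /=; rewrite add0r. Qed.
Fact lhom_addN : left_inverse lhom_zero lhom_opp lhom_add.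
Proof. by move=> f; apply: linear_ext => n /=; rewrite addNr. Qed.
HB.instance Definition _ :=
  GRing.isZmodule.Build lhom lhom_addA lhom_addC lhom_add0 lhom_addN.

Definition lhom_scale_fun (s : S) (h : lhom) (n : N) : X := lhom_fun h (ract n s).
Fact lhom_scale_linear s h : linear (lhom_scale_fun s h).
Proof. by move=> r n n'; rewrite /lhom_scale_fun ractDl ractZ linearP. Qed.
HB.instance Definition _ s h :=
  GRing.isLinear.Build R N X *:%R (lhom_scale_fun s h) (lhom_scale_linear s h).
Definition lhom_scale (s : S) (h : lhom) : lhom :=
  lhom_scale_fun s h : {linear N -> X}.

Fact lhom_scaleA a b h : lhom_scale a (lhom_scale b h) = lhom_scale (a * b) h.
Proof. by apply: linear_ext => n; rewrite /= /lhom_scale_fun /= /lhom_scale_fun ractA. Qed.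
Fact lhom_scale1 : left_id 1 lhom_scale.
Proof. by move=> h; apply: linear_ext => n; rewrite /= /lhom_scale_fun ractr1. Qed.
Fact lhom_scaleDr : right_distributive lhom_scale +%R.
Proof. by move=> s h k; apply: linear_ext => n. Qed.
Fact lhom_scaleDl h : {morph lhom_scale^~ h : a b / a + b}.
Proof.
by move=> a b; apply: linear_ext => n; rewrite /= /lhom_scale_fun ractDr linearD.
Qed.
HB.instance Definition _ := GRing.Zmodule_isLmodule.Build S lhom
  lhom_scaleA lhom_scale1 lhom_scaleDr lhom_scaleDl.

Section Adjunct.
Variables (Y : lmodType S) (g : {linear tens N Y -> X}).

Definition adjunct_fun (y : Y) (n : N) : X := g (pure n y).
Fact adjunct_fun_linear y : linear (adjunct_fun y).
Proof.
by move=> r n n'; rewrite /adjunct_fun pureDl -scale_pure linearP.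
Qed.
HB.instance Definition _ y :=
  GRing.isLinear.Build R N X *:%R (adjunct_fun y) (adjunct_fun_linear y).

Definition adjunct (y : Y) : lhom := adjunct_fun y : {linear N -> X}.
Fact adjunct_linear : linear adjunct.
Proof.
move=> s y y'; apply: linear_ext => n /=.
by rewrite /lhom_scale_fun /= /adjunct_fun pureDr linearD pure_bal.
Qed.
HB.instance Definition _ :=
  GRing.isLinear.Build S Y lhom *:%R adjunct adjunct_linear.
End Adjunct.
End Hom.

Definition projective (R : pzRingType) (P : lmodType R) : Prop :=
  forall (V W : lmodType R) (p : {linear V -> W}) (h : {linear P -> W}),
    surjective p -> exists k : {linear P -> V}, forall x, p (k x) = h x.

(* ... -> P_2 -> P_1 -> P_0 -> X -> 0, with res_d n : P_(n+1) -> P_n. *)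
Record proj_resolution (R : pzRingType) (X : lmodType R) := ProjResolution {
  res_mod : nat -> lmodType R;
  res_d : forall n, {linear res_mod n.+1 -> res_mod n};
  res_aug : {linear res_mod 0%N -> X};
  res_projective : forall n, projective (res_mod n);
  res_aug_surj : surjective res_aug;
  res_exact0 : exact_at (res_d 0) res_aug;
  res_exact : forall n, exact_at (res_d n.+1) (res_d n)
}.

(* Tor_1^S(M, X) = 0 and Ext^1_R(X, V) = 0: the first homology of M ⊗_S P,
   resp. of Hom_R(P, V), vanishes. Which projective resolution P of X is used
   is immaterial, and one always exists (by free modules). *)
Definition Tor1_vanishes (R S : pzRingType) (M : bimodType R S)
    (X : lmodType S) : Prop :=
  forall P : proj_resolution X,
    exact_at (tens_map M (res_d P 1)) (tens_map M (res_d P 0)).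

Definition Ext1_vanishes (R : pzRingType) (X V : lmodType R) : Prop :=
  forall (P : proj_resolution X) (h : {linear res_mod P 1 -> V}),
    (forall z, h (res_d P 1 z) = 0) <->
    (exists k : {linear res_mod P 0 -> V}, forall y, k (res_d P 0 y) = h y).

Definition mod_class (R : pzRingType) := lmodType R -> Prop.

Definition perp_right (R : pzRingType) (C : mod_class R) : mod_class R :=
  fun X => forall V, C V -> Ext1_vanishes V X.
Definition perp_left (R : pzRingType) (C : mod_class R) : mod_class R :=
  fun X => forall V, C V -> Ext1_vanishes X V.

Definition cotorsion_pair (R : pzRingType) (C D : mod_class R) : Prop :=
  (forall X, perp_right C X <-> D X) /\ (forall X, perp_left D X <-> C X).

Definition complete_pair (R : pzRingType) (C D : mod_class R) : Prop :=
  forall Z : lmodType R,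
    (exists (D1 C1 : lmodType R) (i : {linear D1 -> C1}) (p : {linear C1 -> Z}),
       [/\ D D1, C C1 & short_exact i p]) /\
    (exists (D2 C2 : lmodType R) (i : {linear Z -> D2}) (p : {linear D2 -> C2}),
       [/\ D D2, C C2 & short_exact i p]).

Definition hereditary_pair (R : pzRingType) (C D : mod_class R) : Prop :=
  (forall (V W : lmodType R) (p : {linear V -> W}),
     surjective p -> C V -> C W -> C (ker p)) /\
  (forall (V W : lmodType R) (i : {linear V -> W}),
     injective i -> D V -> D W -> D (coker i)).

(* The right linearity of phi and psi is stated on pure tensors, where the
   right action on the tensor product is (m ⊗ n) b = m ⊗ (n b). *)
Record morita_context (A B : pzRingType) (M : bimodType B A) (N : bimodType A B) :=
  MoritaContext {
    phi : {linear tens M N -> B^o};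
    psi : {linear tens N M -> A^o};
    phi_ract : forall (m : M) (n : N) (b : B), phi (pure m (ract n b)) = phi (pure m n) * b;
    psi_ract : forall (n : N) (m : M) (a : A), psi (pure n (ract m a)) = psi (pure n m) * a;
    phi_psi : forall (m' : M) (n : N) (m : M),
      ract m' (psi (pure n m)) = (phi (pure m' n) : B) *: m;
    psi_phi : forall (n' : N) (m : M) (n : N),
      ract n' (phi (pure m n)) = (psi (pure n' m) : A) *: n
  }.

Section MoritaRing.
Variables (A B : pzRingType) (M : bimodType B A) (N : bimodType A B).

(* The matrix with rows (a, n) and (m, b) is encoded as ((a, n), (m, b)).
   The context is a phantom argument, as the product depends on it. *)
Definition morita_ring (K : morita_context M N) : Type :=
  ((A * N) * (M * B))%type.
HB.instance Definition _ (K : morita_context M N) :=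
  GRing.Zmodule.on (morita_ring K).

Variable K : morita_context M N.

Definition morita_one : morita_ring K := ((1, 0), (0, 1)).
Definition morita_mul (x y : morita_ring K) : morita_ring K :=
  let: ((a, n), (m, b)) := x in
  let: ((a', n'), (m', b')) := y in
  ((a * a' + psi K (pure n m'), a *: n' + ract n b'),
   (ract m a' + b *: m', phi K (pure m n') + b * b')).

Lemma ract0 (R S : pzRingType) (L : bimodType R S) (s : S) : ract (0 : L) s = 0.
Proof. by apply: (addIr (ract (0 : L) s)); rewrite -ractDl !add0r. Qed.
Lemma ractr0 (R S : pzRingType) (L : bimodType R S) (l : L) : ract l 0 = 0.
Proof. by apply: (addIr (ract l 0)); rewrite -ractDr !add0r. Qed.
Lemma pure0l (R S : pzRingType) (L : bimodType R S) (X : lmodType S) (x : X) :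
  pure (0 : L) x = 0.
Proof. by apply: (addIr (pure (0 : L) x)); rewrite -pureDl !add0r. Qed.
Lemma pure0r (R S : pzRingType) (L : bimodType R S) (X : lmodType S) (l : L) :
  pure l (0 : X) = 0.
Proof. by apply: (addIr (pure l (0 : X))); rewrite -pureDr !add0r. Qed.

Fact morita_mulA : associative morita_mul.
Proof.
move=> [[a1 n1] [m1 b1]] [[a2 n2] [m2 b2]] [[a3 n3] [m3 b3]] /=.
congr ((_, _), (_, _)).
- rewrite mulrDr pureDr linearD /= mulrDl pureDl linearD /= mulrA psi_ract.
  rewrite -scale_pure pure_bal linearZ /= !addrA; congr (_ + _).
  by rewrite -!addrA; congr (_ + _); rewrite addrC.
- rewrite scalerDr scalerA ractDr ractDl ractZ ractA scalerDl -psi_phi.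
  rewrite -!addrA; congr (_ + _); rewrite !addrA; congr (_ + _).
  by rewrite addrC.
- rewrite ractDr phi_psi ractDl ractA ractZ scalerDr scalerDl scalerA.
  by rewrite addrACA.
- rewrite pureDr linearD /= phi_ract mulrDr mulrA pureDl linearD /= mulrDl.
  rewrite pure_bal -scale_pure linearZ /= -!addrA; congr (_ + _).
  by rewrite !addrA; congr (_ + _); rewrite addrC.
Qed.
Fact morita_mul1 : left_id morita_one morita_mul.
Proof.
move=> [[a n] [m b]] /=.
by rewrite !pure0l !linear0 !ract0 !mul1r !scale1r !add0r !addr0.
Qed.
Fact morita_mulr1 : right_id morita_one morita_mul.
Proof.
move=> [[a n] [m b]] /=.
by rewrite !pure0r !linear0 !scaler0 !ractr1 !mulr1 !add0r !addr0.
Qed.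
Fact morita_mulDl : left_distributive morita_mul +%R.
Proof.
move=> [[a1 n1] [m1 b1]] [[a2 n2] [m2 b2]] [[a3 n3] [m3 b3]] /=.
by congr ((_, _), (_, _));
  rewrite ?pureDl ?linearD /= ?mulrDl ?ractDl ?scalerDl addrACA.
Qed.
Fact morita_mulDr : right_distributive morita_mul +%R.
Proof.
move=> [[a1 n1] [m1 b1]] [[a2 n2] [m2 b2]] [[a3 n3] [m3 b3]] /=.
by congr ((_, _), (_, _));
  rewrite ?pureDr ?linearD /= ?mulrDr ?ractDr ?scalerDr addrACA.
Qed.
HB.instance Definition _ := GRing.Zmodule_isPzRing.Build (morita_ring K)
  morita_mulA morita_mul1 morita_mulr1 morita_mulDl morita_mulDr.

Definition quo_ring : Type := coker (phi K).
HB.instance Definition _ := GRing.Zmodule.on quo_ring.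

Definition to_quo (b : B) : quo_ring := to_coker (phi K) (b : B^o).
Definition quo_mul (x y : quo_ring) : quo_ring :=
  to_quo ((repr x : B) * (repr y : B)).

Lemma to_quoK (x : quo_ring) : to_quo (repr x) = x.
Proof. exact: to_cokerK. Qed.

Lemma phi_mulr t b : exists u, phi K u = (phi K t : B) * b.
Proof.
have [s ->] := tensE t; elim: s => [|p s [u hu]].
  by exists 0; rewrite !big_nil linear0 mul0r.
exists (pure p.1 (ract p.2 b) + u).
by rewrite big_cons !linearD /= hu phi_ract mulrDl.
Qed.

Lemma quo_mulE b b' : quo_mul (to_quo b) (to_quo b') = to_quo (b * b').
Proof.
have [t ht] := coker_reprP (phi K) b; have [u hu] := coker_reprP (phi K) b'.
have [v hv] := phi_mulr t (repr (to_coker (phi K) b')).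
apply/to_cokerP; exists (v + b *: u).
rewrite linearD linearZ /= hv ht hu mulrBl [_ *: _]mulrBr.
by rewrite addrA subrK.
Qed.

Lemma to_quoD b b' : to_quo (b + b') = to_quo b + to_quo b'.
Proof. exact: to_cokerD. Qed.

Fact quo_mulA : associative quo_mul.
Proof.
move=> x y z; rewrite -(to_quoK x) -(to_quoK y) -(to_quoK z).
by rewrite !quo_mulE mulrA.
Qed.
Fact quo_mul1 : left_id (to_quo 1) quo_mul.
Proof. by move=> x; rewrite -(to_quoK x) quo_mulE mul1r. Qed.
Fact quo_mulr1 : right_id (to_quo 1) quo_mul.
Proof. by move=> x; rewrite -(to_quoK x) quo_mulE mulr1. Qed.
Fact quo_mulDl : left_distributive quo_mul +%R.
Proof.
move=> x y z; rewrite -(to_quoK x) -(to_quoK y) -(to_quoK z).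
by rewrite -to_quoD !quo_mulE -to_quoD mulrDl.
Qed.
Fact quo_mulDr : right_distributive quo_mul +%R.
Proof.
move=> x y z; rewrite -(to_quoK x) -(to_quoK y) -(to_quoK z).
by rewrite -to_quoD !quo_mulE -to_quoD mulrDr.
Qed.
HB.instance Definition _ := GRing.Zmodule_isPzRing.Build quo_ring
  quo_mulA quo_mul1 quo_mulr1 quo_mulDl quo_mulDr.

Lemma to_quoM b b' : to_quo (b * b') = to_quo b * to_quo b'.
Proof. by rewrite -quo_mulE. Qed.

Definition quo_ract (x : quo_ring^o) (b : B) : quo_ring^o :=
  (x : quo_ring) * to_quo b.
Fact quo_ractA x b c : quo_ract (quo_ract x b) c = quo_ract x (b * c).
Proof. by rewrite /quo_ract to_quoM mulrA. Qed.
Fact quo_ractr1 x : quo_ract x 1 = x.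
Proof. exact: mulr1. Qed.
Fact quo_ractDr x b c : quo_ract x (b + c) = quo_ract x b + quo_ract x c.
Proof. by rewrite /quo_ract to_quoD mulrDr. Qed.
Fact quo_ractDl x y b : quo_ract (x + y) b = quo_ract x b + quo_ract y b.
Proof. exact: mulrDl. Qed.
Fact quo_ractZ r x b : quo_ract (r *: x) b = r *: quo_ract x b.
Proof. by rewrite /quo_ract [r *: x]/(r * x) -mulrA. Qed.
Definition quo_bimod : bimodType quo_ring B :=
  Bimod quo_ractA quo_ractr1 quo_ractDr quo_ractDl quo_ractZ.
End MoritaRing.

Section MoritaModules.
Variables (A B : pzRingType) (M : bimodType B A) (N : bimodType A B).
Variable K : morita_context M N.

Record quadruple := Quadruple {
  quad_X : lmodType A;
  quad_Y : lmodType B;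
  quad_f : {linear tens M quad_X -> quad_Y};
  quad_g : {linear tens N quad_Y -> quad_X};
  quad_gf : forall n m x,
    quad_g (pure n (quad_f (pure m x))) = (psi K (pure n m) : A) *: x;
  quad_fg : forall m n y,
    quad_f (pure m (quad_g (pure n y))) = (phi K (pure m n) : B) *: y
}.

(* The Λ-module of a quadruple: column vectors (x, y), with Λ acting by matrix
   multiplication. *)
Definition quad_mod (q : quadruple) : Type := (quad_X q * quad_Y q)%type.
HB.instance Definition _ (q : quadruple) := GRing.Zmodule.on (quad_mod q).

Section QuadMod.
Variable q : quadruple.

Definition quad_scale (l : morita_ring K) (v : quad_mod q) : quad_mod q :=
  let: ((a, n), (m, b)) := l in
  let: (x, y) := v in
  (a *: x + quad_g q (pure n y), quad_f q (pure m x) + b *: y).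

Fact quad_scaleA l l' v : quad_scale l (quad_scale l' v) = quad_scale (l * l') v.
Proof.
case: l => [[a n] [m b]]; case: l' => [[a' n'] [m' b']]; case: v => [x y] /=.
congr (_, _).
- rewrite scalerDr scalerA pureDr linearD /= quad_gf scalerDl -!addrA.
  congr (_ + _); rewrite addrCA; congr (_ + _).
  by rewrite pureDl -scale_pure pure_bal linearD linearZ.
- rewrite pureDr linearD /= quad_fg scalerDr scalerA scalerDl.
  rewrite pureDl pure_bal -scale_pure linearD linearZ /= -!addrA.
  by congr (_ + _); rewrite !addrA; congr (_ + _); rewrite addrC.
Qed.
Fact quad_scale1 : left_id 1 quad_scale.
Proof.
by move=> [x y] /=; rewrite !pure0l !linear0 !scale1r addr0 add0r.
Qed.
Fact quad_scaleDr : right_distributive quad_scale +%R.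
Proof.
move=> [[a n] [m b]] [x y] [x' y'] /=.
by congr (_, _); rewrite pureDr linearD /= scalerDr addrACA.
Qed.
Fact quad_scaleDl v : {morph quad_scale^~ v : l l' / l + l'}.
Proof.
case: v => [x y] [[a n] [m b]] [[a' n'] [m' b']] /=.
by congr (_, _); rewrite pureDl linearD /= scalerDl addrACA.
Qed.
HB.instance Definition _ :=
  GRing.Zmodule_isLmodule.Build (morita_ring K) (quad_mod q)
    quad_scaleA quad_scale1 quad_scaleDr quad_scaleDl.
End QuadMod.

(* A class of quadruples, seen as a class of Λ-modules under the identification
   of Λ-modules with quadruples. *)
Definition quad_class (P : quadruple -> Prop) : mod_class (morita_ring K) :=
  fun L => exists q : quadruple, P q /\ lmod_iso L (quad_mod q).

Definition classM (U' : mod_class (quo_ring K)) (U'' : mod_class A) :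
    mod_class (morita_ring K) :=
  quad_class (fun q =>
    [/\ U' (tens (quo_bimod K) (coker (quad_f q))), U'' (quad_X q)
      & injective (quad_f q)]).

Definition classN (V' : mod_class (quo_ring K)) (V'' : mod_class A) :
    mod_class (morita_ring K) :=
  quad_class (fun q =>
    [/\ V' (tens (quo_bimod K) (ker (adjunct (quad_g q)))), V'' (quad_X q)
      & surjective (adjunct (quad_g q))]).
End MoritaModules.

(* Main.v *)
(** Write T(X) = (X, M ⊗_A X), H(X) = (X, Hom_A(N, X)) and Z(W) = (0, W). By the
    adjunctions, Ext^1(T(U), (X, Y)) = 0 whenever Ext^1_A(U, X) = 0, and the
    converse holds if Tor_1(M, U) = 0, as T then preserves exactness of sequences
    ending in U; dually for H(V) if Ext^1(N, V) = 0. As φ is injective, the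
    sequence 0 -> T(N) -> Λ e_B -> Z(B / Im φ) -> 0 is exact, so the vanishing of
    Ext^1(Z(B / Im φ), (X, Y)) forces g~ to be epi, and then
    Ext^1(Z(U), (X, Y)) = 0 iff Ext^1(U, Ker g~) = 0. Hence N is the right
    orthogonal of T(U'') and Z(U'). Dually, with the character module of e_B Λ in
    place of Λ e_B, M is the left orthogonal of H(V'') and Z(V'). That M and N are
    orthogonal to each other follows from 0 -> T(X) -> (X, Y) -> Z(Coker f) -> 0,
    which is exact when f is mono.

    For completeness, a module is embedded in an object of N by three pushouts,
    with cokernels T(U), a direct sum of copies of Z(B / Im φ), and Z(U'): the
    first puts X in V'', the second makes g~ epi, the third puts Ker g~ in V'. The
    other approximation sequences follow by Salce's argument. The class M is
    closed under kernels of epimorphisms by the snake lemma and the vanishing of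
    Tor_1; the dual closure of N is then formal. *)

Require Import Defs.
From HB Require Import structures.
From mathcomp Require Import all_boot all_order all_algebra.
From mathcomp Require Import boolp classical_sets functions.

Set Implicit Arguments.
Unset Strict Implicit.
Unset Printing Implicit Defensive.

Import GRing.Theory.
Local Open Scope ring_scope.

(** * Short exact sequences and extensions *)

(** Ext^1 is used only through an extension property, [ext1_zero], so each Ext argument becomes the
    extension or the lifting of a single map, without long exact sequences; resolutions occur only
    where the definitions of Ext and Tor are translated. The tensor product with B / Im φ in the two
    classes is harmless: f(m ⊗ g(n ⊗ y)) = φ(m ⊗ n) y shows that Im φ kills Ker g~ and Coker f, so
    both are already modules over B / Im φ. The same identity restricts Z(W) to modules W over B /
    Im φ. The map φ is the f of Λ e_B, and it also governs the g~ of the character module of e_B Λ;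
    its injectivity makes the former mono and the latter epi, which is what turns these two modules
    into tests for g~ being epi and f being mono. An extension of quadruples has an arbitrary
    Λ-module in the middle, which is replaced by an isomorphic quadruple before maps are built by
    components. One pushout over all maps N -> X suffices to make g~ epi, because its cokernel has
    first component 0: X stays the same up to isomorphism and no new maps N -> X arise. *)

Section LinearMaps.
Variable R : pzRingType.
Implicit Types U V W X E K : lmodType R.

Definition mklin V W (f : V -> W) (hf : linear f) : {linear V -> W} :=
  HB.pack f (GRing.isLinear.Build R V W *:%R f hf).

Lemma mklinE V W (f : V -> W) (hf : linear f) : mklin hf =1 f.
Proof. by []. Qed.

(** Maps out of quotients and into kernels are defined below by their graphs. Single-valuedness need
    only be checked at 0, since the difference of two values at [v] is a value at 0. *)
Lemma linear_graph V W (G : V -> W -> Prop) :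
    (forall v, exists w, G v w) ->
    (forall a v w v' w', G v w -> G v' w' -> G (a *: v + v') (a *: w + w')) ->
    (forall w, G 0 w -> w = 0) ->
  exists f : {linear V -> W}, forall v w, f v = w <-> G v w.
Proof.
move=> Gt GD G0; have [f Gf] := choice Gt.
have Gu v w w' : G v w -> G v w' -> w = w'.
  move=> h h'; apply/eqP; rewrite -subr_eq0 addrC -scaleN1r; apply/eqP/G0.
  by rewrite -(addNr v) -scaleN1r; apply: GD.
have fl : linear f by move=> a v v'; apply: Gu (Gf _) _; apply: GD.
exists (mklin fl) => v w; split=> [<-|h]; first exact: Gf.
exact: Gu (Gf _) h.
Qed.

Definition lcomp U V W (g : {linear V -> W}) (f : {linear U -> V}) :
  {linear U -> W} := g \o f.

Lemma linv V W (f : {linear V -> W}) : bijective f ->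
  exists2 g : {linear W -> V}, cancel f g & cancel g f.
Proof.
case=> g fg gf; have gl : linear g.
  by move=> a x y; apply: (can_inj fg); rewrite linearP !gf.
by exists (mklin gl).
Qed.

Lemma inj_surj_bij V W (f : {linear V -> W}) :
  injective f -> surjective f -> bijective f.
Proof.
move=> fi fs; have [g gf] := choice fs.
by exists g => // x; apply: fi.
Qed.

Lemma lmod_iso_sym V W : lmod_iso V W -> lmod_iso W V.
Proof. by case=> f /linv[g fg gf]; exists g; exists f. Qed.

Lemma lmod_iso_refl V : lmod_iso V V.
Proof. by exists (idfun : {linear V -> V}); exists idfun. Qed.

Lemma lmod_iso_trans V W X : lmod_iso V W -> lmod_iso W X -> lmod_iso V X.
Proof.
move=> [f fb] [g gb]; exists (lcomp g f); exact: bij_comp.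
Qed.

Lemma linear_inj V W (f : {linear V -> W}) :
  (forall v, f v = 0 -> v = 0) -> injective f.
Proof.
move=> h x y e; apply/eqP; rewrite -subr_eq0; apply/eqP/h.
by rewrite linearB e subrr.
Qed.

Lemma ses_comp0 U V W (i : {linear U -> V}) (p : {linear V -> W}) u :
  short_exact i p -> p (i u) = 0.
Proof. by case=> _ ex _; apply/ex; exists u. Qed.

Lemma to_cokerZ V W (f : {linear V -> W}) a w :
  to_coker f (a *: w) = a *: to_coker f w.
Proof. by rewrite -coker_scaleE. Qed.

Fact to_coker_linear V W (f : {linear V -> W}) : linear (to_coker f).
Proof. by move=> a x y; rewrite to_cokerD to_cokerZ. Qed.
HB.instance Definition _ V W (f : {linear V -> W}) :=
  GRing.isLinear.Build R W (coker f) *:%R (to_coker f) (to_coker_linear f).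

Lemma to_coker0P V W (f : {linear V -> W}) w :
  to_coker f w = 0 <-> exists v, f v = w.
Proof. by rewrite -(linear0 (to_coker f)) to_cokerP subr0. Qed.

Lemma to_coker_surj V W (f : {linear V -> W}) : surjective (to_coker f).
Proof. by move=> c; exists (repr c); rewrite to_cokerK. Qed.

Lemma coker_lift V W X (f : {linear V -> W}) (h : {linear W -> X}) :
  (forall v, h (f v) = 0) ->
  exists k : {linear coker f -> X}, forall w, k (to_coker f w) = h w.
Proof.
move=> hf.
have [|a c x c' x' [w <- <-] [w' <- <-]|x [w /to_coker0P[v <-] <-]|k kP] :=
    linear_graph (G := fun c x => exists2 w, to_coker f w = c & h w = x).
- by move=> c; exists (h (repr c)); exists (repr c); rewrite ?to_cokerK.
- by exists (a *: w + w'); rewrite linearP.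
- exact: hf.
by exists k => w; apply/kP; exists w.
Qed.

Lemma ses_coker V W (f : {linear V -> W}) :
  injective f -> short_exact f (to_coker f).
Proof.
by move=> fi; split=> // [w|]; [exact: to_coker0P|exact: to_coker_surj].
Qed.

Fact ker_val_linear V W (f : {linear V -> W}) : linear (@ker_val _ _ _ f).
Proof. by []. Qed.
HB.instance Definition _ V W (f : {linear V -> W}) :=
  GRing.isLinear.Build R (ker f) V *:%R (@ker_val _ _ _ f) (ker_val_linear (f := f)).

Lemma ker_valK V W (f : {linear V -> W}) (k : ker f) : f (ker_val k) = 0.
Proof. by apply/eqP; exact: (valP k). Qed.

Lemma ker_val_inj V W (f : {linear V -> W}) : injective (@ker_val _ _ _ f).
Proof. exact: val_inj. Qed.

Lemma kerP V W (f : {linear V -> W}) v :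
  f v = 0 <-> exists k : ker f, ker_val k = v.
Proof.
split=> [h|[k <-]]; last exact: ker_valK.
have h' : v \in ker_pred f by rewrite unfold_in; apply/eqP.
by exists (Ker h').
Qed.

Lemma ker_corestrict U V W (f : {linear V -> W}) (h : {linear U -> V}) :
  (forall u, f (h u) = 0) ->
  exists k : {linear U -> ker f}, forall u, ker_val (k u) = h u.
Proof.
move=> fh.
have [|a c x c' x' e e'|x e|k kP] :=
    linear_graph (G := fun u (k : ker f) => ker_val k = h u).
- by move=> u; apply/kerP.
- by rewrite ker_val_linear e e' linearP.
- by apply: ker_val_inj; apply: etrans e _; rewrite linear0.
by exists k => u; apply/kP.
Qed.

Lemma ses_ker V W (f : {linear V -> W}) :
  surjective f -> short_exact (@ker_val _ _ _ f) f.
Proof. by move=> fs; split=> // [|w]; [exact: ker_val_inj|exact: kerP]. Qed.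

Lemma ses_lift U V W X (i : {linear U -> V}) (p : {linear V -> W})
    (h : {linear X -> V}) : short_exact i p -> (forall x, p (h x) = 0) ->
  exists k : {linear X -> U}, forall x, i (k x) = h x.
Proof.
move=> [ii ex _] ph.
have [|a c x c' x' e e'|x e|k kP] :=
    linear_graph (G := fun x u => i u = h x).
- by move=> x; apply/ex.
- by rewrite !linearP e e'.
- by apply: ii; rewrite e !linear0.
by exists k => u; apply/kP.
Qed.

Lemma ses_fact U V W X (i : {linear U -> V}) (p : {linear V -> W})
    (h : {linear V -> X}) : short_exact i p -> (forall u, h (i u) = 0) ->
  exists k : {linear W -> X}, forall v, k (p v) = h v.
Proof.
move=> [ii ex ps] hi.
have [|a c x c' x' [w <- <-] [w' <- <-]|x [w /ex[v <-] <-]|k kP] :=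
    linear_graph (G := fun c x => exists2 w, p w = c & h w = x).
- by move=> c; have [v <-] := ps c; exists (h v); exists v.
- by exists (a *: w + w'); rewrite linearP.
- exact: hi.
by exists k => w; apply/kP; exists w.
Qed.

Fact pair_linear U V W (f : {linear U -> V}) (g : {linear U -> W}) :
  linear (fun u => (f u, g u) : (V * W)%type).
Proof. by move=> a x y; rewrite !linearP. Qed.

Fact fst_linear U V : linear (fst : (U * V)%type -> U). Proof. by []. Qed.
Fact snd_linear U V : linear (snd : (U * V)%type -> V). Proof. by []. Qed.

Fact copair_linear U V W (f : {linear U -> W}) (g : {linear V -> W}) :
  linear (fun x : (U * V)%type => f x.1 + g x.2).
Proof. by move=> a x y; rewrite /= !linearP scalerDr addrACA. Qed.

(** The pushout is the cokernel of k ↦ (i k, - h k). Its last clause, that the two legs jointly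
    cover [E'], stands in for the universal property later on. *)
Lemma pushout K E X V (i : {linear K -> E}) (p : {linear E -> X})
    (h : {linear K -> V}) : short_exact i p ->
  exists (E' : lmodType R) (i' : {linear V -> E'}) (p' : {linear E' -> X})
      (h' : {linear E -> E'}),
    [/\ short_exact i' p', forall k, h' (i k) = i' (h k),
        forall e, p' (h' e) = p e
      & forall e', exists v e, e' = i' v + h' e].
Proof.
move=> [ii ex ps]; pose d := mklin (pair_linear i (\- h)).
pose q : {linear _ -> _} := to_coker d.
have zl : linear (fun _ : V => 0 : E) by move=> a x y; rewrite scaler0 addr0.
have zr : linear (fun _ : E => 0 : V) by move=> a x y; rewrite scaler0 addr0.
pose i' := lcomp q (mklin (pair_linear (mklin zl) idfun)).
pose h' := lcomp q (mklin (pair_linear idfun (mklin zr))).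
have qE e v : q (e, v) = i' v + h' e.
  by rewrite /= -linearD; congr (to_coker _ (_, _)) => /=; rewrite ?add0r ?addr0.
have [|p' p'E] := coker_lift (f := d) (h := lcomp p (mklin (@fst_linear E V))).
  by move=> k /=; apply/ex; exists k.
have h'i k : h' (i k) = i' (h k).
  apply/eqP; rewrite -subr_eq0 -linearN addrC -qE; apply/eqP/to_coker0P.
  by exists k.
have p'i' v : p' (i' v) = 0 by rewrite [LHS]p'E /= linear0.
have p'h' e : p' (h' e) = p e by rewrite [LHS]p'E.
have sur e' : exists v e, e' = i' v + h' e.
  by have [[e v] <-] := to_coker_surj e'; exists v, e; rewrite -qE.
exists (coker d), i', p', h'; split=> //; split.
- apply: linear_inj => v /to_coker0P[k [ek <-]].
  have -> : k = 0 by apply: ii; rewrite ek linear0.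
  by rewrite linear0 oppr0.
- move=> e'; split=> [|[v <-] //]; have [v [e ->]] := sur e'.
  rewrite linearD p'i' add0r p'h' => /ex[k <-].
  by exists (v + h k); rewrite linearD h'i.
- by move=> x; have [e <-] := ps x; exists (h' e); rewrite p'h'.
Qed.

(** The pullback is the kernel of (e, x) ↦ p e - h x. *)
Lemma pullback V E W X (i : {linear V -> E}) (p : {linear E -> W})
    (h : {linear X -> W}) : short_exact i p ->
  exists (E' : lmodType R) (i' : {linear V -> E'}) (p' : {linear E' -> X})
      (h' : {linear E' -> E}),
    [/\ short_exact i' p', forall e', p (h' e') = h (p' e')
      & forall v, h' (i' v) = i v].
Proof.
move=> [ii ex ps].
pose d : {linear (E * X)%type -> W} := mklin (copair_linear p (\- h)).
have dE e x : d (e, x) = p e - h x by [].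
pose j : {linear ker d -> _} := @ker_val _ _ _ d.
pose h' := lcomp (mklin (@fst_linear E X)) j.
pose p' := lcomp (mklin (@snd_linear E X)) j.
have zr : linear (fun _ : V => 0 : X) by move=> a x y; rewrite scaler0 addr0.
have [|i' i'E] := ker_corestrict (f := d) (h := mklin (pair_linear i (mklin zr))).
  move=> v; rewrite [d _]dE /= linear0 subr0.
  by apply/ex; exists v.
exists (ker d), i', p', h'; split.
- split.
  + apply: linear_inj => v e; have := i'E v; rewrite e linear0 /=.
    by move=> [e0]; apply: ii; rewrite -e0 linear0.
  + move=> k; split=> [e|[v <-]]; last by rewrite /= i'E.
    have kE : ker_val k = (h' k, 0) by rewrite -e; exact: surjective_pairing.
    have := ker_valK k; rewrite kE dE linear0 subr0 => /ex[v ev].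
    by exists v; apply: ker_val_inj; rewrite i'E /= ev kE.
  + move=> x; have [e pe] := ps (h x).
    have [k ke] : exists k : ker d, ker_val k = (e, x).
      by apply/kerP; rewrite dE pe subrr.
    by exists k; rewrite /= ke.
- by move=> k; apply/eqP; rewrite -subr_eq0; apply/eqP; exact: (ker_valK k).
- by move=> v; rewrite /= i'E.
Qed.

(** The map e ↦ e - i (r e) kills the image of [i], hence factors through [p]; the factor is the
    section. *)
Lemma ses_section V E X (i : {linear V -> E}) (p : {linear E -> X})
    (r : {linear E -> V}) : short_exact i p -> (forall v, r (i v) = v) ->
  exists s : {linear X -> E}, forall x, p (s x) = x.
Proof.
move=> es ri;
have cl : linear (fun e => e - i (r e)).
  by move=> a x y; rewrite !linearP scalerDr addrACA.
have [|s sE] := ses_fact (h := mklin cl) es.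
  by move=> v; rewrite /= ri subrr.
have [_ _ ps] := es.
exists s => x; have [e <-] := ps x.
by rewrite sE /= linearB /= (ses_comp0 _ es) subr0.
Qed.

Lemma ses_retraction V E X (i : {linear V -> E}) (p : {linear E -> X})
    (s : {linear X -> E}) : short_exact i p -> (forall x, p (s x) = x) ->
  exists r : {linear E -> V}, forall v, r (i v) = v.
Proof.
move=> es sp.
have cl : linear (fun e => e - s (p e)).
  by move=> a x y; rewrite !linearP scalerDr addrACA.
have [|r rE] := ses_lift (h := mklin cl) es.
  by move=> e; rewrite /= linearB /= sp subrr.
exists r => v; have [ii _ _] := es; apply: ii.
by rewrite rE /= (ses_comp0 _ es) linear0 subr0.
Qed.

(* By pushout, this means that every extension of X by V splits. *)
Definition ext1_zero X V : Prop :=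
  forall K E (i : {linear K -> E}) (p : {linear E -> X}), short_exact i p ->
  forall h : {linear K -> V}, exists k : {linear E -> V}, forall x, k (i x) = h x.

(** The pullback along [h] is an extension of [X] by [V], so it splits; a section followed by the
    leg into [E] is the lift. *)
Lemma ext1_lift X V E W (i : {linear V -> E}) (p : {linear E -> W})
    (h : {linear X -> W}) : ext1_zero X V -> short_exact i p ->
  exists k : {linear X -> E}, forall x, p (k x) = h x.
Proof.
move=> xv es; have [E' [i' [p' [h' [es' ph' hi']]]]] := pullback h es.
have [r ri] := xv _ _ _ _ es' idfun.
have [s ps] := ses_section es' ri.
by exists (lcomp h' s) => x; rewrite /= ph' ps.
Qed.

Lemma ext1_retraction X V :
  (forall E (i : {linear V -> E}) (p : {linear E -> X}), short_exact i p ->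
    exists r : {linear E -> V}, forall v, r (i v) = v) -> ext1_zero X V.
Proof.
move=> H K E i p es h; have [E' [i' [p' [h' [es' h'i _ _]]]]] := pushout h es.
have [r ri] := H _ _ _ es'.
by exists (lcomp r h') => x; rewrite /= h'i ri.
Qed.

Lemma ext1_section X V :
  (forall E (i : {linear V -> E}) (p : {linear E -> X}), short_exact i p ->
    exists s : {linear X -> E}, forall x, p (s x) = x) -> ext1_zero X V.
Proof.
move=> H; apply: ext1_retraction => E i p es; have [s sp] := H _ _ _ es.
exact: ses_retraction es sp.
Qed.

Lemma ses_iso_r K E X X' (i : {linear K -> E}) (p : {linear E -> X})
    (f : {linear X -> X'}) : bijective f ->
  short_exact i p -> short_exact i (lcomp f p).
Proof.
move=> /linv[g fg gf] [ii ex ps]; split=> // [e|x].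
  by rewrite -ex; split=> [/(congr1 g)|/= ->]; rewrite ?linear0 //= fg.
by have [e ee] := ps (g x); exists e; rewrite /= ee.
Qed.

Lemma ext1_iso X X' V V' : lmod_iso X X' -> lmod_iso V V' ->
  ext1_zero X V -> ext1_zero X' V'.
Proof.
move=> [f fb] [g /linv[g' gg' g'g]] xv K E i p es h.
have [f' ff' f'f] := linv fb.
have f'b : bijective f' by exists f.
have [k kE] := xv _ _ _ _ (ses_iso_r f'b es) (lcomp g' h).
by exists (lcomp g k) => x; rewrite /= kE /= g'g.
Qed.

(** Let [E1] be the preimage of [X1] in [E]. The map [h] extends from [K] to [E1], as [E1 / K] is
    [X1], and then from [E1] to [E], as [E / E1] is [X2]. *)
Lemma ext1_ext X1 X X2 V (i : {linear X1 -> X}) (p : {linear X -> X2}) :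
  short_exact i p -> ext1_zero X1 V -> ext1_zero X2 V -> ext1_zero X V.
Proof.
move=> es x1v x2v K E j q es' h.
have [E1 [j1 [q1 [i1 [es1 qi1 i1j]]]]] := pullback i es'.
have [h1 h1E] := x1v _ _ _ _ es1 h.
have es2 : short_exact i1 (lcomp p q).
  have [ii ex ps] := es; have [ji ejq qs] := es'; have [j1i ej1 q1s] := es1.
  split.
  - apply: linear_inj => e e0; have : q1 e = 0.
      by apply: ii; rewrite -qi1 e0 !linear0.
    move=> /ej1[k ke]; move: e0; rewrite -ke i1j => jk.
    by have -> : k = 0 by [apply: ji; rewrite jk linear0]; rewrite linear0.
  - move=> e; split=> [/ex[x xe]|[e1 <-]]; last by rewrite /= qi1 (ses_comp0 _ es).
    have [e1 e1x] := q1s x.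
    have /ejq[k ke] : q (e - i1 e1) = 0 by rewrite linearB qi1 e1x xe subrr.
    by exists (e1 + j1 k); rewrite linearD i1j ke addrC subrK.
  - by move=> x; have [y <-] := ps x; have [e <-] := qs y; exists e.
have [h2 h2E] := x2v _ _ _ _ es2 h1.
by exists h2 => k; rewrite -i1j h2E h1E.
Qed.

Lemma ext1_projective X V : projective X -> ext1_zero X V.
Proof.
move=> Xp; apply: ext1_section => E i p [_ _ ps].
by have [s sE] := Xp _ _ p idfun ps; exists s.
Qed.
End LinearMaps.

(** * Direct sums and free modules *)

Section DirectSum.
Variables (R : pzRingType) (I : choiceType) (W : lmodType R).

Definition dsum_pred : {pred I -> W} :=
  fun f => `[< exists s : seq I, forall i, f i != 0 -> i \in s >].

Fact dsum_pred_submod : submod_closed dsum_pred.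
Proof.
split=> [|a f g]; rewrite !unfold_in.
  by apply/asboolP; exists [::] => i; rewrite eqxx.
move=> /asboolP[s sP] /asboolP[t tP]; apply/asboolP; exists (s ++ t) => i.
rewrite mem_cat; apply: contraNT; rewrite negb_or => /andP[si ti].
have -> : (a *: f + g) i = a *: f i + g i by [].
have /eqP-> : f i == 0 by apply: contraNT si; apply: sP.
have /eqP-> : g i == 0 by apply: contraNT ti; apply: tP.
by rewrite scaler0 addr0.
Qed.

HB.instance Definition _ :=
  GRing.isSubmodClosed.Build R (I -> W) dsum_pred dsum_pred_submod.

Record dsum : Type := Dsum { dsum_val : I -> W; _ : dsum_val \in dsum_pred }.
HB.instance Definition _ := [isSub for dsum_val].
HB.instance Definition _ := [Choice of dsum by <:].
HB.instance Definition _ := [SubChoice_isSubLmodule of dsum by <:].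

Lemma dsum_valP (a : R) (f g : dsum) i :
  dsum_val (a *: f + g) i = a *: dsum_val f i + dsum_val g i.
Proof. by []. Qed.

Lemma dsum_ext (f g : dsum) : dsum_val f =1 dsum_val g -> f = g.
Proof. by move=> fg; apply: val_inj; apply: funext. Qed.

Definition dsum_inc_fun (i : I) (w : W) : I -> W := fun j => if j == i then w else 0.
Fact dsum_inc_subproof i w : dsum_inc_fun i w \in dsum_pred.
Proof.
rewrite unfold_in; apply/asboolP; exists [:: i] => j.
by rewrite /dsum_inc_fun inE; case: (j == i); rewrite ?eqxx.
Qed.
Definition dsum_inc i w : dsum := Dsum (dsum_inc_subproof i w).
Fact dsum_inc_linear i : linear (dsum_inc i).
Proof.
move=> a w w'; apply: dsum_ext => j; rewrite dsum_valP /= /dsum_inc_fun.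
by case: eqP => // _; rewrite scaler0 addr0.
Qed.
HB.instance Definition _ i :=
  GRing.isLinear.Build R W dsum *:%R (dsum_inc i) (dsum_inc_linear i).

Fact dsum_proj_linear i : linear (fun f : dsum => dsum_val f i).
Proof. by []. Qed.
Definition dsum_proj i := mklin (dsum_proj_linear i).

Lemma dsum_supp (f : dsum) :
  exists2 s : seq I, uniq s & forall i, i \notin s -> dsum_val f i = 0.
Proof.
have := valP f; rewrite unfold_in => /asboolP[s sP].
exists (undup s); first exact: undup_uniq.
by move=> i; rewrite mem_undup => si; apply/eqP; apply: contraNT si; apply: sP.
Qed.

Lemma dsum_sumE (f : dsum) (s : seq I) : uniq s ->
    (forall i, i \notin s -> dsum_val f i = 0) ->
  f = \sum_(i <- s) dsum_inc i (dsum_val f i).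
Proof.
move=> us fs; apply: dsum_ext => j.
rewrite -[RHS]/(dsum_proj j _) linear_sum /=.
rewrite /dsum_inc_fun; case: (boolP (j \in s)) => js.
  rewrite (bigD1_seq j) //= eqxx big1 ?addr0 // => i ij.
  by rewrite eq_sym (negPf ij).
rewrite fs // big_seq big1 // => i si.
by case: eqP => // ij; rewrite ij si in js.
Qed.

Lemma dsum_lift (V : lmodType R) (u : forall i : I, {linear W -> V}) :
  exists h : {linear dsum -> V}, forall i w, h (dsum_inc i w) = u i w.
Proof.
pose G (f : dsum) (v : V) := exists s : seq I,
  [/\ uniq s, forall i, i \notin s -> dsum_val f i = 0 &
      v = \sum_(i <- s) u i (dsum_val f i)].
(* The sum is the same over every duplicate-free list covering the support, so two elements can be
   added over a common list. *)
have ext (f : dsum) s t : uniq s -> uniq t -> {subset s <= t} ->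
    (forall i, i \notin s -> dsum_val f i = 0) ->
    \sum_(i <- s) u i (dsum_val f i) = \sum_(i <- t) u i (dsum_val f i).
  move=> us ut st fs; rewrite [RHS](bigID [in s]) /= [X in _ + X]big1; last first.
    by move=> i /fs ->; rewrite linear0.
  rewrite addr0 -[RHS]big_filter; apply: perm_big; apply: uniq_perm => //.
    exact: filter_uniq.
  by move=> i; rewrite mem_filter; case: (boolP (i \in s)) => // /st ->.
have [||v|h hP] := linear_graph (G := G).
- by move=> f; have [s us sP] := dsum_supp f; exists (\sum_(i <- s) u i (dsum_val f i)), s.
- move=> a f _ f' _ [s [us sP ->]] [s' [us' sP' ->]].
  have uu := undup_uniq (s ++ s').
  exists (undup (s ++ s')); split=> //.
    move=> i; rewrite mem_undup mem_cat negb_or => /andP[si si'].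
    by rewrite dsum_valP sP // sP' // scaler0 addr0.
  rewrite (ext f s (undup (s ++ s'))) //; last first.
    by move=> i; rewrite mem_undup mem_cat => ->.
  rewrite (ext f' s' (undup (s ++ s'))) //; last first.
    by move=> i; rewrite mem_undup mem_cat orbC => ->.
  rewrite scaler_sumr -big_split; apply: eq_bigr => i _.
  by rewrite dsum_valP linearP.
- by move=> [s [_ _ ->]]; apply: big1 => i _; rewrite linear0.
exists h => i w; apply/hP; exists [:: i]; split=> //.
  by move=> j; rewrite inE /= /dsum_inc_fun => /negPf->.
by rewrite big_seq1 /= /dsum_inc_fun eqxx.
Qed.

Lemma dsum_hom_ext (V : lmodType R) (h k : {linear dsum -> V}) :
  (forall i w, h (dsum_inc i w) = k (dsum_inc i w)) -> h =1 k.
Proof.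
move=> hk f; have [s us sP] := dsum_supp f; rewrite (dsum_sumE us sP).
by rewrite !linear_sum; apply: eq_bigr => i _; exact: hk.
Qed.

(** Each summand inclusion lifts through the extension, and the lifts assemble to a section. *)
Lemma ext1_dsum (V : lmodType R) : ext1_zero W V -> ext1_zero dsum V.
Proof.
move=> wv; apply: ext1_section => E i p es.
have lift j := ext1_lift (dsum_inc (j : I)) wv es.
have [s sE] := choice lift.
have [t tE] := dsum_lift s.
exists t; apply: (dsum_hom_ext (h := lcomp p t) (k := idfun)) => j w.
by rewrite /= tE sE.
Qed.
End DirectSum.

Section DirectSumMap.
Variables (R : pzRingType) (I : choiceType) (W W' : lmodType R).
Variable f : {linear W -> W'}.

Lemma dsum_map_exists : exists F : {linear dsum I W -> dsum I W'},
  forall x i, dsum_val (F x) i = f (dsum_val x i).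
Proof.
have [F FE] := dsum_lift (fun i : I => lcomp (@dsum_inc R I W' i) f).
exists F => x i.
apply: (@dsum_hom_ext _ _ _ _ (lcomp (dsum_proj W' i) F)
                              (lcomp f (dsum_proj W i))) => j w /=.
by rewrite FE /= /dsum_inc_fun; case: eqP; rewrite ?linear0.
Qed.
End DirectSumMap.

Lemma ses_dsum (R : pzRingType) (I : choiceType) (U V W : lmodType R)
    (i : {linear U -> V}) (p : {linear V -> W}) : short_exact i p ->
  exists (i' : {linear dsum I U -> dsum I V}) (p' : {linear dsum I V -> dsum I W}),
    [/\ short_exact i' p',
        forall x j, dsum_val (i' x) j = i (dsum_val x j)
      & forall x j, dsum_val (p' x) j = p (dsum_val x j)].
Proof.
move=> [ii ex ps].
have [i' i'E] := @dsum_map_exists R I _ _ i.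
have [p' p'E] := @dsum_map_exists R I _ _ p.
exists i', p'; split=> //; split.
- move=> x y e; apply: dsum_ext => j; apply: ii.
  by rewrite -!i'E e.
- move=> y; split=> [e|[x <-]]; last first.
    by apply: dsum_ext => j; rewrite p'E i'E; apply/ex; exists (dsum_val x j).
  have hx j : exists u, i u = dsum_val y j by apply/ex; rewrite -p'E e.
  have [h hE] := choice hx.
  (* Pointwise preimages have finite support because [i] is injective: the preimage of 0 is 0. *)
  have hD : h \in @dsum_pred R I U.
    have [s _ sP] := dsum_supp y; rewrite unfold_in; apply/asboolP; exists s => j.
    apply: contraNT => js; apply/eqP/ii.
    by rewrite hE sP // linear0.
  by exists (Dsum hD); apply: dsum_ext => j; rewrite i'E hE.
- move=> z; have [s us sP] := dsum_supp z.
  have [h hE] := choice (fun j => ps (dsum_val z j)).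
  (* The chosen preimage of 0 under [p] need not be 0, so only the indices in [s] are used. *)
  exists (\sum_(j <- s) dsum_inc j (h j)).
  rewrite [RHS](dsum_sumE us sP) linear_sum; apply: eq_bigr => j _.
  apply: dsum_ext => k; rewrite p'E /= /dsum_inc_fun.
  by case: eqP => _; rewrite ?hE ?linear0.
Qed.

(** * Free resolutions and the comparison with Ext^1 *)

Section Free.
Variable R : pzRingType.
Implicit Types V W X : lmodType R.

Definition free_mod (I : choiceType) : lmodType R := dsum I R^o.

Fact scale_linear V (v : V) : linear (fun r : R^o => (r : R) *: v).
Proof. by move=> a r s; rewrite scalerDl scalerA. Qed.

Lemma free_lift (I : choiceType) V (u : I -> V) :
  exists h : {linear free_mod I -> V}, forall i, h (dsum_inc i (1 : R^o)) = u i.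
Proof.
have [h hE] := dsum_lift (fun i : I => mklin (scale_linear (u i))).
by exists h => i; rewrite hE /= scale1r.
Qed.

Lemma scale_surj_ext V (h k : {linear R^o -> V}) : h 1 = k 1 -> h =1 k.
Proof.
by move=> e r; rewrite -[r](@mulr1 R) -[r * 1]/(r *: (1 : R^o)) !linearZ e.
Qed.

Lemma projective_free (I : choiceType) : projective (free_mod I).
Proof.
move=> V W p h ps.
have [u uE] := choice (fun i : I => ps (h (dsum_inc i (1 : R^o)))).
have [k kE] := free_lift u; exists k.
apply: (dsum_hom_ext (h := lcomp p k)) => i.
apply: (scale_surj_ext (h := lcomp (lcomp p k) (dsum_inc i))
                       (k := lcomp h (dsum_inc i))).
by rewrite /= kE.
Qed.

Lemma free_cover_exists V :
  exists h : {linear free_mod V -> V}, surjective h.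
Proof.
have [h hE] := free_lift (fun v : V => v).
by exists h => v; exists (dsum_inc v (1 : R^o)).
Qed.

Definition free_cover V : {linear free_mod V -> V} :=
  projT1 (cid (free_cover_exists V)).
Lemma free_cover_surj V : surjective (free_cover V).
Proof. exact: projT2 (cid (free_cover_exists V)). Qed.

(* The successive steps of a free resolution. *)
Record stage := Stage {
  stage_src : lmodType R; stage_tgt : lmodType R;
  stage_map : {linear stage_src -> stage_tgt} }.

Definition next_stage (s : stage) : stage :=
  Stage (lcomp (@ker_val _ _ _ (stage_map s)) (free_cover (ker (stage_map s)))).

Definition stages V n := iter n next_stage (Stage (free_cover V)).

Lemma stage_exact (s : stage) : exact_at (stage_map (next_stage s)) (stage_map s).
Proof.
move=> x; split=> [/kerP[k <-]|[y <-]]; last exact: ker_valK.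
by have [y <-] := free_cover_surj k; exists y.
Qed.

Lemma proj_resolution_exists V : inhabited (proj_resolution V).
Proof.
have P n : projective (stage_src (stages V n)).
  by case: n => [|n]; exact: projective_free.
have ex n : exact_at (stage_map (stages V n.+2)) (stage_map (stages V n.+1)).
  exact: stage_exact.
have ex0 : exact_at (stage_map (stages V 1)) (stage_map (stages V 0)).
  exact: stage_exact.
exact: (inhabits (@ProjResolution _ V (fun n => stage_src (stages V n))
  (fun n => stage_map (stages V n.+1)) (stage_map (stages V 0))
  P (@free_cover_surj V) ex0 ex)).
Qed.

(** A map on P_1 that vanishes on the image of P_2 is a map on the kernel of P_0 -> X. The forward
    direction needs just one resolution, a free one; the backward direction yields the condition for
    every resolution. *)
Lemma Ext1P X V : Ext1_vanishes X V <-> ext1_zero X V.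
Proof.
split=> [xv K E i p es h|xv P h].
  have [P] := proj_resolution_exists X.
  have [ii ex ps] := es.
  have [al alE] := @res_projective _ _ P 0%N _ _ p (res_aug P) ps.
  have augd y : res_aug P (res_d P 0 y) = 0 by apply/res_exact0; exists y.
  have [|be beE] := ses_lift (h := lcomp al (res_d P 0)) es.
    by move=> y; rewrite /= alE augd.
  have [|k kE] := (xv P (lcomp h be)).1.
    move=> z /=; have -> : be (res_d P 1 z) = 0; last exact: linear0.
    apply: ii; rewrite beE /= linear0.
    have -> : res_d P 0 (res_d P 1 z) = 0 by apply/res_exact; exists z.
    exact: linear0.
  (* [E] is the quotient of P_0 ⊕ K by the pairs (d y, - be y), on which (x, c) ↦ k x + h c
     vanishes. *)
  pose G e v := exists x0 c, e = al x0 + i c /\ v = k x0 + h c.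
  have [||v|l lP] := linear_graph (G := G).
  - move=> e; have [x0 x0e] := res_aug_surj P (p e).
    have /ex[c ce] : p (e - al x0) = 0 by rewrite linearB alE x0e subrr.
    by exists (k x0 + h c), x0, c; rewrite ce addrC subrK.
  - move=> a _ _ _ _ [x [c [-> ->]]] [x' [c' [-> ->]]].
    exists (a *: x + x'), (a *: c + c').
    by rewrite !linearP; split; rewrite scalerDr addrACA.
  - move=> [x [c [e0 ->]]].
    have /res_exact0[y ye] : res_aug P x = 0.
      have := congr1 p e0.
      by rewrite linearD alE (ses_comp0 c es) addr0 linear0.
    have cy : c = - be y.
      apply: ii; rewrite linearN beE /= ye; apply/eqP.
      by rewrite -addr_eq0 addrC -e0.
    by rewrite cy linearN -[h (be y)]kE ye subrr.
  have lG x0 c : l (al x0 + i c) = k x0 + h c by apply/lP; exists x0, c.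
  exists l => c; have := lG 0 c; rewrite !linear0 !add0r; exact.
split=> [h1|[k kE] z]; last first.
  have dd : res_d P 0 (res_d P 1 z) = 0 by apply/res_exact; exists z.
  by rewrite -kE dd linear0.
have es := ses_ker (@res_aug_surj _ _ P).
have ds y : res_aug P (res_d P 0 y) = 0 by apply/res_exact0; exists y.
have [d' d'E] := ker_corestrict ds.
(* Two preimages of [c] in P_1 differ by an element of the image of P_2, where [h] vanishes. *)
pose G (c : ker (res_aug P)) v := exists2 y, d' y = c & h y = v.
have [||v|h' h'P] := linear_graph (G := G).
- move=> c; have /res_exact0[y ye] := ker_valK c.
  by exists (h y), y => //; apply: ker_val_inj; rewrite d'E.
- move=> a _ _ _ _ [y <- <-] [y' <- <-].
  by exists (a *: y + y'); rewrite linearP.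
- move=> [y y0 <-]; have /res_exact[z <-] : res_d P 0 y = 0.
    by rewrite -d'E y0.
  exact: h1.
have [k kE] := xv _ _ _ _ es h'.
exists k => y; rewrite -d'E kE; apply/h'P.
by exists y.
Qed.
End Free.

(** * Tensor products *)

Section TensorExact.
Variables (R S : pzRingType) (M : bimodType R S).
Implicit Types X Y Z K E W : lmodType S.

Lemma tens_hom_ext X (T : lmodType R) (h k : {linear tens M X -> T}) :
  (forall m x, h (pure m x) = k (pure m x)) -> h =1 k.
Proof. by apply: tens_ext => t u; rewrite linearD. Qed.

Section Lift.
Variables (X : lmodType S) (T : lmodType R) (b : M -> X -> T).
Hypothesis bb : balanced b.
Hypothesis bZ : forall r m x, b (r *: m) x = r *: b m x.

Fact tens_lift_linear : linear (tens_lift b).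
Proof.
move=> r t u; rewrite tens_liftD //; congr (_ + _); move: t.
apply: tens_ext => [t t'|t t'|m x]; rewrite ?scalerDr ?tens_liftD ?scalerDr //.
by rewrite scale_pure !tens_liftE.
Qed.

(* The opaque witness keeps simplification from unfolding tens_hom to tens_lift. *)
Lemma tens_hom_spec :
  {h : {linear tens M X -> T} | forall m x, h (pure m x) = b m x}.
Proof. by exists (mklin tens_lift_linear) => m x; exact: tens_liftE. Qed.

Definition tens_hom : {linear tens M X -> T} := sval tens_hom_spec.

Lemma tens_homE m x : tens_hom (pure m x) = b m x.
Proof. exact: (svalP tens_hom_spec). Qed.
End Lift.

Lemma tens_map_comp X Y Z (g : {linear Y -> Z}) (f : {linear X -> Y}) t :
  tens_map M (lcomp g f) t = tens_map M g (tens_map M f t).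
Proof.
apply: (@tens_hom_ext _ _ _ (lcomp (tens_map M g) (tens_map M f))) => m x.
by rewrite /= !tens_mapE.
Qed.

Lemma tens_map_id X t : tens_map M (idfun : {linear X -> X}) t = t.
Proof.
by apply: (@tens_hom_ext _ _ _ idfun) => m x; rewrite /= tens_mapE.
Qed.

Lemma eq_tens_map X Y (f g : {linear X -> Y}) : f =1 g ->
  tens_map M f =1 tens_map M g.
Proof. by move=> fg; rewrite (linear_ext fg). Qed.

Lemma tens_map0 X Y (f : {linear X -> Y}) t : (forall x, f x = 0) ->
  tens_map M f t = 0.
Proof.
move=> f0; apply: (@tens_hom_ext _ _ (tens_map M f) \0) => m x.
by rewrite /= tens_mapE f0 pure0r.
Qed.

Lemma tens_map_surj X Y (f : {linear X -> Y}) : surjective f ->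
  surjective (tens_map M f).
Proof.
move=> fs t; have [s ->] := tensE t; elim: s => [|[m y] s [u uE]].
  by exists 0; rewrite linear0 big_nil.
have [x <-] := fs y; exists (pure m x + u).
by rewrite linearD /= uE tens_mapE big_cons.
Qed.

(** A set-theoretic section [s] of [p] induces M ⊗ X -> Coker (M ⊗ i). Changing [s x] by an element
    of the image of [i] does not change the class of m ⊗ s x, so the formula is balanced although
    [s] is not linear. *)
Lemma tens_right_exact K E X (i : {linear K -> E}) (p : {linear E -> X}) :
  exact_at i p -> surjective p -> exact_at (tens_map M i) (tens_map M p).
Proof.
move=> ex ps t; split=> [|[k <-]]; last first.
  rewrite -tens_map_comp; apply: tens_map0 => x /=.
  by apply/ex; exists x.
have [s sE] := choice ps.
pose q : {linear tens M E -> coker (tens_map M i)} := to_coker (tens_map M i).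
have qp m e e' : p e = p e' -> q (pure m e) = q (pure m e').
  move=> pe; have /ex[k ke] : p (e - e') = 0 by rewrite linearB pe subrr.
  have q0 : q (pure m (i k)) = 0.
    by apply/to_coker0P; exists (pure m k); rewrite /= tens_mapE.
  by rewrite -[e](subrK e') -ke pureDr linearD q0 add0r.
have bb : balanced (fun m x => q (pure m (s x))).
  split=> [m m' x|m x x'|m r x]; first by rewrite pureDl linearD.
  - by rewrite -linearD -pureDr; apply: qp; rewrite linearD !sE.
  - by rewrite pure_bal; apply: qp; rewrite linearZ !sE.
have bZ r m x : q (pure (r *: m) (s x)) = r *: q (pure m (s x)).
  by rewrite -scale_pure linearZ.
have E' : q =1 lcomp (tens_hom bb bZ) (tens_map M p).
  by apply: tens_hom_ext => m e; rewrite /= tens_mapE tens_homE; apply: qp; rewrite sE.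
move=> t0; apply/to_coker0P; rewrite -/(q t) E' /= t0.
exact: linear0.
Qed.

(** For Ω = Ker (P_0 -> X), the injectivity of M ⊗ Ω -> M ⊗ P_0 restates the vanishing homology at M
    ⊗ P_1. Any other sequence is compared with this one through Ω -> P_0 ⊕ K -> E -> 0, whose
    exactness survives tensoring. *)
Lemma Tor1_inj X K E (i : {linear K -> E}) (p : {linear E -> X}) :
  Tor1_vanishes M X -> short_exact i p -> injective (tens_map M i).
Proof.
move=> tor es; have [P] := proj_resolution_exists X.
have [ii ex ps] := es.
have [al alE] := @res_projective _ _ P 0%N _ _ p (res_aug P) ps.
pose j : {linear ker (res_aug P) -> _} := @ker_val _ _ _ (res_aug P).
have jexact c : p (al (j c)) = 0 by rewrite alE ker_valK.
have [be beE] := ses_lift (h := lcomp al j) es jexact.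
have ds y : res_aug P (res_d P 0 y) = 0 by apply/res_exact0; exists y.
have [d' d'E] := ker_corestrict ds.
have d's : surjective d'.
  move=> c; have /res_exact0[y ye] := ker_valK c.
  by exists y; apply: ker_val_inj; rewrite d'E.
have j_inj : injective (tens_map M j).
  apply: linear_inj => s; have [s' <-] := tens_map_surj d's s.
  rewrite /= -tens_map_comp (@eq_tens_map _ _ (lcomp j d') (res_d P 0)) //.
  move=> /(tor P)[z <-]; rewrite /= -tens_map_comp; apply: tens_map0 => y /=.
  by apply: ker_val_inj; rewrite d'E; apply/res_exact; exists y.
pose c : {linear (res_mod P 0 * K)%type -> E} := mklin (copair_linear al i).
pose k := mklin (pair_linear j (\- be)).
have cs : surjective c.
  move=> e; have [x xe] := res_aug_surj P (p e).
  have /ex[y ye] : p (e - al x) = 0 by rewrite linearB alE xe subrr.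
  by exists (x, y); rewrite mklinE /= ye addrC subrK.
have ck : exact_at k c.
  move=> [x y]; split=> [e|[z <-]]; last first.
    by rewrite mklinE /= linearN /= beE subrr.
  have /kerP[z zx] : res_aug P x = 0.
    have := congr1 p e; rewrite mklinE /= linearD alE (ses_comp0 _ es) addr0.
    by rewrite linear0.
  exists z; rewrite mklinE /= zx; congr (_, _); apply: ii.
  rewrite linearN beE /= [j z]zx; apply/eqP; rewrite eq_sym -addr_eq0 addrC.
  exact/eqP.
have zl : linear (fun _ : K => 0 : res_mod P 0).
  by move=> a x y; rewrite scaler0 addr0.
pose inr := mklin (pair_linear (mklin zl) idfun).
apply: linear_inj => t t0.
(* Placed in the second summand, [t] comes from some [s] in M ⊗ Ω. The first projection kills it,
   whence [s = 0] by injectivity of M ⊗ j; the second projection returns [t]. *)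
have /(tens_right_exact ck cs)[s sE] : tens_map M c (tens_map M inr t) = 0.
  rewrite /= -tens_map_comp -[RHS]t0; apply: eq_tens_map => y /=.
  by rewrite linear0 add0r.
have s0 : s = 0.
  apply: j_inj; rewrite linear0.
  have := congr1 (tens_map M (mklin (@fst_linear _ (res_mod P 0) K))) sE.
  rewrite /= -!tens_map_comp [RHS]tens_map0 // => e; exact: etrans _ e.
have := congr1 (tens_map M (mklin (@snd_linear _ (res_mod P 0) K))) sE.
rewrite s0 !linear0 /= -tens_map_comp => ->.
by rewrite -[LHS]tens_map_id; apply: eq_tens_map.
Qed.
End TensorExact.

(** * Cotorsion pairs *)

Section Cotorsion.
Variable R : pzRingType.
Implicit Types (C D : mod_class R) (U V W X Y Z Q P K E : lmodType R).

(** The other exact sequence of a pushout square: the leg parallel to the monomorphism [h] is again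
    mono and has the same cokernel. *)
Lemma pushout_ses K E X V Q E' (i : {linear K -> E}) (p : {linear E -> X})
    (h : {linear K -> V}) (q : {linear V -> Q}) (i' : {linear V -> E'})
    (p' : {linear E' -> X}) (h' : {linear E -> E'}) :
    short_exact i p -> short_exact h q -> short_exact i' p' ->
    (forall k, h' (i k) = i' (h k)) -> (forall e, p' (h' e) = p e) ->
    (forall e', exists v e, e' = i' v + h' e) ->
  exists q' : {linear E' -> Q}, short_exact h' q'.
Proof.
move=> es es2 es' h'i p'h' sur.
have [ii ex ps] := es; have [hi exq qs] := es2; have [i'i ex' p's] := es'.
pose G e' c := exists v e, e' = i' v + h' e /\ c = q v.
have h'k e v : i' v + h' e = 0 -> exists2 k, i k = e & h k = - v.
  move=> e0; have /ex[k ke] : p e = 0.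
    have := congr1 p' e0.
    by rewrite linearD (ses_comp0 _ es') add0r p'h' linear0.
  exists k => //; apply: i'i; rewrite -h'i ke linearN; apply/eqP.
  by rewrite -addr_eq0 addrC e0.
have [||v|q' q'P] := linear_graph (G := G).
- by move=> e'; have [v [e ->]] := sur e'; exists (q v), v, e.
- move=> a _ _ _ _ [v [e [-> ->]]] [v' [e' [-> ->]]].
  exists (a *: v + v'), (a *: e + e'); rewrite !linearP; split=> //.
  by rewrite scalerDr addrACA.
- move=> [w [e [/esym /h'k[k _ hk] ->]]]; rewrite -[w]opprK -hk linearN.
  by rewrite (ses_comp0 _ es2) oppr0.
have q'E v e : q' (i' v + h' e) = q v by apply/q'P; exists v, e.
exists q'; split.
- apply: linear_inj => e e0; have [|k <- hk] := h'k e 0.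
    by rewrite linear0 add0r.
  have -> : k = 0 by apply: hi; rewrite hk linear0 oppr0.
  exact: linear0.
- move=> e'; have [v [e ->]] := sur e'; rewrite q'E; split=> [/exq[k <-]|[f fE]].
    by exists (i k + e); rewrite linearD h'i.
  by rewrite -(q'E v e) -fE -[h' f]add0r -(linear0 i') q'E linear0.
- by move=> c; have [v <-] := qs c; exists (i' v + h' 0); rewrite q'E.
Qed.

(** Extending maps over one projective presentation is enough. A lift [al] of [p] restricts to a map
    K -> V; subtracting from [al] an extension of it leaves a map that kills [K] and descends to a
    section. *)
Lemma ext1_presentation K P X V (i : {linear K -> P}) (p : {linear P -> X}) :
    projective P -> short_exact i p ->
    (forall h : {linear K -> V}, exists k : {linear P -> V}, forall x, k (i x) = h x) ->
  ext1_zero X V.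
Proof.
move=> Pp es H; apply: ext1_section => E j q es'.
have [_ _ qs] := es'; have [al alE] := Pp _ _ q p qs.
have [|h hE] := ses_lift (h := lcomp al i) es'.
  by move=> x; rewrite /= alE (ses_comp0 _ es).
have [k kE] := H h.
have [|s sE] := ses_fact (h := (al \- lcomp j k) : {linear P -> E}) es.
  by move=> x; rewrite /= kE hE subrr.
exists s => x; have [_ _ ps] := es; have [y <-] := ps x.
by rewrite sE /= linearB alE (ses_comp0 _ es') subr0.
Qed.

Lemma perp_leftP D X : perp_left D X <-> (forall V, D V -> ext1_zero X V).
Proof. by split=> h V /h /Ext1P. Qed.

Lemma perp_rightP C X : perp_right C X <-> (forall V, C V -> ext1_zero V X).
Proof. by split=> h V /h /Ext1P. Qed.

(** Half of a special preenvelope. The membership of [Y] in the right-hand class is asked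
    separately, so that several embeddings can be composed before it holds. *)
Definition special_sub C X Y : Prop :=
  exists (Z : lmodType R) (i : {linear X -> Y}) (p : {linear Y -> Z}),
    short_exact i p /\ C Z.

(** The sequence 0 -> Y/X -> Z/X -> Z/Y -> 0 is exact, and a left orthogonal class is closed under
    extensions. *)
Lemma special_sub_trans D X Y Z :
  special_sub (perp_left D) X Y -> special_sub (perp_left D) Y Z ->
  special_sub (perp_left D) X Z.
Proof.
move=> [U [i [p [es Up]]]] [V [j [q [es' Vq]]]].
have [ii ex ps] := es; have [ji exj qs] := es'.
pose k := lcomp j i.
have [|p' p'E] := ses_fact (h := lcomp (to_coker k) j) es.
  by move=> x; apply/to_coker0P; exists x.
have [|q' q'E] := coker_lift (f := k) (h := q).
  by move=> x; rewrite (ses_comp0 _ es').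
exists (coker k), k, (to_coker k); split.
  by apply: ses_coker; exact: inj_comp.
apply/perp_leftP => W DW.
apply: (@ext1_ext _ _ _ _ _ p' q').
- split.
  + apply: linear_inj => u; have [y <-] := ps u; rewrite p'E.
    by move=> /to_coker0P[x /ji <-]; rewrite (ses_comp0 _ es).
  + move=> c; have [z <-] := to_coker_surj c; rewrite q'E.
    split=> [/exj[y <-]|[u]]; first by exists (p y); rewrite p'E.
    have [y <-] := ps u; rewrite p'E => e.
    by rewrite -q'E -e q'E (ses_comp0 _ es').
  + by move=> v; have [z <-] := qs v; exists (to_coker k z); rewrite q'E.
- by move/perp_leftP: Up; apply.
- by move/perp_leftP: Vq; apply.
Qed.

(** Salce's argument: embed the kernel of a free cover F -> Z in some [Y] of [D] with cokernel [U]
    in [C]. The pushout [E] fits in 0 -> Y -> E -> Z -> 0 and in 0 -> F -> E -> U -> 0; the latter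
    puts [E] in [C]. *)
Lemma salce C D : cotorsion_pair C D ->
  (forall X, exists2 Y, D Y & special_sub C X Y) -> complete_pair C D.
Proof.
move=> [CD DC] H Z; split; last first.
  by have [Y DY [U [i [p [es CU]]]]] := H Z; exists Y, U, i, p.
have es := ses_ker (@free_cover_surj _ Z).
have [Y DY [U [i [p [es' CU]]]]] := H (ker (free_cover Z)).
have [E [j [q [h [es2 hj qh sur]]]]] := pushout i es.
have [q' es3] := pushout_ses es es' es2 hj qh sur.
exists Y, E, j, q; split=> //; apply/DC/perp_leftP => V DV.
apply: ext1_ext es3 _ _; first exact/ext1_projective/projective_free.
by move/DC/perp_leftP: CU; apply.
Qed.

(** A dimension shift: for [U] in [C], the kernel of a free cover of [U] is in [C] too. A map from
    it to [coker i] lifts to [W], since [V] is in [D]; the lift extends to the free module, since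
    [W] is in [D]. *)
Lemma hereditary_of_kernels C D : cotorsion_pair C D ->
    (forall V W (p : {linear V -> W}), surjective p -> C V -> C W -> C (ker p)) ->
  hereditary_pair C D.
Proof.
move=> [CD DC] H; split=> // V W i ii DV DW; apply/CD/perp_rightP => U CU.
have ext X Y : C X -> D Y -> ext1_zero X Y.
  by move=> /DC /perp_leftP h; apply: h.
have CF : C (free_mod R U).
  by apply/DC/perp_leftP => X _; apply/ext1_projective/projective_free.
have es := ses_ker (@free_cover_surj _ U).
have CK := H _ _ _ (@free_cover_surj _ U) CF CU.
apply: (ext1_presentation (@projective_free _ _) es) => h.
have [k kE] := ext1_lift h (ext _ _ CK DV) (ses_coker ii).
have [l lE] := ext _ _ CU DW _ _ _ _ es k.
by exists (lcomp (to_coker i) l) => x; rewrite /= lE kE.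
Qed.
End Cotorsion.

(** * The injective cogenerator Q/Z *)

Section RationalsModIntegers.
Import Num.Theory.

Section Divisible.
Variables (V D : lmodType int).

(** The graph of a homomorphism from a subgroup of [V] to [D]. *)
Definition zgraph (G : set (V * D)%type) : Prop :=
  [/\ G (0, 0), forall n x y, G x -> G y -> G (n *: x + y)
    & forall d, G (0, d) -> d = 0].

Hypothesis Ddiv : forall (n : int) (d : D), n != 0 -> exists e, n *: e = d.

Lemma int_ideal_principal (P : int -> Prop) :
    P 0 -> (forall n x y, P x -> P y -> P (n * x + y)) ->
  exists n0, P n0 /\ forall n, P n -> exists q, n = q * n0.
Proof.
move=> P0 PD; case: (pselect (exists n : nat, P n.+1)) => [[n Pn]|noP].
  (* Shifted by one, so that the minimum found is the least positive element. *)
  pose Q : pred nat := fun n => `[< P n.+1 >].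
  have exQ : exists n, Q n by exists n; apply/asboolP.
  have [m /asboolP Qm mmin] := ex_minnP exQ.
  exists m.+1; split=> // k Pk; exists (k %/ m.+1)%Z.
  have r0 : P (k %% m.+1)%Z.
    have -> : (k %% m.+1)%Z = - (k %/ m.+1)%Z * m.+1 + k.
      by rewrite {3}(divz_eq k m.+1) mulNr addKr.
    exact: PD.
  have lt := ltz_pmod k (isT : (0 : int) < m.+1%:Z).
  have ge := modz_ge0 k (isT : m.+1%:Z != 0).
  rewrite {1}(divz_eq k m.+1).
  case: (k %% m.+1)%Z r0 lt ge => // [[|r]] Pr lt _; first by rewrite addr0.
  have /mmin : Q r by apply/asboolP.
  by rewrite leqNgt; move: lt; rewrite ltz_nat ltnS => ->.
exists 0; split=> // n Pn; exists 0; rewrite mulr0.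
have Pabs : P `|n|.
  case: n Pn => // n Pn; have -> : `|Negz n| = -1 * Negz n + 0 by rewrite addr0 mulN1r.
  exact: PD.
case E : `|n|%N => [|m]; first by apply/eqP; rewrite -absz_eq0 E.
by case: noP; exists m; rewrite -E abszE.
Qed.

(** Baer's argument: a maximal partial homomorphism containing [G] is total, because a divisible
    target allows one more element in the domain. *)
Lemma zgraph_extend (G : set (V * D)%type) : zgraph G ->
  exists f : {linear V -> D}, forall v d, G (v, d) -> f v = d.
Proof.
move=> zG.
pose P (A : set (V * D)%type) := A = set0 \/ (zgraph A /\ (G `<=` A)%classic).
have [|A [PA Amax]] := @Zorn_bigcup _ P.
  move=> F FP Ftot.
  case: (pselect (exists2 A, F A & A !=set0)%classic) =>
    [[A0 FA0 A00]|noA]; last first.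
    left; apply/seteqP; split=> // x [A FA Ax].
    by case: noA; exists A => //; exists x.
  have good A : F A -> A !=set0%classic -> zgraph A /\ (G `<=` A)%classic.
    by move=> /FP[-> [x []]|].
  right; split; last first.
    by move=> x Gx; exists A0 => //; apply: (good _ FA0 A00).2.
  split.
  - by exists A0 => //; have [[]] := good _ FA0 A00.
  - move=> n x y [A FA Ax] [B FB By].
    have [[_ Acl _] _] := good _ FA (ex_intro _ _ Ax).
    have [[_ Bcl _] _] := good _ FB (ex_intro _ _ By).
    by have [AB|BA] := Ftot _ _ FA FB;
      [exists B => //; apply: Bcl => //; apply: AB
      |exists A => //; apply: Acl => //; apply: BA].
  - move=> d [A FA Ad].
    by have [[_ _ Au] _] := good _ FA (ex_intro _ _ Ad); apply: Au.
have [zA GA] : zgraph A /\ (G `<=` A)%classic.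
  case: PA => [A0|//]; exfalso; apply: (Amax G); last by right; split.
  rewrite A0; split=> // /(_ (0, 0)) h; have [G0 _ _] := zG.
  exact: h G0.
have [A0 AD Af] := zA.
have AN x : A x -> A (- x).
  by move=> Ax; have := AD (-1) _ _ Ax A0; rewrite addr0 scaleN1r.
have tot v : exists d, A (v, d).
  (* The multiples of [v] in the domain form an ideal, generated by [n0]. Sending [v] to an [e] with
     [n0 *: e = d0] is compatible with [A]; when [n0] is 0, so is [d0], and [e = 0] works. *)
  pose Q n := exists d, A (n *: v, d).
  have [||n0 [[d0 Ad0] n0P]] := @int_ideal_principal Q.
  - by exists 0; rewrite scale0r.
  - move=> n x y [d Ad] [d' Ad']; exists (n *: d + d').
    by rewrite scalerDl -scalerA; exact: AD Ad Ad'.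
  have [e ed0] : exists e, n0 *: e = d0.
    have [n00|] := eqVneq n0 0; last exact: Ddiv.
    exists 0; rewrite scaler0; apply/esym/Af.
    by move: Ad0; rewrite n00 scale0r.
  pose B : set (V * D)%type := fun x => exists n y, A y /\ x = y + n *: (v, e).
  apply: contrapT => noA; apply: (Amax B).
    split=> [x Ax|/(_ (v, e)) h]; first by exists 0, x; rewrite scale0r addr0.
    apply: noA; exists e; apply: h; exists 1, (0, 0).
    by split=> //; rewrite scale1r add0r.
  right; split; last first.
    by move=> x /GA Ax; exists 0, x; rewrite scale0r addr0.
  split.
  - by exists 0, (0, 0); rewrite scale0r addr0.
  - move=> n _ _ [m [x [Ax ->]]] [m' [x' [Ax' ->]]].
    exists (n * m + m'), (n *: x + x'); split; first exact: AD.
    by rewrite scalerDr scalerDl scalerA addrACA.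
  - move=> d [n [[a b] [Aab [a0 ->]]]].
    have an : n *: v = - a by apply: (addrI a); rewrite subrr; exact: esym a0.
    have /n0P[q nq] : Q n by exists (- b); rewrite an; exact: (AN _ Aab).
    have Aqd : A (n *: v, n *: e).
      have := AD q _ _ Ad0 A0; rewrite addr0.
      by rewrite nq -!scalerA ed0.
    apply: Af; have := AD 1 _ _ Aab Aqd; rewrite scale1r an;
      congr A; congr (_, _); exact: subrr.
have [|||f fP] := linear_graph (G := fun v d => A (v, d)).
- exact: tot.
- by move=> n v d v' d' h h'; have := AD n _ _ h h'.
- exact: Af.
by exists f => v d /GA h; apply/fP.
Qed.
End Divisible.

Fact intr_rat_linear : linear (fun n : int^o => n%:~R : zmodule rat).
Proof. by move=> a x y; rewrite rmorphD rmorphM /= scalezrE mulrC mulrzr. Qed.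

Definition rat_mod_int : lmodType int := coker (mklin intr_rat_linear).

Lemma rat_mod_int_div (n : int) (d : rat_mod_int) : n != 0 ->
  exists e, n *: e = d.
Proof.
move=> n0; have [r <-] := to_coker_surj d.
exists (to_coker (mklin intr_rat_linear) ((r : rat) / n%:~R)).
rewrite -to_cokerZ scalezrE -mulrzr mulrVK // unitfE intr_eq0.
exact: n0.
Qed.

Lemma rat_mod_int_injective (U V : lmodType int) (i : {linear U -> V})
    (h : {linear U -> rat_mod_int}) : injective i ->
  exists k : {linear V -> rat_mod_int}, forall u, k (i u) = h u.
Proof.
move=> ii; pose G := fun x : (V * rat_mod_int)%type => exists u, x = (i u, h u).
have [|k kP] := @zgraph_extend _ _ rat_mod_int_div G.
  split; first by exists 0; rewrite !linear0.
    move=> n _ _ [x ->] [y ->]; exists (n *: x + y).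
    by rewrite !linearP.
  move=> d [u [u0 ->]]; have -> : u = 0 by apply: ii; rewrite -u0 linear0.
  exact: linear0.
by exists k => u; apply: kP; exists u.
Qed.

Lemma rat_mod_int_cogenerator (V : lmodType int) (v : V) :
  (forall h : {linear V -> rat_mod_int}, h v = 0) -> v = 0.
Proof.
move=> H; have [//|v0] := eqVneq v 0; exfalso.
pose q (r : rat) := to_coker (mklin intr_rat_linear) r.
have [||n0 [n0v n0P]] := @int_ideal_principal (fun n => n *: v = 0).
- exact: scale0r.
- by move=> n x y xv yv; rewrite scalerDl -scalerA xv yv scaler0 addr0.
(* The value [c] at [v] must be nonzero and killed by the generator [n0] of the annihilator of [v].
   The class of 1 / n0 qualifies, since |n0| = 1 would force [v = 0]; for [n0 = 0] the class of 1 /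
   2 is taken. *)
have [c [c0 cn]] : exists c : rat_mod_int, c <> 0 /\ n0 *: c = 0.
  have nz (k : int) : (1 < `|k|)%N -> q (1 / k%:~R) <> 0 /\ k *: q (1 / k%:~R) = 0.
    move=> k1; have k0 : k%:~R != 0 :> rat.
      by rewrite intr_eq0; apply: contraTneq k1 => ->.
    split; last first.
      rewrite -to_cokerZ scalezrE -mulrzr mulrVK ?unitfE //.
      by apply/to_coker0P; exists 1.
    move=> /to_coker0P[/= m /(congr1 ( *%R^~ k%:~R))].
    rewrite mulrVK ?unitfE // -rmorphM -[RHS]/(1%:~R) => /intr_inj.
    move=> /(congr1 absz); rewrite abszM => /eqP.
    by rewrite muln_eq1 => /andP[_ /eqP k1']; rewrite k1' in k1.
  have [n00|n00] := eqVneq n0 0.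
    by have [c0 _] := nz 2 isT; exists (q (1 / 2%:~R)); rewrite n00 scale0r.
  exists (q (1 / n0%:~R)); apply: nz.
  case E : `|n0|%N => [|[|//]]; first by rewrite -absz_eq0 E in n00.
  case/eqP: v0; have : n0 * n0 = 1.
    by case: (n0) E => [m /= [->]|m /= [->]].
  by move=> n1; rewrite -[v]scale1r -n1 -scalerA n0v scaler0.
pose G := fun x : (V * rat_mod_int)%type => exists n : int, x = (n *: v, n *: c).
have [|k kP] := @zgraph_extend _ _ rat_mod_int_div G.
  split; first by exists 0; rewrite !scale0r.
    by move=> n _ _ [x ->] [y ->]; exists (n * x + y); rewrite !scalerDl -!scalerA.
  by move=> d [n [/esym /n0P[r ->] ->]]; rewrite -scalerA cn scaler0.
apply: c0; rewrite -(H k); apply/esym/kP.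
by exists 1; rewrite !scale1r.
Qed.

End RationalsModIntegers.

(** * Additive maps, zero modules and corners *)

Section AdditiveMaps.
Variables (T : zmodType) (V : lmodType int) (f : T -> V).
Hypothesis fD : {morph f : x y / x + y}.

(** Characters are built as bare additive functions; this turns them into linear maps over [int]. *)
Fact additive_int_linear : linear (f : zmodule T -> V).
Proof.
move=> n x y; rewrite [LHS]fD; congr (_ + _); rewrite scalezrE.
have f0 : f 0 = 0 by apply: (addIr (f 0)); rewrite -fD !add0r.
have fN z : f (- z) = - f z by apply: (addIr (f z)); rewrite -fD !addNr.
have fM z m : f (z *+ m) = f z *+ m.
  by elim: m => [|m ih]; rewrite ?mulr0n ?mulrS ?fD ?ih.
have sc m (v : V) : m%:Z *: v = v *+ m by rewrite -[m%:Z]natz scaler_nat.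
case: n => m; first by rewrite -pmulrn fM sc.
by rewrite NegzE mulrNz scaleNr fN -pmulrn fM sc.
Qed.
End AdditiveMaps.

Section ZeroModule.
Variable R : pzRingType.

Definition zero_mod : lmodType R := ker (idfun : {linear R^o -> R^o}).

Lemma zero_modE (x : zero_mod) : x = 0.
Proof. by apply: ker_val_inj; rewrite -[ker_val x]/(idfun (ker_val x)) ker_valK. Qed.

Fact zero_map_linear (V W : lmodType R) : linear (fun _ : V => 0 : W).
Proof. by move=> a x y; rewrite scaler0 addr0. Qed.
Definition zero_map (V W : lmodType R) : {linear V -> W} :=
  mklin (@zero_map_linear V W).
End ZeroModule.

(* For the inclusions of A and B in Λ as corners e Λ e; they map 1 to e. *)
Record nonunital_hom (S R : pzRingType) := NonunitalHom {
  nh_fun :> S -> R;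
  nhD : {morph nh_fun : x y / x + y};
  nhM : {morph nh_fun : x y / x * y}
}.

Section Corner.
Variables (S R : pzRingType) (al : nonunital_hom S R) (L : lmodType R).

(** With the idempotent [e = al 1], the fixed set of [e] is e L. It is stable under each [al s]
    because [al s = e * al s]. *)
Definition corner_pred : {pred L} := fun l => al 1 *: l == l.

Fact corner_zmod : zmod_closed corner_pred.
Proof.
split=> [|u v]; rewrite !unfold_in ?scaler0 // => /eqP ue /eqP ve.
by rewrite scalerBr ue ve.
Qed.
HB.instance Definition _ := GRing.isZmodClosed.Build L corner_pred corner_zmod.

Record corner : Type := Corner { corner_val : L; _ : corner_val \in corner_pred }.
HB.instance Definition _ := [isSub for corner_val].
HB.instance Definition _ := [Choice of corner by <:].
HB.instance Definition _ := [SubChoice_isSubZmodule of corner by <:].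

Lemma corner_inj : injective corner_val.
Proof. exact: val_inj. Qed.

Lemma corner_valD (x y : corner) : corner_val (x + y) = corner_val x + corner_val y.
Proof. by []. Qed.

Lemma corner_val1 (x : corner) : al 1 *: corner_val x = corner_val x.
Proof. by apply/eqP; exact: (valP x). Qed.

Fact corner_scale_subproof (s : S) (l : L) : al s *: l \in corner_pred.
Proof. by rewrite unfold_in scalerA -nhM mul1r. Qed.

Definition to_corner (s : S) (l : L) : corner := Corner (corner_scale_subproof s l).

Definition corner_scale (s : S) (x : corner) : corner := to_corner s (corner_val x).

Fact corner_scaleA a b x : corner_scale a (corner_scale b x) = corner_scale (a * b) x.
Proof. by apply: corner_inj; rewrite /= scalerA nhM. Qed.
Fact corner_scale1 : left_id 1 corner_scale.
Proof. by move=> x; apply: corner_inj; rewrite /= corner_val1. Qed.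
Fact corner_scaleDr : right_distributive corner_scale +%R.
Proof. by move=> a x y; apply: corner_inj; exact: scalerDr. Qed.
Fact corner_scaleDl x : {morph corner_scale^~ x : a b / a + b}.
Proof. by move=> a b; apply: corner_inj; rewrite /= nhD scalerDl. Qed.
HB.instance Definition _ := GRing.Zmodule_isLmodule.Build S corner
  corner_scaleA corner_scale1 corner_scaleDr corner_scaleDl.

Lemma corner_valZ s (x : corner) : corner_val (s *: x) = al s *: corner_val x.
Proof. by []. Qed.

End Corner.

(** * Quadruples *)

Section Quadruples.
Variables (A B : pzRingType) (M : bimodType B A) (N : bimodType A B).
Variable K : morita_context M N.
Implicit Types q : quadruple K.

Section QuadHom.
Variables q q' : quadruple K.

Section Build.
Variables (a : {linear quad_X q -> quad_X q'}) (b : {linear quad_Y q -> quad_Y q'}).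
Hypothesis bf : forall m x, b (quad_f q (pure m x)) = quad_f q' (pure m (a x)).
Hypothesis ag : forall n y, a (quad_g q (pure n y)) = quad_g q' (pure n (b y)).

Fact quad_hom_linear : linear (fun v : quad_mod q => (a v.1, b v.2) : quad_mod q').
Proof.
move=> [[r n] [m s]] [x y] [x' y'] /=.
rewrite !linearD !linearZ /= bf ag.
by congr (_, _).
Qed.
Definition quad_hom : {linear quad_mod q -> quad_mod q'} := mklin quad_hom_linear.
End Build.

Variable h : {linear quad_mod q -> quad_mod q'}.

Lemma quad_homZ (r : A) (n : N) (m : M) (s : B) x y u v : h (x, y) = (u, v) ->
  h (r *: x + quad_g q (pure n y), quad_f q (pure m x) + s *: y) =
  (r *: u + quad_g q' (pure n v), quad_f q' (pure m u) + s *: v).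
Proof.
move=> e; have := linearZ_LR h (((r, n), (m, s)) : morita_ring K) ((x, y) : quad_mod q).
by rewrite e.
Qed.

Lemma quad_homD x y x' y' : h (x + x', y + y') =
  ((h (x, y)).1 + (h (x', y')).1, (h (x, y)).2 + (h (x', y')).2).
Proof. exact: (linearD h (x, y) (x', y')). Qed.

Lemma quad_hom_e1 x : h (x, 0) = ((h (x, 0)).1, 0).
Proof.
have := quad_homZ 1 0 0 0 (surjective_pairing (h (x, 0))).
by rewrite !pure0l !linear0 !scale1r !scale0r !addr0.
Qed.

Lemma quad_hom_e2 y : h (0, y) = (0, (h (0, y)).2).
Proof.
have := quad_homZ 0 0 0 1 (surjective_pairing (h (0, y))).
by rewrite !pure0l !linear0 !scale1r !scale0r !add0r.
Qed.

(** Commuting with the diagonal idempotents of Λ makes [h] act componentwise; commuting with the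
    off-diagonal entries gives the compatibility with f and g. The informative form allows the two
    components to be extracted. *)
Lemma quad_hom_spec :
  { ab : {linear quad_X q -> quad_X q'} * {linear quad_Y q -> quad_Y q'} |
    [/\ forall x y, h (x, y) = (ab.1 x, ab.2 y),
        forall m x, ab.2 (quad_f q (pure m x)) = quad_f q' (pure m (ab.1 x))
      & forall n y, ab.1 (quad_g q (pure n y)) = quad_g q' (pure n (ab.2 y))] }.
Proof.
have hE x y : h (x, y) = ((h (x, 0)).1, (h (0, y)).2).
  by have := quad_homD x 0 0 y; rewrite !addr0 add0r quad_hom_e1 quad_hom_e2 addr0 add0r.
have al : linear (fun x => (h (x, 0)).1).
  move=> r x x'; have := quad_homZ r 0 0 0 (quad_hom_e1 x).
  rewrite !pure0l !linear0 !scale0r !addr0 => e.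
  by have := quad_homD (r *: x) 0 x' 0; rewrite addr0 e => ->.
have bl : linear (fun y => (h (0, y)).2).
  move=> r x x'; have := quad_homZ 0 0 0 r (quad_hom_e2 x).
  rewrite !pure0l !linear0 !scale0r !add0r => e.
  by have := quad_homD 0 (r *: x) 0 x'; rewrite addr0 e => ->.
exists (mklin al, mklin bl); split=> //= [m x|n y].
- have := quad_homZ 0 0 m 0 (quad_hom_e1 x).
  by rewrite !pure0r !linear0 !scale0r !add0r !addr0 => ->.
- have := quad_homZ 0 n 0 0 (quad_hom_e2 y).
  by rewrite !pure0r !linear0 !scale0r !add0r => ->.
Qed.

Definition hom_X : {linear quad_X q -> quad_X q'} := (sval quad_hom_spec).1.
Definition hom_Y : {linear quad_Y q -> quad_Y q'} := (sval quad_hom_spec).2.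

Lemma hom_XY x y : h (x, y) = (hom_X x, hom_Y y).
Proof. by rewrite /hom_X /hom_Y; case: (svalP quad_hom_spec). Qed.
Lemma hom_f m x : hom_Y (quad_f q (pure m x)) = quad_f q' (pure m (hom_X x)).
Proof. by rewrite /hom_X /hom_Y; case: (svalP quad_hom_spec). Qed.
Lemma hom_g n y : hom_X (quad_g q (pure n y)) = quad_g q' (pure n (hom_Y y)).
Proof. by rewrite /hom_X /hom_Y; case: (svalP quad_hom_spec). Qed.
Lemma hom_f_tens t : hom_Y (quad_f q t) = quad_f q' (tens_map M hom_X t).
Proof.
apply: (@tens_hom_ext _ _ _ _ _ (lcomp hom_Y (quad_f q))
                                (lcomp (quad_f q') (tens_map M hom_X))) => m x.
by rewrite /= tens_mapE hom_f.
Qed.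
End QuadHom.

Lemma hom_XE q q' (h : {linear quad_mod q -> quad_mod q'}) x y x' y' :
  h (x, y) = (x', y') -> hom_X h x = x'.
Proof. by rewrite hom_XY => -[]. Qed.
Lemma hom_YE q q' (h : {linear quad_mod q -> quad_mod q'}) x y x' y' :
  h (x, y) = (x', y') -> hom_Y h y = y'.
Proof. by rewrite hom_XY => -[]. Qed.

Lemma ses_quad q1 q2 q3 (i : {linear quad_mod q1 -> quad_mod q2})
    (p : {linear quad_mod q2 -> quad_mod q3}) :
  short_exact i p <->
  short_exact (hom_X i) (hom_X p) /\ short_exact (hom_Y i) (hom_Y p).
Proof.
split=> [[ii ex ps]|[[iX exX pX] [iY exY pY]]].
- split; split.
  + apply: linear_inj => x x0; have : i (x, 0) = i 0.
      by rewrite hom_XY x0 !linear0.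
    by move=> /ii[].
  + move=> x; split=> [x0|[u <-]].
      have /ex[[u v]] : p (x, 0) = 0 by rewrite hom_XY x0 linear0.
      by rewrite hom_XY => -[ux _]; exists u.
    have /ex : exists t, i t = i (u, 0) by exists (u, 0).
    by rewrite !hom_XY => -[].
  + move=> z; have [[u v]] := ps (z, 0).
    by rewrite hom_XY => -[uz _]; exists u.
  + apply: linear_inj => x x0; have : i (0, x) = i 0.
      by rewrite hom_XY x0 !linear0.
    by move=> /ii[].
  + move=> x; split=> [x0|[u <-]].
      have /ex[[v u]] : p (0, x) = 0 by rewrite hom_XY x0 linear0.
      by rewrite hom_XY => -[_ ux]; exists u.
    have /ex : exists t, i t = i (0, u) by exists (0, u).
    by rewrite !hom_XY => -[].
  + move=> z; have [[v u]] := ps (0, z).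
    by rewrite hom_XY => -[_ uz]; exists u.
- split.
  + move=> [x y] [x' y']; rewrite !hom_XY => -[/iX-> /iY->] //.
  + move=> [x y]; split=> [|[[u v] <-]].
      rewrite hom_XY => -[/exX[u <-] /exY[v <-]].
      by exists (u, v); rewrite hom_XY.
    rewrite !hom_XY; congr (_, _).
      by apply/exX; exists u.
    by apply/exY; exists v.
  + move=> [x y]; have [u <-] := pX x; have [v <-] := pY y.
    by exists (u, v); rewrite hom_XY.
Qed.
End Quadruples.

(** * The quadruple of a Λ-module *)

Section QuadOf.
Variables (A B : pzRingType) (M : bimodType B A) (N : bimodType A B).
Variable K : morita_context M N.

Definition mxA (a : A) : morita_ring K := ((a, 0), (0, 0)).
Definition mxN (n : N) : morita_ring K := ((0, n), (0, 0)).
Definition mxM (m : M) : morita_ring K := ((0, 0), (m, 0)).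
Definition mxB (b : B) : morita_ring K := ((0, 0), (0, b)).

Lemma morita_mulE (a a' : A) (n n' : N) (m m' : M) (b b' : B) :
  (((a, n), (m, b)) : morita_ring K) * ((a', n'), (m', b')) =
  ((a * a' + psi K (pure n m'), a *: n' + ract n b'),
   (ract m a' + b *: m', phi K (pure m n') + b * b')).
Proof. by []. Qed.

Local Ltac mx := rewrite /mxA /mxN /mxM /mxB ?morita_mulE; congr ((_, _), (_, _));
  rewrite ?pure0l ?pure0r ?ract0 ?ractr0 ?linear0 ?mul0r ?mulr0 ?scale0r ?scaler0
    ?addr0 ?add0r //.

Fact mxA_D : {morph mxA : x y / x + y}.
Proof. by move=> x y; congr ((_, _), (_, _)); rewrite /= addr0. Qed.
Fact mxA_M : {morph mxA : x y / x * y}.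
Proof. by move=> x y; mx. Qed.
Fact mxB_D : {morph mxB : x y / x + y}.
Proof. by move=> x y; congr ((_, _), (_, _)); rewrite /= addr0. Qed.
Fact mxB_M : {morph mxB : x y / x * y}.
Proof. by move=> x y; mx. Qed.
Lemma mxM_D m m' : mxM (m + m') = mxM m + mxM m'.
Proof. by congr ((_, _), (_, _)); rewrite /= addr0. Qed.
Lemma mxN_D m m' : mxN (m + m') = mxN m + mxN m'.
Proof. by congr ((_, _), (_, _)); rewrite /= addr0. Qed.
Lemma mxBM b m : mxB b * mxM m = mxM (b *: m). Proof. by mx. Qed.
Lemma mxMA m a : mxM m * mxA a = mxM (ract m a). Proof. by mx. Qed.
Lemma mxAN a n : mxA a * mxN n = mxN (a *: n). Proof. by mx. Qed.
Lemma mxNB n b : mxN n * mxB b = mxN (ract n b). Proof. by mx. Qed.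
Lemma mxNM n m : mxN n * mxM m = mxA (psi K (pure n m)). Proof. by mx. Qed.
Lemma mxMN m n : mxM m * mxN n = mxB (phi K (pure m n)). Proof. by mx. Qed.
Lemma mx1 : mxA 1 + mxB 1 = 1.
Proof. by congr ((_, _), (_, _)); rewrite /= ?addr0 ?add0r. Qed.
Lemma mxAB a b : mxA a * mxB b = 0. Proof. by mx. Qed.
Lemma mxBA a b : mxB b * mxA a = 0. Proof. by mx. Qed.
Lemma mx_sum a n m b :
  ((a, n), (m, b)) = mxA a + mxN n + mxM m + mxB b :> morita_ring K.
Proof. by congr ((_, _), (_, _)); rewrite /= ?addr0 ?add0r. Qed.

Definition nhA : nonunital_hom A (morita_ring K) := NonunitalHom mxA_D mxA_M.
Definition nhB : nonunital_hom B (morita_ring K) := NonunitalHom mxB_D mxB_M.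

Variable L : lmodType (morita_ring K).
Let X : lmodType A := corner nhA L.
Let Y : lmodType B := corner nhB L.

(** Multiplication by a matrix whose only entry is [m] already lands in e_B L; [to_corner] with
    scalar 1 records this membership without changing the value. *)
Definition actM (m : M) (x : X) : Y := to_corner nhB 1 (mxM m *: corner_val x).
Lemma actME m x : corner_val (actM m x) = mxM m *: corner_val x.
Proof. by rewrite /= scalerA mxBM scale1r. Qed.
Definition actN (n : N) (y : Y) : X := to_corner nhA 1 (mxN n *: corner_val y).
Lemma actNE n y : corner_val (actN n y) = mxN n *: corner_val y.
Proof. by rewrite /= scalerA mxAN scale1r. Qed.

Fact actM_bal : balanced actM.
Proof.
split=> [m m' x|m x x'|m a x]; apply: corner_inj.
- by rewrite corner_valD !actME mxM_D scalerDl.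
- by rewrite corner_valD !actME corner_valD scalerDr.
- by rewrite !actME corner_valZ scalerA /= mxMA.
Qed.
Fact actM_Z b m x : actM (b *: m) x = b *: actM m x.
Proof. by apply: corner_inj; rewrite corner_valZ !actME scalerA /= mxBM. Qed.
Fact actN_bal : balanced actN.
Proof.
split=> [m m' x|m x x'|m a x]; apply: corner_inj.
- by rewrite corner_valD !actNE mxN_D scalerDl.
- by rewrite corner_valD !actNE corner_valD scalerDr.
- by rewrite !actNE corner_valZ scalerA /= mxNB.
Qed.
Fact actN_Z b m x : actN (b *: m) x = b *: actN m x.
Proof. by apply: corner_inj; rewrite corner_valZ !actNE scalerA /= mxAN. Qed.

Definition quad_of_f : {linear tens M X -> Y} := tens_hom actM_bal actM_Z.
Definition quad_of_g : {linear tens N Y -> X} := tens_hom actN_bal actN_Z.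

Fact quad_of_gf n m x :
  quad_of_g (pure n (quad_of_f (pure m x))) = (psi K (pure n m) : A) *: x.
Proof.
apply: corner_inj.
by rewrite !tens_homE actNE actME scalerA mxNM.
Qed.
Fact quad_of_fg m n y :
  quad_of_f (pure m (quad_of_g (pure n y))) = (phi K (pure m n) : B) *: y.
Proof.
apply: corner_inj.
by rewrite !tens_homE actME actNE scalerA mxMN.
Qed.

Definition quad_of : quadruple K := Quadruple quad_of_gf quad_of_fg.

(** The Peirce decomposition: L is e_A L ⊕ e_B L, as e_A and e_B are orthogonal idempotents with sum
    1. *)
Lemma quad_of_iso : lmod_iso L (quad_mod quad_of).
Proof.
apply: lmod_iso_sym.
have fl : linear (fun v : quad_mod quad_of => corner_val v.1 + corner_val v.2).
  move=> [[r n] [m s]] [x y] [x' y'] /=.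
  rewrite /quad_of_f /quad_of_g !tens_homE actNE actME mx_sum.
  (* A matrix with a single entry kills the corner that does not match its column, so the cross
     terms vanish. *)
  have A0 (l : L) : nhB 1 *: l = l -> forall a, mxA a *: l = 0.
    by move=> <- a; rewrite scalerA mxAB scale0r.
  have B0 (l : L) : nhA 1 *: l = l -> forall b, mxB b *: l = 0.
    by move=> <- b; rewrite scalerA mxBA scale0r.
  have M0 (l : L) : nhB 1 *: l = l -> forall m, mxM m *: l = 0.
    by move=> <- m0; rewrite scalerA /= -[m0]ractr1 -mxMA -mulrA mxAB mulr0 scale0r.
  have N0 (l : L) : nhA 1 *: l = l -> forall n, mxN n *: l = 0.
    by move=> <- n0; rewrite scalerA /= -[n0]ractr1 -mxNB -mulrA mxBA mulr0 scale0r.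
  have hx := corner_val1 x; have hy := corner_val1 y.
  rewrite !scalerDl !scalerDr (A0 _ hy) (B0 _ hx) (M0 _ hy) (N0 _ hx).
  by rewrite !add0r !addr0 addrACA !addrA.
exists (mklin fl); apply: inj_surj_bij.
- apply: linear_inj => -[x y] /= e.
  have e1 : mxA 1 *: (corner_val x + corner_val y) = 0 by rewrite e scaler0.
  have e2 : mxB 1 *: (corner_val x + corner_val y) = 0 by rewrite e scaler0.
  move: e1 e2; rewrite !scalerDr -(corner_val1 y) -(corner_val1 x) /=.
  rewrite !scalerA mxAB mxBA -mxA_M -mxB_M !mulr1 !scale0r addr0 add0r.
  rewrite (corner_val1 x) (corner_val1 y) => e1 e2.
  by congr (_, _); apply: corner_inj.
- move=> l; exists (to_corner nhA 1 l, to_corner nhB 1 l).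
  by rewrite /= -scalerDl mx1 scale1r.
Qed.
End QuadOf.

Section QuadExt.
Variables (A B : pzRingType) (M : bimodType B A) (N : bimodType A B).
Variable K : morita_context M N.
Implicit Types q e : quadruple K.

Lemma short_exact_middle (R : pzRingType) (U E E' W : lmodType R)
    (i : {linear U -> E}) (p : {linear E -> W}) (f : {linear E -> E'})
    (g : {linear E' -> E}) : cancel f g -> cancel g f -> short_exact i p ->
  short_exact (lcomp f i) (lcomp p g).
Proof.
move=> fg gf [ii ex ps]; split.
- by move=> x y /(can_inj fg)/ii.
- move=> e; split=> [/ex[u ue]|[u <-]] /=.
    by exists u; rewrite /= ue gf.
  by rewrite fg; apply/ex; exists u.
- by move=> w; have [e <-] := ps w; exists (f e); rewrite /= fg.
Qed.

(** The middle term of an extension may be taken to be a quadruple, so that splittings can be built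
    by components. *)
Lemma ext1_quad_section q q' :
  (forall e (i : {linear quad_mod q' -> quad_mod e})
      (p : {linear quad_mod e -> quad_mod q}), short_exact i p ->
    exists s : {linear quad_mod q -> quad_mod e}, forall x, p (s x) = x) ->
  ext1_zero (quad_mod q) (quad_mod q').
Proof.
move=> H; apply: ext1_section => E i p es.
have [f /linv[g fg gf]] := quad_of_iso E.
have [s sE] := H _ _ _ (short_exact_middle fg gf es).
by exists (lcomp g s) => x; apply: etrans (sE x).
Qed.

Lemma ext1_quad_retraction q q' :
  (forall e (i : {linear quad_mod q' -> quad_mod e})
      (p : {linear quad_mod e -> quad_mod q}), short_exact i p ->
    exists r : {linear quad_mod e -> quad_mod q'}, forall x, r (i x) = x) ->
  ext1_zero (quad_mod q) (quad_mod q').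
Proof.
move=> H; apply: ext1_quad_section => e i p es.
have [r rE] := H _ _ _ es.
exact: ses_section es rE.
Qed.
End QuadExt.

(** * Modules over B / Im φ *)

Section QuotientModules.
Variables (A B : pzRingType) (M : bimodType B A) (N : bimodType A B).
Variable K : morita_context M N.
Notation S := (quo_ring K).

Lemma to_quo_surj : surjective (to_quo K).
Proof. by move=> x; exists (repr x); rewrite to_quoK. Qed.

Lemma to_quo_phi t : to_quo K (phi K t : B) = 0.
Proof. by apply/to_coker0P; exists t. Qed.

(** Restriction of scalars along B -> B / Im φ; the new name for the same group carries the B-module
    structure. *)
Definition res (W : lmodType S) : Type := W.
Section Res.
Variable W : lmodType S.
HB.instance Definition _ := GRing.Zmodule.on (res W).
Definition res_scale (b : B) (w : res W) : res W := to_quo K b *: (w : W).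
Fact res_scaleA a b w : res_scale a (res_scale b w) = res_scale (a * b) w.
Proof. by rewrite /res_scale scalerA to_quoM. Qed.
Fact res_scale1 : left_id 1 res_scale.
Proof. by move=> w; exact: scale1r. Qed.
Fact res_scaleDr : right_distributive res_scale +%R.
Proof. by move=> a x y; exact: scalerDr. Qed.
Fact res_scaleDl w : {morph res_scale^~ w : a b / a + b}.
Proof. by move=> a b; rewrite /res_scale to_quoD scalerDl. Qed.
HB.instance Definition _ := GRing.Zmodule_isLmodule.Build B (res W)
  res_scaleA res_scale1 res_scaleDr res_scaleDl.
Lemma res_scaleE b (w : res W) : b *: w = to_quo K b *: (w : W).
Proof. by []. Qed.
End Res.

Section ResHom.
Variables (W W' : lmodType S) (f : {linear W -> W'}).
Fact res_hom_linear : linear (f : res W -> res W').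
Proof. by move=> a x y; rewrite [LHS]linearP. Qed.
Definition res_hom : {linear res W -> res W'} := mklin res_hom_linear.
End ResHom.

Lemma quo_linear (W W' : lmodType S) (f : W -> W') :
    {morph f : x y / x + y} ->
    (forall b w, f (to_quo K b *: w) = to_quo K b *: f w) -> linear f.
Proof. by move=> fD fZ s x y; have [b <-] := to_quo_surj s; rewrite fD fZ. Qed.

Section UnresHom.
Variables (W W' : lmodType S) (f : {linear res W -> res W'}).
Fact unres_hom_linear : linear (f : W -> W').
Proof.
apply: quo_linear => [x y|b y]; first exact: (linearD f).
exact: (linearZ_LR f).
Qed.
Definition unres_hom : {linear W -> W'} := mklin unres_hom_linear.
End UnresHom.

Section Killed.
Variable Y : lmodType B.
Definition killed := forall t (y : Y), (phi K t : B) *: y = 0.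
Hypothesis kY : killed.

Lemma killed_repr b (y : Y) : (repr (to_quo K b) : B) *: y = b *: y.
Proof.
have [t tE] := coker_reprP (phi K) b.
by rewrite -[repr _](subrK b) -tE scalerDl kY add0r.
Qed.
End Killed.

(** The same group seen over B / Im φ. The proof [kY] is an argument of the type, since it is what
    makes the action through representatives well defined. *)
Definition quo_mod (Y : lmodType B) (kY : killed Y) : Type := Y.
Section QuoMod.
Variables (Y : lmodType B) (kY : killed Y).
HB.instance Definition _ := GRing.Zmodule.on (quo_mod kY).
Definition quo_mod_scale (s : S) (y : quo_mod kY) : quo_mod kY :=
  (repr s : B) *: (y : Y).
Lemma quo_mod_scaleE' b y : quo_mod_scale (to_quo K b) y = b *: (y : Y).
Proof. exact: killed_repr. Qed.
Fact quo_mod_scaleA a b w : quo_mod_scale a (quo_mod_scale b w) = quo_mod_scale (a * b) w.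
Proof.
have [r <-] := to_quo_surj a; have [s <-] := to_quo_surj b.
by rewrite -to_quoM !quo_mod_scaleE' scalerA.
Qed.
Fact quo_mod_scale1 : left_id 1 quo_mod_scale.
Proof. by move=> w; rewrite [LHS]quo_mod_scaleE' scale1r. Qed.
Fact quo_mod_scaleDr : right_distributive quo_mod_scale +%R.
Proof. by move=> a x y; exact: scalerDr. Qed.
Fact quo_mod_scaleDl w : {morph quo_mod_scale^~ w : a b / a + b}.
Proof.
move=> a b; have [r <-] := to_quo_surj a; have [s <-] := to_quo_surj b.
by rewrite -to_quoD !quo_mod_scaleE' scalerDl.
Qed.
HB.instance Definition _ := GRing.Zmodule_isLmodule.Build S (quo_mod kY)
  quo_mod_scaleA quo_mod_scale1 quo_mod_scaleDr quo_mod_scaleDl.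
Lemma quo_mod_scaleE b (y : quo_mod kY) : to_quo K b *: y = b *: (y : Y).
Proof. exact: quo_mod_scaleE'. Qed.

(** The maps y ↦ 1 ⊗ y and s ⊗ y ↦ s y are mutually inverse. This removes the tensor product from
    the definitions of the two classes. *)
Lemma quo_mod_iso : lmod_iso (tens (quo_bimod K) Y) (quo_mod kY).
Proof.
pose u : quo_bimod K := (1 : S).
have uZ b y : pure (to_quo K b *: u) y = pure u (b *: y) :> tens (quo_bimod K) Y.
  rewrite -pure_bal; congr (pure _ y).
  by rewrite /= /quo_ract [LHS]mulr1 mul1r.
have fl : linear (fun y : quo_mod kY => pure u (y : Y) : tens (quo_bimod K) Y).
  apply: quo_linear => [x y|b y]; first exact: pureDr.
  by rewrite scale_pure quo_mod_scaleE uZ.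
have gb : balanced (fun (s : quo_bimod K) (y : Y) => (s : S) *: (y : quo_mod kY)).
  split=> [s s' y|s y y'|s b y]; first exact: scalerDl.
    exact: scalerDr.
  by rewrite /= /quo_ract -scalerA quo_mod_scaleE.
have gZ r (s : quo_bimod K) (y : Y) :
    (r *: s : S) *: (y : quo_mod kY) = r *: ((s : S) *: (y : quo_mod kY)).
  by rewrite scalerA.
exists (tens_hom gb gZ), (fun y : quo_mod kY => pure u (y : Y)) => [t|y].
- apply: (@tens_hom_ext _ _ _ _ _ (lcomp (mklin fl) (tens_hom gb gZ)) idfun) => s y.
  rewrite /= tens_homE; have [b <-] := to_quo_surj s.
  rewrite quo_mod_scaleE -uZ; congr (pure _ y).
  exact: mulr1.
- by rewrite tens_homE scale1r.
Qed.
End QuoMod.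

Section QuoHom.
Variables (W : lmodType S) (Y : lmodType B) (kY : killed Y).
Fact quo_hom_linear (f : {linear Y -> res W}) : linear (f : quo_mod kY -> W).
Proof.
apply: quo_linear => [x y|b y]; first exact: (linearD f).
by rewrite quo_mod_scaleE; exact: (linearZ_LR f).
Qed.
Definition quo_hom f : {linear quo_mod kY -> W} := mklin (quo_hom_linear f).
Fact hom_quo_linear (f : {linear res W -> Y}) : linear (f : W -> quo_mod kY).
Proof.
apply: quo_linear => [x y|b y]; first exact: (linearD f).
by rewrite quo_mod_scaleE; exact: (linearZ_LR f).
Qed.
Definition hom_quo f : {linear W -> quo_mod kY} := mklin (hom_quo_linear f).
End QuoHom.

Section KerCoker.
Variable q : quadruple K.
Notation X := (quad_X q).
Notation Y := (quad_Y q).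

(** On pure tensors φ(m ⊗ n) y = f(m ⊗ g(n ⊗ y)); the same identity puts φ(t) y in the image of f
    for [coker_killed]. *)
Lemma quad_fg_tens t y :
  (forall n, quad_g q (pure n y) = 0) -> (phi K t : B) *: y = 0.
Proof.
move=> gy; have [s ->] := tensE t; elim: s => [|p s ih].
  by rewrite big_nil linear0 scale0r.
by rewrite big_cons linearD scalerDl ih addr0 /= -quad_fg gy pure0r linear0.
Qed.

Lemma ker_adjunctP y : (forall n, quad_g q (pure n y) = 0) <->
  exists k : ker (adjunct (quad_g q)), ker_val k = y.
Proof.
split=> [gy|[k <-] n].
  by apply/kerP; apply: linear_ext => n; exact: gy.
have /= := congr1 (fun h : lhom N X => lhom_fun h n) (ker_valK k).
exact.
Qed.

Fact ker_killed : killed (ker (adjunct (quad_g q))).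
Proof.
move=> t k; apply: ker_val_inj; apply: quad_fg_tens.
by apply/ker_adjunctP; exists k.
Qed.

Fact coker_killed : killed (coker (quad_f q)).
Proof.
move=> t c; have [y <-] := to_coker_surj c; rewrite -to_cokerZ.
have [s ->] := tensE t; elim: s => [|p s ih].
  by rewrite big_nil linear0 scale0r linear0.
rewrite big_cons linearD scalerDl to_cokerD ih addr0; apply/to_coker0P.
by exists (pure p.1 (quad_g q (pure p.2 y))); rewrite quad_fg.
Qed.

(* Im φ annihilates Ker g~ and Coker f, which are thus modules over B / Im φ. *)
Definition KerQ : lmodType S := quo_mod ker_killed.
Definition CokQ : lmodType S := quo_mod coker_killed.

Lemma KerQ_iso : lmod_iso (tens (quo_bimod K) (ker (adjunct (quad_g q)))) KerQ.
Proof. exact: quo_mod_iso. Qed.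
Lemma CokQ_iso : lmod_iso (tens (quo_bimod K) (coker (quad_f q))) CokQ.
Proof. exact: quo_mod_iso. Qed.

Fact KerQ_in_linear : linear (fun k : res KerQ => ker_val (k : ker (adjunct (quad_g q)))).
Proof.
move=> b x y; rewrite res_scaleE quo_mod_scaleE.
exact: ker_val_linear.
Qed.
Definition KerQ_in : {linear res KerQ -> Y} := mklin KerQ_in_linear.

Fact CokQ_pr_linear : linear (fun y => to_coker (quad_f q) y : res CokQ).
Proof.
move=> b x y; rewrite res_scaleE quo_mod_scaleE.
exact: to_coker_linear.
Qed.
Definition CokQ_pr : {linear Y -> res CokQ} := mklin CokQ_pr_linear.

Lemma KerQ_in_inj : injective KerQ_in.
Proof. exact: ker_val_inj. Qed.
Lemma KerQ_inP y : (forall n, quad_g q (pure n y) = 0) <-> exists k, KerQ_in k = y.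
Proof. exact: ker_adjunctP. Qed.
Lemma KerQ_in0 n k : quad_g q (pure n (KerQ_in k)) = 0.
Proof. by move: n; apply/KerQ_inP; exists k. Qed.
Lemma CokQ_pr_surj : surjective CokQ_pr.
Proof. exact: to_coker_surj. Qed.
Lemma CokQ_prP y : CokQ_pr y = 0 <-> exists t, quad_f q t = y.
Proof. exact: to_coker0P. Qed.
Lemma CokQ_pr0 t : CokQ_pr (quad_f q t) = 0.
Proof. by apply/CokQ_prP; exists t. Qed.

(** Together with [CokQ_lift] this describes the adjoints of Z: maps Z(W) -> (X, Y) amount to maps W
    -> Ker g~, and maps (X, Y) -> Z(W) to maps Coker f -> W. *)
Lemma KerQ_lift (W : lmodType S) (b : {linear res W -> Y}) :
    (forall n w, quad_g q (pure n (b w)) = 0) ->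
  exists k : {linear W -> KerQ}, forall w, KerQ_in (k w) = b w.
Proof.
move=> gb; have [|k kE] := ker_corestrict (f := adjunct (quad_g q)) (h := b).
  by move=> w; apply: linear_ext => n; exact: gb.
by exists (hom_quo ker_killed k) => w; rewrite /= kE.
Qed.

Lemma CokQ_lift (W : lmodType S) (b : {linear Y -> res W}) :
    (forall m x, b (quad_f q (pure m x)) = 0) ->
  exists k : {linear CokQ -> W}, forall y, k (CokQ_pr y) = b y.
Proof.
move=> bf; have [|k kE] := coker_lift (f := quad_f q) (h := b).
  apply: (@tens_hom_ext _ _ _ _ _ (lcomp b (quad_f q)) (zero_map _ _)) => m x /=.
  exact: bf.
by exists (quo_hom coker_killed k) => y; rewrite /= kE.
Qed.
End KerCoker.

Definition epi_g (q : quadruple K) := surjective (adjunct (quad_g q)).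

Lemma epi_gP (q : quadruple K) : epi_g q <->
  forall h : {linear N -> quad_X q}, exists y, forall n, quad_g q (pure n y) = h n.
Proof.
split=> [gs h|gs h].
  have [y yE] := gs (h : lhom N (quad_X q)); exists y => n.
  exact: (congr1 (fun h : lhom N (quad_X q) => lhom_fun h n) yE).
by have [y yE] := gs h; exists y; apply: linear_ext => n; exact: yE.
Qed.
End QuotientModules.

(** * Special quadruples *)

Section Constructions.
Variables (A B : pzRingType) (M : bimodType B A) (N : bimodType A B).
Variable K : morita_context M N.
Notation S := (quo_ring K).
Implicit Types q : quadruple K.

Section Tensor.
Variable X : lmodType A.

(** One stage of the map N ⊗ (M ⊗ X) -> X, n ⊗ (m ⊗ x) ↦ ψ(n ⊗ m) x: the element [n] is fixed and
    the inner tensor product is treated. *)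
Definition psi_act (n : N) (t : tens M X) : X :=
  tens_lift (fun m x => (psi K (pure n m) : A) *: x) t.

Fact psi_act_bal n : balanced (fun (m : M) (x : X) => (psi K (pure n m) : A) *: x).
Proof.
split=> [m m' x|m x x'|m s x].
- by rewrite pureDr linearD scalerDl.
- exact: scalerDr.
- by rewrite psi_ract scalerA.
Qed.

Lemma psi_actE n m x : psi_act n (pure m x) = (psi K (pure n m) : A) *: x.
Proof. exact: tens_liftE (psi_act_bal n). Qed.

Lemma psi_actD n : {morph psi_act n : t u / t + u}.
Proof. exact: tens_liftD (psi_act_bal n). Qed.

Fact psi_act_balanced : balanced psi_act.
Proof.
split=> [n n' t|n t t'|n b t]; last 1 first.
- move: t; apply: tens_ext => [t u|t u|m x]; rewrite ?scalerDr ?psi_actD //.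
  by rewrite scale_pure !psi_actE pure_bal.
- move: t; apply: tens_ext => [t u|t u|m x]; rewrite ?psi_actD // 1?addrACA //.
  by rewrite !psi_actE pureDl linearD scalerDl.
- exact: psi_actD.
Qed.

Fact psi_actZ a n t : psi_act (a *: n) t = a *: psi_act n t.
Proof.
move: t; apply: tens_ext => [t u|t u|m x]; rewrite ?psi_actD ?scalerDr //.
by rewrite !psi_actE -scale_pure linearZ /= scalerA.
Qed.

Definition tens_g : {linear tens N (tens M X) -> X} :=
  tens_hom psi_act_balanced psi_actZ.

Lemma tens_gE n m x : tens_g (pure n (pure m x)) = (psi K (pure n m) : A) *: x.
Proof. by rewrite tens_homE psi_actE. Qed.

Definition tens_f : {linear tens M X -> tens M X} := idfun.

Fact tens_gf n m x : tens_g (pure n (tens_f (pure m x))) = (psi K (pure n m) : A) *: x.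
Proof. exact: tens_gE. Qed.
Fact tens_fg m n (y : tens M X) :
  tens_f (pure m (tens_g (pure n y))) = (phi K (pure m n) : B) *: y.
Proof.
move: y; apply: tens_ext => [t u|t u|m' x]; rewrite ?pureDr ?linearD ?pureDr ?scalerDr //=.
by rewrite tens_gE -pure_bal phi_psi scale_pure.
Qed.

(* (X, M ⊗_A X) *)
Definition tens_quad : quadruple K := Quadruple tens_gf tens_fg.

(** T is left adjoint to (X, Y) ↦ X; this is the map T(X) -> q with first component [a]. *)
Lemma tens_quad_lift q (a : {linear X -> quad_X q}) :
  exists h : {linear quad_mod tens_quad -> quad_mod q},
    forall x t, h (x, t) = (a x, quad_f q (tens_map M a t)).
Proof.
have bf m x : lcomp (quad_f q) (tens_map M a) (quad_f tens_quad (pure m x)) =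
    quad_f q (pure m (a x)) by rewrite /= tens_mapE.
have ag n t : a (quad_g tens_quad (pure n t)) =
    quad_g q (pure n (lcomp (quad_f q) (tens_map M a) t)).
  move: t; apply: tens_ext => [t u|t u|m x].
  - by rewrite pureDr !linearD.
  - by rewrite linearD pureDr linearD.
  - by rewrite /= tens_mapE quad_gf tens_gE linearZ.
by exists (quad_hom bf ag).
Qed.
End Tensor.

Section HomModule.
Variable V : lmodType A.

Fact psi_hom_linear (m : M) (v : V) :
  linear (fun n : N => (psi K (pure n m) : A) *: v).
Proof.
by move=> a n n'; rewrite pureDl -scale_pure linearP scalerDl scalerA.
Qed.
Definition psi_hom (m : M) (v : V) : lhom N V := mklin (psi_hom_linear m v).

Fact psi_hom_bal : balanced psi_hom.
Proof.
split=> [m m' v|m v v'|m a v]; apply: linear_ext => n /=.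
- by rewrite pureDr linearD scalerDl.
- by rewrite scalerDr.
- by rewrite psi_ract scalerA.
Qed.
Fact psi_homZ b m v : psi_hom (b *: m) v = b *: psi_hom m v.
Proof. by apply: linear_ext => n; rewrite /= /lhom_scale_fun /= pure_bal. Qed.

Definition hom_mod_f : {linear tens M V -> lhom N V} := tens_hom psi_hom_bal psi_homZ.

Fact eval_bal : balanced (fun (n : N) (h : lhom N V) => lhom_fun h n).
Proof. by split=> [n n' h|n h h'|n b h] //; rewrite linearD. Qed.
Fact evalZ a n (h : lhom N V) : lhom_fun h (a *: n) = a *: lhom_fun h n.
Proof. exact: linearZ. Qed.

Definition hom_mod_g : {linear tens N (lhom N V) -> V} := tens_hom eval_bal evalZ.

Lemma hom_mod_gE n h : hom_mod_g (pure n h) = lhom_fun h n.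
Proof. exact: tens_homE. Qed.

Fact hom_gf n m x :
  hom_mod_g (pure n (hom_mod_f (pure m x))) = (psi K (pure n m) : A) *: x.
Proof. by rewrite !tens_homE. Qed.
Fact hom_fg m n (y : lhom N V) :
  hom_mod_f (pure m (hom_mod_g (pure n y))) = (phi K (pure m n) : B) *: y.
Proof.
apply: linear_ext => n'; rewrite !tens_homE /= /lhom_scale_fun psi_phi.
by rewrite (linearZ_LR (lhom_fun y)).
Qed.

(* (V, Hom_A(N, V)) *)
Definition hom_quad : quadruple K := Quadruple hom_gf hom_fg.

(** H is right adjoint to (X, Y) ↦ X; this is the map q -> H(V) with first component [a]. *)
Lemma hom_quad_lift q (a : {linear quad_X q -> V}) :
  exists h : {linear quad_mod q -> quad_mod hom_quad},
    forall x y, h (x, y) = (a x, adjunct (lcomp a (quad_g q)) y).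
Proof.
pose b : {linear quad_Y q -> lhom N V} := adjunct (lcomp a (quad_g q)).
have bf m x : b (quad_f q (pure m x)) = quad_f hom_quad (pure m (a x)).
  apply: linear_ext => n; rewrite /= tens_homE /=.
  by rewrite /adjunct_fun /= quad_gf linearZ.
have ag n y : a (quad_g q (pure n y)) = quad_g hom_quad (pure n (b y)).
  by rewrite /= hom_mod_gE.
by exists (@quad_hom _ _ _ _ _ _ hom_quad a b bf ag).
Qed.
End HomModule.

Section Zero.
Variable W : lmodType S.

Fact zero_gf n m x : zero_map (tens N (res W)) (zero_mod A)
    (pure n (zero_map (tens M (zero_mod A)) (res W) (pure m x))) =
  (psi K (pure n m) : A) *: x.
Proof. by rewrite [RHS]zero_modE. Qed.
(** The left side is 0, so Im φ must annihilate [W]; hence [W] is a module over B / Im φ. *)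
Fact zero_fg m n y : zero_map (tens M (zero_mod A)) (res W)
    (pure m (zero_map (tens N (res W)) (zero_mod A) (pure n y))) =
  (phi K (pure m n) : B) *: y.
Proof. by rewrite res_scaleE to_quo_phi scale0r. Qed.

(* (0, W) *)
Definition zero_quad : quadruple K := Quadruple zero_gf zero_fg.

Lemma zero_quad_in q (b : {linear res W -> quad_Y q}) :
    (forall n w, quad_g q (pure n (b w)) = 0) ->
  exists h : {linear quad_mod zero_quad -> quad_mod q}, forall x w, h (x, w) = (0, b w).
Proof.
move=> gb.
have bf m x : b (quad_f zero_quad (pure m x)) =
    quad_f q (pure m (zero_map (zero_mod A) (quad_X q) x)).
  by rewrite /= pure0r !linear0.
have ag n y : zero_map (zero_mod A) (quad_X q) (quad_g zero_quad (pure n y)) =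
    quad_g q (pure n (b y)) by rewrite gb.
by exists (quad_hom bf ag).
Qed.

Lemma zero_quad_out q (b : {linear quad_Y q -> res W}) :
    (forall m x, b (quad_f q (pure m x)) = 0) ->
  exists h : {linear quad_mod q -> quad_mod zero_quad}, forall x y, h (x, y) = (0, b y).
Proof.
move=> bf0.
pose a := zero_map (quad_X q) (zero_mod A).
have bf m x : b (quad_f q (pure m x)) = quad_f zero_quad (pure m (a x)) by rewrite bf0.
have ag n y : a (quad_g q (pure n y)) = quad_g zero_quad (pure n (b y)) by [].
by exists (@quad_hom _ _ _ _ _ q zero_quad a b bf ag).
Qed.
End Zero.

Section Projective.
Fact ract_bal : balanced (fun (n : N) (b : B^o) => ract n b).
Proof.
by split=> [n n' b|n b b'|n b b']; rewrite ?ractDl ?ractDr ?ractA.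
Qed.
Fact ract_Z (a : A) (n : N) (b : B) : ract (a *: n) b = a *: ract n b.
Proof. exact: ractZ. Qed.

Definition ract_hom : {linear tens N B^o -> N} := tens_hom ract_bal ract_Z.

Fact proj_gf n m (x : N) : ract_hom (pure n (phi K (pure m x))) = (psi K (pure n m) : A) *: x.
Proof. by rewrite tens_homE psi_phi. Qed.
Fact proj_fg m n (y : B^o) : phi K (pure m (ract_hom (pure n y))) = (phi K (pure m n) : B) *: y.
Proof. by rewrite tens_homE phi_ract. Qed.

(* The second column of Λ, i.e. the projective module Λ e_B = (N, B). *)
Definition proj_quad : quadruple K := Quadruple proj_gf proj_fg.

(** As f is φ on Λ e_B, this cokernel is the regular module B / Im φ, and a lift is determined by
    choosing a preimage of the image of 1. *)
Lemma projective_CokQ_proj_quad : projective (CokQ proj_quad).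
Proof.
move=> V W p h ps; have [v pv] := ps (h (CokQ_pr proj_quad (1 : B^o))).
have bl : linear (fun b : B^o => to_quo K b *: (v : V) : res V).
  move=> a x y.
  have -> : to_quo K (a *: x + y : B) = to_quo K a * to_quo K x + to_quo K y.
    by rewrite -to_quoM -to_quoD.
  by rewrite scalerDl -scalerA.
pose b0 : {linear quad_Y proj_quad -> res V} := mklin bl.
have [|k kE] := CokQ_lift (b := b0).
  by move=> m x /=; rewrite to_quo_phi scale0r.
exists k => c; have [b <-] := @CokQ_pr_surj _ _ _ _ _ proj_quad c.
have e : CokQ_pr proj_quad b = to_quo K (b : B) *: (CokQ_pr proj_quad (1 : B^o) : CokQ proj_quad).
  rewrite -[LHS](congr1 (CokQ_pr proj_quad) (mulr1 b)).
  exact: (linearZ_LR (CokQ_pr proj_quad) b 1).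
by rewrite kE /= linearZ /= pv e linearZ.
Qed.
End Projective.
End Constructions.

(** * Character modules *)

Local Notation QZ := rat_mod_int.

Section CharacterModules.
Variables (S : pzRingType) (T : zmodType) (r : T -> S -> T).
Hypothesis rA : forall m s t, r (r m s) t = r m (s * t).
Hypothesis r1 : forall m, r m 1 = m.
Hypothesis rDr : forall m s t, r m (s + t) = r m s + r m t.
Hypothesis rDl : forall m m' s, r (m + m') s = r m s + r m' s.

Fact int_ractZ (n : int) (m : zmodule T) s : r (n *: m) s = n *: (r m s : zmodule T).
Proof.
have rD : {morph (fun m => r m s : zmodule T) : x y / x + y} by move=> x y; exact: rDl.
have /= := linearZ_LR (mklin (additive_int_linear rD)) n m.
exact.
Qed.

(** A right [S]-module seen as a bimodule over the integers and [S], so that [lhom] makes its group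
    of characters a left [S]-module. *)
Definition int_bimod : bimodType int S :=
  @Bimod int S (zmodule T) r rA r1 rDr rDl int_ractZ.
End CharacterModules.

Section Injective.
Variables (A B : pzRingType) (M : bimodType B A) (N : bimodType A B).
Variable K : morita_context M N.
Notation S := (quo_ring K).

(* Hom_Z(M, Q/Z) and Hom_Z(B, Q/Z). *)
Definition charM : lmodType A :=
  lhom (int_bimod (@ractA _ _ M) (@ractr1 _ _ M) (@ractDr _ _ M) (@ractDl _ _ M)) QZ.
Definition charB : lmodType B :=
  lhom (int_bimod (fun x y z : B => esym (mulrA x y z)) (@mulr1 B) (@mulrDr B)
    (fun x y z : B => mulrDl x y z)) QZ.

Definition mk_charM (f : M -> QZ) (fD : {morph f : x y / x + y}) : charM :=
  mklin (additive_int_linear fD).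
Definition mk_charB (f : B -> QZ) (fD : {morph f : x y / x + y}) : charB :=
  mklin (additive_int_linear fD).

Definition evM (h : charM) (m : M) : QZ := lhom_fun h m.
Definition evB (h : charB) (b : B) : QZ := lhom_fun h b.

Lemma charM_ext (h k : charM) : evM h =1 evM k -> h = k.
Proof. by move=> e; apply: linear_ext. Qed.
Lemma charB_ext (h k : charB) : evB h =1 evB k -> h = k.
Proof. by move=> e; apply: linear_ext. Qed.
Lemma evM_add h x y : evM h (x + y) = evM h x + evM h y.
Proof. exact: (linearD (lhom_fun h)). Qed.
Lemma evB_add h x y : evB h (x + y) = evB h x + evB h y.
Proof. exact: (linearD (lhom_fun h)). Qed.
Lemma evM_D h k x : evM (h + k) x = evM h x + evM k x. Proof. by []. Qed.
Lemma evB_D h k x : evB (h + k) x = evB h x + evB k x. Proof. by []. Qed.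
Lemma evM_Z a h x : evM (a *: h) x = evM h (ract x a). Proof. by []. Qed.
Lemma evB_Z b h x : evB (b *: h) x = evB h (x * b). Proof. by []. Qed.
Lemma evM_mk f fD x : evM (@mk_charM f fD) x = f x. Proof. by []. Qed.
Lemma evB_mk f fD x : evB (@mk_charB f fD) x = f x. Proof. by []. Qed.

(** The structure maps of the character module are the transposes of the right multiplications b ↦ b
    m and m ↦ φ(m ⊗ n) on e_B Λ. *)
Fact char_f_add (m : M) (h : charM) : {morph (fun b : B => evM h (b *: m)) : x y / x + y}.
Proof. by move=> x y; rewrite scalerDl evM_add. Qed.
Definition char_f_fun (m : M) (h : charM) : charB := mk_charB (char_f_add m h).
Fact char_f_bal : balanced char_f_fun.
Proof.
split=> [m m' h|m h h'|m a h]; apply: charB_ext => b.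
- by rewrite evB_D !evB_mk scalerDr evM_add.
- by rewrite evB_D !evB_mk evM_D.
- by rewrite !evB_mk evM_Z ractZ.
Qed.
Fact char_fZ b m h : char_f_fun (b *: m) h = b *: char_f_fun m h.
Proof. by apply: charB_ext => b'; rewrite evB_Z !evB_mk scalerA. Qed.
Definition char_f : {linear tens M charM -> charB} := tens_hom char_f_bal char_fZ.

Fact char_g_add (n : N) (h : charB) :
  {morph (fun m : M => evB h (phi K (pure m n))) : x y / x + y}.
Proof. by move=> x y; rewrite pureDl linearD evB_add. Qed.
Definition char_g_fun (n : N) (h : charB) : charM := mk_charM (char_g_add n h).
Fact char_g_bal : balanced char_g_fun.
Proof.
split=> [m m' h|m h h'|m a h]; apply: charM_ext => b.
- by rewrite evM_D !evM_mk pureDr linearD evB_add.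
- by rewrite evM_D !evM_mk evB_D.
- by rewrite !evM_mk evB_Z phi_ract.
Qed.
Fact char_gZ a n h : char_g_fun (a *: n) h = a *: char_g_fun n h.
Proof. by apply: charM_ext => m; rewrite evM_Z !evM_mk pure_bal. Qed.
Definition char_g : {linear tens N charB -> charM} := tens_hom char_g_bal char_gZ.

Fact char_gf n m x : char_g (pure n (char_f (pure m x))) = (psi K (pure n m) : A) *: x.
Proof.
apply: charM_ext => m'.
by rewrite !tens_homE evM_Z evM_mk evB_mk phi_psi.
Qed.
Fact char_fg m n y : char_f (pure m (char_g (pure n y))) = (phi K (pure m n) : B) *: y.
Proof.
apply: charB_ext => b.
by rewrite !tens_homE evB_Z evB_mk evM_mk -scale_pure linearZ.
Qed.

(* The character module of the second row of Λ, i.e. of the right module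
   e_B Λ = (M, B). *)
Definition char_quad : quadruple K := Quadruple char_gf char_fg.

Lemma char_quad_f m h b : evB (quad_f char_quad (pure m h)) b = evM h (b *: m).
Proof. by rewrite /= tens_homE. Qed.
Lemma char_quad_g n h m : evM (quad_g char_quad (pure n h)) m = evB h (phi K (pure m n)).
Proof. by rewrite /= tens_homE. Qed.

(** A map from N to the characters of M is a character of M ⊗ N. As φ is mono and Q/Z is injective,
    it extends along φ to a character of B, which is the required preimage. *)
Lemma char_quad_epi : injective (phi K) -> epi_g char_quad.
Proof.
move=> phi_inj; apply/epi_gP => eta.
have bal : balanced (fun (m : M) (n : N) => evM (eta n) m).
  split=> [m m' n|m n n'|m a n]; first exact: evM_add.
    by rewrite linearD.
  by rewrite linearZ.
have phD : {morph (fun t : tens M N => phi K t : zmodule B) : x y / x + y}.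
  by move=> x y; exact: linearD.
pose ph : {linear zmodule (tens M N) -> zmodule B} := mklin (additive_int_linear phD).
pose et : {linear zmodule (tens M N) -> QZ} :=
  mklin (additive_int_linear (tens_liftD bal)).
have [chi chiE] := @rat_mod_int_injective _ _ ph et phi_inj.
have chiD : {morph (chi : B -> QZ) : x y / x + y} by move=> x y; exact: (linearD chi).
exists (mk_charB chiD) => n; apply: charM_ext => m.
by rewrite char_quad_g evB_mk [LHS](chiE (pure m n)) /= tens_liftE.
Qed.

(** Here Ker g~ is the character module of B / Im φ, hence injective: evaluate [h] at 1, extend the
    resulting character χ to [F], and send x to b ↦ χ(b x). *)
Lemma ext1_KerQ_char_quad (U : lmodType S) : ext1_zero U (KerQ char_quad).
Proof.
move=> E F i p es h; have [ii _ _] := es.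
have h1D : {morph (fun x => evB (KerQ_in char_quad (h x)) 1) : x y / x + y}.
  by move=> x y; rewrite linearD.
have iD : {morph (fun x => i x : zmodule F) : x y / x + y} by move=> x y; exact: linearD.
have [chi chiE] := @rat_mod_int_injective _ _ (mklin (additive_int_linear iD))
  (mklin (additive_int_linear h1D)) ii.
have cD (e : F) : {morph (fun b : B => chi (to_quo K b *: e)) : x y / x + y}.
  by move=> x y; rewrite to_quoD scalerDl [LHS](linearD chi).
have kl : linear (fun e : res F => mk_charB (cD e) : quad_Y char_quad).
  move=> b x y; apply: charB_ext => b'.
  rewrite evB_D evB_Z !evB_mk res_scaleE scalerDr scalerA to_quoM.
  exact: (linearD chi).
have [|k kE] := KerQ_lift (q := char_quad) (b := mklin kl).
  move=> n e; apply: charM_ext => m; rewrite char_quad_g /= evB_mk to_quo_phi scale0r.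
  exact: (linear0 chi).
exists k => x; apply: KerQ_in_inj; apply: charB_ext => b; rewrite kE /= evB_mk.
have e : KerQ_in char_quad (to_quo K b *: h x) = b *: KerQ_in char_quad (h x).
  exact: (linearZ_LR (KerQ_in char_quad) b (h x)).
rewrite -linearZ [LHS](chiE (to_quo K b *: x)) [LHS]/= linearZ_LR.
by rewrite [X in evB X _]e evB_Z mul1r.
Qed.
End Injective.

(** * Extensions of quadruples *)

Section ExtComputations.
Variables (A B : pzRingType) (M : bimodType B A) (N : bimodType A B).
Variable K : morita_context M N.
Notation S := (quo_ring K).
Implicit Types q e : quadruple K.

Lemma hom_XYE q q' (h : {linear quad_mod q -> quad_mod q'})
    (a : quad_X q -> quad_X q') (b : quad_Y q -> quad_Y q') :
  (forall x y, h (x, y) = (a x, b y)) -> hom_X h =1 a /\ hom_Y h =1 b.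
Proof.
move=> hE; split=> z; first exact: (hom_XE (hE z 0)).
exact: (hom_YE (hE 0 z)).
Qed.

Lemma ses_quadI q1 q2 q3 (i : {linear quad_mod q1 -> quad_mod q2})
    (p : {linear quad_mod q2 -> quad_mod q3})
    (a : {linear quad_X q1 -> quad_X q2}) (b : {linear quad_Y q1 -> quad_Y q2})
    (c : {linear quad_X q2 -> quad_X q3}) (d : {linear quad_Y q2 -> quad_Y q3}) :
  (forall x y, i (x, y) = (a x, b y)) -> (forall x y, p (x, y) = (c x, d y)) ->
  short_exact a c -> short_exact b d -> short_exact i p.
Proof.
move=> /hom_XYE[/linear_ext iX /linear_ext iY] /hom_XYE[/linear_ext pX /linear_ext pY].
by rewrite ses_quad iX iY pX pY.
Qed.

Lemma ses_id (R : pzRingType) (X Z : lmodType R) : (forall z : Z, z = 0) ->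
  short_exact (idfun : {linear X -> X}) (zero_map X Z).
Proof.
move=> Z0; split=> [//|x|z]; first by split=> // _; exists x.
by exists 0; rewrite (Z0 z).
Qed.

Lemma ses_id0 (R : pzRingType) (X Z : lmodType R) : (forall z : Z, z = 0) ->
  short_exact (zero_map Z X) (idfun : {linear X -> X}).
Proof.
move=> Z0; split=> [x y _|x|z]; first by rewrite (Z0 x) (Z0 y).
  by split=> [e|[_ <-] //]; exists 0; rewrite -[x]/(idfun x) e.
by exists z.
Qed.

Lemma ses_T q : injective (quad_f q) ->
  exists (i : {linear quad_mod (tens_quad K (quad_X q)) -> quad_mod q})
      (p : {linear quad_mod q -> quad_mod (zero_quad (CokQ q))}),
    short_exact i p /\ hom_X i =1 id.
Proof.
move=> fi; have [i iE] := tens_quad_lift (idfun : {linear quad_X q -> quad_X q}).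
have [|p pE] := zero_quad_out (b := CokQ_pr q); first by move=> m x; exact: CokQ_pr0.
have iE' x t : i (x, t) = ((idfun : {linear quad_X q -> quad_X q}) x, quad_f q t).
  by rewrite iE tens_map_id.
have pE' x y : p (x, y) = (zero_map (quad_X q) (zero_mod A) x, CokQ_pr q y).
  exact: pE.
exists i, p; split; last exact: (hom_XYE iE).1.
apply: (@ses_quadI (tens_quad K (quad_X q)) q (zero_quad (CokQ q)) _ _ _ _ _ _ iE' pE').
  by apply: ses_id; exact: zero_modE.
by split=> [//|y|]; [exact: CokQ_prP|exact: CokQ_pr_surj].
Qed.

(** The dual of [ses_T]: when g~ is epi, 0 -> Z(Ker g~) -> (X, Y) -> H(X) -> 0 is exact, the last
    map being g~ on second components. *)
Lemma ses_H q : epi_g q ->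
  exists (i : {linear quad_mod (zero_quad (KerQ q)) -> quad_mod q})
      (p : {linear quad_mod q -> quad_mod (hom_quad K (quad_X q))}),
    short_exact i p /\ hom_X p =1 id.
Proof.
move=> gs; have [p pE] := hom_quad_lift (idfun : {linear quad_X q -> quad_X q}).
have [|i iE] := zero_quad_in (b := KerQ_in q); first by move=> n w; exact: KerQ_in0.
pose b : {linear quad_Y q -> quad_Y (hom_quad K (quad_X q))} :=
  adjunct (lcomp (idfun : {linear quad_X q -> quad_X q}) (quad_g q)).
have bE y n : lhom_fun (b y) n = quad_g q (pure n y) by [].
have iE' x y : i (x, y) = (zero_map (zero_mod A) (quad_X q) x, KerQ_in q y).
  exact: iE.
have pE' x y : p (x, y) = ((idfun : {linear quad_X q -> quad_X q}) x, b y).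
  exact: pE.
exists i, p; split; last exact: (hom_XYE pE).1.
apply: (@ses_quadI (zero_quad (KerQ q)) q (hom_quad K (quad_X q)) _ _ _ _ _ _ iE' pE').
  by apply: ses_id0; exact: zero_modE.
split=> [|y|h]; first exact: KerQ_in_inj.
- rewrite -KerQ_inP; split=> [e n|e]; first by rewrite -bE e.
  by apply: linear_ext => n; exact: e.
- have [y yE] := (epi_gP q).1 gs (lhom_fun h); exists y.
  by apply: linear_ext => n; exact: yE.
Qed.

Lemma ses_Tmap (E F U : lmodType A) (i : {linear E -> F}) (p : {linear F -> U}) :
    Tor1_vanishes M U -> short_exact i p ->
  exists (i' : {linear quad_mod (tens_quad K E) -> quad_mod (tens_quad K F)})
      (p' : {linear quad_mod (tens_quad K F) -> quad_mod (tens_quad K U)}),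
    [/\ short_exact i' p', hom_X i' =1 i & hom_X p' =1 p].
Proof.
move=> tor es; have [i' i'E] := tens_quad_lift (q := tens_quad K F) i.
have [p' p'E] := tens_quad_lift (q := tens_quad K U) p.
exists i', p'; split; [|exact: (hom_XYE i'E).1|exact: (hom_XYE p'E).1].
have [ii ex ps] := es.
apply: (@ses_quadI (tens_quad K E) (tens_quad K F) (tens_quad K U)
  _ _ _ (tens_map M i) _ (tens_map M p) i'E p'E es).
split; [exact: Tor1_inj tor es|exact: tens_right_exact|exact: tens_map_surj].
Qed.

(** The vanishing of Ext^1(N, V) lifts maps N -> C to [W]; the rest is left exactness of Hom. *)
Lemma ses_Hmap (V W C : lmodType A) (i : {linear V -> W}) (p : {linear W -> C}) :
    ext1_zero N V -> short_exact i p ->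
  exists (i' : {linear quad_mod (hom_quad K V) -> quad_mod (hom_quad K W)})
      (p' : {linear quad_mod (hom_quad K W) -> quad_mod (hom_quad K C)}),
    [/\ short_exact i' p', hom_X i' =1 i & hom_X p' =1 p].
Proof.
move=> nv es.
have [i' i'E] := hom_quad_lift (q := hom_quad K V) i.
have [p' p'E] := hom_quad_lift (q := hom_quad K W) p.
exists i', p'; split; [|exact: (hom_XYE i'E).1|exact: (hom_XYE p'E).1].
pose b : {linear quad_Y (hom_quad K V) -> quad_Y (hom_quad K W)} :=
  adjunct (lcomp i (quad_g (hom_quad K V))).
pose d : {linear quad_Y (hom_quad K W) -> quad_Y (hom_quad K C)} :=
  adjunct (lcomp p (quad_g (hom_quad K W))).
have bE h n : lhom_fun (b h) n = i (lhom_fun h n).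
  by rewrite /= /adjunct_fun /= hom_mod_gE.
have dE h n : lhom_fun (d h) n = p (lhom_fun h n).
  by rewrite /= /adjunct_fun /= hom_mod_gE.
have [ii ex ps] := es.
apply: (@ses_quadI (hom_quad K V) (hom_quad K W) (hom_quad K C) _ _ _ b _ d i'E p'E es).
split.
- move=> h k e; apply: linear_ext => n; apply: ii.
  by rewrite -[LHS]bE e bE.
- move=> h; split=> [e|[k <-]]; last first.
    by apply: linear_ext => n; rewrite [LHS]dE bE; apply/ex; exists (lhom_fun k n).
  have [|k kE] := ses_lift (h := lhom_fun h) es.
    by move=> n; rewrite -dE e.
  by exists k; apply: linear_ext => n; rewrite [LHS]bE; exact: kE.
- move=> h; have [k kE] := ext1_lift (lhom_fun h) nv es.
  by exists k; apply: linear_ext => n; rewrite [LHS]dE; exact: kE.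
Qed.

Lemma ses_Zmap (V W C : lmodType S) (i : {linear V -> W}) (p : {linear W -> C}) :
    short_exact i p ->
  exists (i' : {linear quad_mod (@zero_quad _ _ _ _ K V) -> quad_mod (zero_quad W)})
      (p' : {linear quad_mod (zero_quad W) -> quad_mod (zero_quad C)}),
    [/\ short_exact i' p', hom_Y i' =1 i & hom_Y p' =1 p].
Proof.
move=> es.
have [|i' i'E] := zero_quad_in (q := zero_quad W) (b := res_hom i) => //.
have [|p' p'E] := zero_quad_in (q := zero_quad C) (b := res_hom p) => //.
exists i', p'; split; [|exact: (hom_XYE i'E).2|exact: (hom_XYE p'E).2].
have iE x y : i' (x, y) = (zero_map (zero_mod A) (zero_mod A) x, res_hom i y).
  exact: i'E.
have pE x y : p' (x, y) = ((idfun : {linear zero_mod A -> zero_mod A}) x, res_hom p y).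
  by rewrite p'E [x]zero_modE.
apply: (@ses_quadI (zero_quad V) (zero_quad W) (zero_quad C) _ _ _ (res_hom i) _ (res_hom p) iE pE).
  by apply: ses_id0; exact: zero_modE.
exact: es.
Qed.

(** A section on first components extends to T(U) by adjunction; that it is a section on M ⊗ U
    follows by functoriality. *)
Lemma ext1_T (U : lmodType A) q :
  ext1_zero U (quad_X q) -> ext1_zero (quad_mod (tens_quad K U)) (quad_mod q).
Proof.
move=> ux; apply: ext1_quad_section => e i p es.
have [esX esY] := (ses_quad i p).1 es.
have [s sE] := ext1_lift (idfun : {linear U -> quad_X (tens_quad K U)}) ux esX.
have [s' s'E] := tens_quad_lift s.
have e1 : hom_X p \o s =1 id by move=> u; exact: sE.
exists s' => -[u t]; rewrite s'E hom_XY sE hom_f_tens /=; congr (_, _).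
rewrite /= -tens_map_comp -[RHS]tens_map_id.
exact: eq_tens_map.
Qed.

(** T turns the given sequence into an exact one. The adjoint of [h] extends over T(F), and the
    first component of that extension extends [h]. *)
Lemma ext1_T_inv U q : Tor1_vanishes M U ->
  ext1_zero (quad_mod (tens_quad K U)) (quad_mod q) -> ext1_zero U (quad_X q).
Proof.
move=> tor tq E F i p es h.
have [i' [p' [es' iX _]]] := ses_Tmap tor es.
have [h' h'E] := tens_quad_lift h.
have [k kE] := tq _ _ _ _ es' h'.
exists (hom_X k) => x; rewrite -iX.
have := kE (x, 0); rewrite !hom_XY => -[-> _].
exact: (hom_XYE h'E).1.
Qed.

Lemma ext1_H (V : lmodType A) q :
  ext1_zero (quad_X q) V -> ext1_zero (quad_mod q) (quad_mod (hom_quad K V)).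
Proof.
move=> xv; apply: ext1_quad_retraction => e i p es.
have [esX esY] := (ses_quad i p).1 es.
have [r rE] := xv _ _ _ _ esX (idfun : {linear V -> V}).
have [r' r'E] := hom_quad_lift r.
exists r' => -[v h]; rewrite hom_XY r'E rE; congr (_, _).
apply: linear_ext => n; rewrite /= /adjunct_fun /= -hom_g rE.
exact: hom_mod_gE.
Qed.

Lemma ext1_H_inv V q : ext1_zero N V ->
  ext1_zero (quad_mod q) (quad_mod (hom_quad K V)) -> ext1_zero (quad_X q) V.
Proof.
move=> nv qh; apply: ext1_section => E i p es.
have [i' [p' [es' _ pX]]] := ses_Hmap nv es.
have [h hE] := hom_quad_lift (idfun : {linear quad_X q -> quad_X q}).
have [k kE] := ext1_lift h qh es'.
exists (hom_X k) => x; rewrite -pX.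
by have := kE (x, 0); rewrite !hom_XY => -[-> _]; exact: (hom_XYE hE).1.
Qed.

(** An extension of Z(U) by [q] restricts to an exact sequence 0 -> Ker g~_q -> Ker g~_e -> U -> 0;
    a section of the latter gives one of the former. *)
Lemma ext1_Z_left U q : epi_g q -> ext1_zero U (KerQ q) ->
  ext1_zero (quad_mod (zero_quad U)) (quad_mod q).
Proof.
move=> gs uk; apply: ext1_quad_section => e i p es.
have [[iXi exX _] [iYi exY pYs]] := (ses_quad i p).1 es.
have iXs x : exists u, hom_X i u = x by apply/exX; exact: zero_modE.
have [|k kE] := KerQ_lift (q := e) (b := lcomp (hom_Y i) (KerQ_in q)).
  by move=> n w; rewrite /= -hom_g KerQ_in0 linear0.
pose pk := unres_hom (lcomp (hom_Y p) (KerQ_in e) : {linear res (KerQ e) -> res U}).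
have esk : short_exact k pk.
  split.
  - move=> x y xy; apply: KerQ_in_inj; apply: iYi.
    by rewrite -[LHS]kE xy; exact: kE.
  - move=> y; split=> [/exY[z zE]|[x <-]].
      have [w wE] : exists w, KerQ_in q w = z.
        apply/KerQ_inP => n; apply: iXi.
        by rewrite hom_g zE linear0; exact: KerQ_in0.
      by exists w; apply: KerQ_in_inj; rewrite kE /= wE.
    by apply/exY; exists (KerQ_in q x); rewrite [RHS]kE.
  - move=> u; have [y yu] := pYs u.
    have al : linear (fun n : N => quad_g e (pure n y)).
      by move=> a n n'; rewrite pureDl -scale_pure linearP.
    have [bi _ biE] := linv (inj_surj_bij iXi iXs).
    (* A preimage [y] of [u] need not lie in Ker g~. Since [hom_X i] is bijective and g~ of [q] is
       epi, some [z] from [q] has the same image under g~ as [y], and y - z is used instead. *)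
    have [z zE] := (epi_gP q).1 gs (lcomp bi (mklin al)).
    have [w wE] : exists w, KerQ_in e w = y - hom_Y i z.
      apply/KerQ_inP => n; rewrite pureDr linearD.
      have -> : pure n (- hom_Y i z) = - pure n (hom_Y i z).
        by apply: (addIr (pure n (hom_Y i z))); rewrite -pureDr !addNr pure0r.
      by rewrite linearN -hom_g zE /= biE subrr.
    exists w; rewrite /= wE linearB yu.
    have -> : hom_Y p (hom_Y i z) = 0 by apply/exY; exists z.
    exact: subr0.
have [s sE] := ext1_lift (idfun : {linear U -> U}) uk esk.
have [|s' s'E] := zero_quad_in (q := e) (b := lcomp (KerQ_in e) (res_hom s)).
  by move=> n w; exact: KerQ_in0.
exists s' => -[x w]; rewrite s'E hom_XY linear0; congr (_, _).
  exact/esym/zero_modE.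
exact: sE.
Qed.

Lemma ext1_Z_left_inv U q : ext1_zero (quad_mod (zero_quad U)) (quad_mod q) ->
  ext1_zero U (KerQ q).
Proof.
move=> zq E F i p es h.
have [i' [p' [es' iY _]]] := ses_Zmap es.
have [|h' h'E] := zero_quad_in (q := q) (b := lcomp (KerQ_in q) (res_hom h)).
  by move=> n w; exact: KerQ_in0.
have [k kE] := zq _ _ _ _ es' h'.
have [|l lE] := KerQ_lift (q := q) (b := hom_Y k).
  by move=> n w; exact: etrans (esym (hom_g k n w)) (linear0 (hom_X k)).
exists l => x; apply: KerQ_in_inj; rewrite lE -iY.
by have := kE (0, x); rewrite !hom_XY => -[_ ->]; exact: (hom_XYE h'E).2.
Qed.

(** A map N -> X is a map from T(N) to [q]; it extends over Λ e_B, and the image of 1 is a preimage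
    of it under g~. *)
Lemma epi_g_of_ext1 q : injective (phi K) ->
  ext1_zero (quad_mod (zero_quad (CokQ (proj_quad K)))) (quad_mod q) -> epi_g q.
Proof.
move=> phi_inj zq; apply/epi_gP => h.
have [i [p [es iX]]] := ses_T (q := proj_quad K) phi_inj.
have [h' h'E] := tens_quad_lift (h : {linear bimod_lmod N -> quad_X q}).
have [k kE] := zq _ _ _ _ es h'.
exists (hom_Y k (1 : B^o)) => n; rewrite -hom_g.
have -> : quad_g (proj_quad K) (pure n (1 : B^o)) = n by rewrite /= tens_homE ractr1.
rewrite -[n in LHS]iX; have := kE (n, 0); rewrite !hom_XY => -[-> _].
exact: (hom_XYE h'E).1.
Qed.

(** An extension of [q] by Z(V) induces 0 -> V -> Coker f_e -> Coker f_q -> 0; a retraction of the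
    latter gives one of the former. *)
Lemma ext1_Z_right V q : injective (quad_f q) -> ext1_zero (CokQ q) V ->
  ext1_zero (quad_mod q) (quad_mod (zero_quad V)).
Proof.
move=> fi cv; apply: ext1_quad_retraction => e i p es.
have [[iXi exX pXs] [iYi exY pYs]] := (ses_quad i p).1 es.
have pXi : injective (hom_X p).
  by apply: linear_inj => x /exX[u <-]; rewrite (zero_modE u) linear0.
pose j : {linear V -> CokQ e} :=
  unres_hom (lcomp (CokQ_pr e) (hom_Y i) : {linear res V -> res (CokQ e)}).
pose c0 : {linear quad_Y e -> res (CokQ q)} := lcomp (CokQ_pr q) (hom_Y p).
have [|pk pkE] := CokQ_lift (b := c0).
  by move=> m x; rewrite /= hom_f CokQ_pr0.
have esk : short_exact j pk.
  split.
  - apply: linear_inj => v /CokQ_prP[t tE].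
    (* If [v] becomes f(t), the image of [t] is killed by the injective f of [q]; as [hom_X p] is
       bijective, [t = 0]. *)
    have pt : quad_f q (tens_map M (hom_X p) t) = 0.
      by rewrite -hom_f_tens tE; apply/exY; exists v.
    have t0 : tens_map M (hom_X p) t = 0 by apply: fi; rewrite pt linear0.
    have [bi biE _] := linv (inj_surj_bij pXi pXs).
    have t0' : t = 0.
      rewrite -[t]tens_map_id -(@eq_tens_map _ _ _ _ _ (lcomp bi (hom_X p))) //.
      by rewrite tens_map_comp t0 linear0.
    by apply: iYi; rewrite -tE t0' !linear0.
  - move=> c; have [y <-] := CokQ_pr_surj c; rewrite [pk _]pkE.
    split=> [/CokQ_prP[t tE]|[v vE]].
      have [t' tE'] := tens_map_surj (M := M) pXs t.
      have /exY[v vE] : hom_Y p (y - quad_f e t') = 0.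
        by rewrite linearB hom_f_tens tE' tE subrr.
      by exists v; rewrite /= vE linearB CokQ_pr0 subr0.
    have := pkE (hom_Y i v); rewrite -/(j v) => e1.
    have e2 : pk (CokQ_pr e y) = pk (j v) by rewrite vE.
    rewrite pkE in e2; rewrite [LHS]e2 [LHS]e1 /=.
    by have -> : hom_Y p (hom_Y i v) = 0; [apply/exY; exists v|rewrite linear0].
  - move=> c; have [y <-] := CokQ_pr_surj c; have [z <-] := pYs y.
    by exists (CokQ_pr e z); rewrite pkE.
have [r rE] := cv _ _ _ _ esk (idfun : {linear V -> V}).
have [|r' r'E] := zero_quad_out (q := e) (b := lcomp (res_hom r) (CokQ_pr e)).
  by move=> m x; rewrite /= CokQ_pr0 linear0.
exists r' => -[x v]; rewrite hom_XY r'E; congr (_, _).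
  exact/esym/zero_modE.
exact: rE.
Qed.

Lemma ext1_Z_right_inv V q : ext1_zero (quad_mod q) (quad_mod (zero_quad V)) ->
  ext1_zero (CokQ q) V.
Proof.
move=> qz; apply: ext1_section => E i p es.
have [i' [p' [es' _ pY]]] := ses_Zmap es.
have [|h hE] := zero_quad_out (q := q) (b := CokQ_pr q); first by move=> m x; exact: CokQ_pr0.
have [k kE] := ext1_lift h qz es'.
have [|l lE] := CokQ_lift (q := q) (b := hom_Y k).
  by move=> m x; exact: etrans (hom_f k m x) (erefl 0).
exists l => c; have [y <-] := CokQ_pr_surj c; rewrite lE -[LHS]pY.
by have := kE (0, y); rewrite !hom_XY => -[_ ->]; exact: (hom_XYE hE).2.
Qed.

(** Every character χ of M ⊗ X factors through f: it is a map from X to the characters of M, hence q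
    -> H(Hom(M, Q/Z)), and lifts to the character module of e_B Λ. Evaluating the second component
    of the lift at 1 gives χ on M ⊗ X. As characters separate points, f is mono. *)
Lemma mono_f_of_ext1 q : injective (phi K) ->
  ext1_zero (quad_mod q) (quad_mod (zero_quad (KerQ (char_quad K)))) -> injective (quad_f q).
Proof.
move=> phi_inj qz; apply: linear_inj => t ft0.
apply: (@rat_mod_int_cogenerator (zmodule (tens M (quad_X q)))) => chi.
have chiD : {morph (chi : tens M (quad_X q) -> QZ) : x y / x + y}.
  by move=> x y; exact: (linearD chi).
have cD x : {morph (fun m : M => chi (pure m x)) : m m' / m + m'}.
  by move=> m m'; rewrite pureDl chiD.
have al : linear (fun x => mk_charM (cD x)).
  move=> a x x'; apply: charM_ext => m; rewrite evM_D evM_Z !evM_mk.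
  by rewrite pureDr chiD pure_bal.
have [i [p [es pX]]] := ses_H (char_quad_epi (K := K) phi_inj).
have [h hE] := hom_quad_lift (mklin al : {linear quad_X q -> charM M}).
have [k kE] := ext1_lift h qz es.
have chiE u : chi u = evB (hom_Y k (quad_f q u)) 1.
  move: u; apply: tens_ext => [u u'|u u'|m x]; first exact: chiD.
    by rewrite !linearD.
  rewrite hom_f char_quad_f scale1r -[hom_X k x]pX.
  have := kE (x, 0); rewrite !hom_XY => -[-> _].
  by have [hX _] := hom_XYE hE; rewrite hX.
by rewrite [LHS]chiE ft0 linear0.
Qed.
End ExtComputations.

(** * Formal properties of cotorsion pairs *)

Section CotorsionFacts.
Variables (R : pzRingType) (C D : mod_class R).
Hypothesis CD : cotorsion_pair C D.

Lemma cotorsion_ext X Y : C X -> D Y -> ext1_zero X Y.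
Proof. by case: CD => _ DC /DC /perp_leftP h; apply: h. Qed.
Lemma cotorsion_left X : (forall Y, D Y -> ext1_zero X Y) -> C X.
Proof. by case: CD => _ DC h; apply/DC/perp_leftP. Qed.
Lemma cotorsion_right Y : (forall X, C X -> ext1_zero X Y) -> D Y.
Proof. by case: CD => CD' _ h; apply/CD'/perp_rightP. Qed.

(** A [mod_class] is an arbitrary predicate; closure under isomorphism comes from that of Ext
    vanishing. *)
Lemma cotorsion_iso_left X X' : lmod_iso X X' -> C X -> C X'.
Proof.
move=> XX' CX; apply: cotorsion_left => Y DY.
exact: ext1_iso XX' (lmod_iso_refl Y) (cotorsion_ext CX DY).
Qed.
Lemma cotorsion_iso_right Y Y' : lmod_iso Y Y' -> D Y -> D Y'.
Proof.
move=> YY' DY; apply: cotorsion_right => X CX.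
exact: ext1_iso (lmod_iso_refl X) YY' (cotorsion_ext CX DY).
Qed.

Lemma ext1_zero_left (X Y : lmodType R) : (forall x : X, x = 0) -> ext1_zero X Y.
Proof.
move=> X0; apply: ext1_section => E i p _.
by exists (zero_map X E) => x; rewrite (X0 x) linear0.
Qed.
Lemma ext1_zero_right (X Y : lmodType R) : (forall y : Y, y = 0) -> ext1_zero X Y.
Proof.
move=> Y0 E F i p _ h; exists (zero_map F Y) => x.
by rewrite (Y0 (h x)).
Qed.

Lemma cotorsion_left0 (X : lmodType R) : (forall x : X, x = 0) -> C X.
Proof. by move=> X0; apply: cotorsion_left => Y _; exact: ext1_zero_left. Qed.
Lemma cotorsion_right0 (X : lmodType R) : (forall x : X, x = 0) -> D X.
Proof. by move=> X0; apply: cotorsion_right => Y _; exact: ext1_zero_right. Qed.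
End CotorsionFacts.

Lemma ses_transport (R : pzRingType) (U V W U' V' W' : lmodType R)
    (i : {linear U -> V}) (p : {linear V -> W}) (a : {linear U' -> U})
    (b : {linear V -> V'}) (b' : {linear V' -> V}) (c : {linear W -> W'}) :
  short_exact i p -> bijective a -> cancel b b' -> cancel b' b -> bijective c ->
  short_exact (lcomp (lcomp b i) a) (lcomp (lcomp c p) b').
Proof.
move=> [ii ex ps] [a' aa' a'a] bb' b'b [c' cc' c'c]; split.
- by move=> x y /(can_inj bb') /ii /(can_inj aa').
- move=> v; split=> [e|[u <-]] /=.
    have /ex[u uE] : p (b' v) = 0 by apply: (can_inj cc'); rewrite linear0.
    by exists (a' u); rewrite /= a'a uE b'b.
  have /ex e : exists t, i t = i (a u) by exists (a u).
  by rewrite bb' e linear0.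
- move=> w; have [v vE] := ps (c' w).
  by exists (b v); rewrite /= bb' vE c'c.
Qed.

Lemma ses_left_iso (R : pzRingType) (U V W : lmodType R)
    (i : {linear U -> V}) (p : {linear V -> W}) :
  short_exact i p -> lmod_iso (ker p) U.
Proof.
move=> es; have [ii ex _] := es.
have [|k kE] := ses_lift (h := @ker_val _ _ _ p) es; first exact: ker_valK.
exists k; apply: inj_surj_bij.
  by move=> x y e; apply: ker_val_inj; rewrite -[LHS]kE e; exact: kE.
move=> u; have /kerP[x xE] : p (i u) = 0 by apply/ex; exists u.
by exists x; apply: ii; rewrite kE.
Qed.

(** * Cokernel sequences and the three pushouts *)

Section Approximations.
Variables (A B : pzRingType) (M : bimodType B A) (N : bimodType A B).
Variable K : morita_context M N.
Notation S := (quo_ring K).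
Implicit Types q e : quadruple K.

(** The end of the snake lemma: with f of [q2] mono there is no connecting map, so the sequence of
    cokernels is exact on the left too. *)
Lemma ses_CokQ q0 q1 q2 (i : {linear quad_mod q0 -> quad_mod q1})
    (p : {linear quad_mod q1 -> quad_mod q2}) :
    short_exact i p -> injective (quad_f q2) ->
  exists (j : {linear CokQ q0 -> CokQ q1}) (k : {linear CokQ q1 -> CokQ q2}),
    short_exact j k.
Proof.
move=> es f2i; have [[iXi exX pXs] [iYi exY pYs]] := (ses_quad i p).1 es.
pose b : {linear quad_Y q0 -> res (CokQ q1)} := lcomp (CokQ_pr q1) (hom_Y i).
pose d : {linear quad_Y q1 -> res (CokQ q2)} := lcomp (CokQ_pr q2) (hom_Y p).
have [|j jE] := CokQ_lift (b := b); first by move=> m x; rewrite /= hom_f CokQ_pr0.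
have [|k kE] := CokQ_lift (b := d); first by move=> m x; rewrite /= hom_f CokQ_pr0.
have pi y : hom_Y p (hom_Y i y) = 0 by apply/exY; exists y.
have dE y : d (hom_Y i y) = 0 by rewrite /= pi linear0.
have tex := tens_right_exact (M := M) exX pXs.
exists j, k; split.
- apply: linear_inj => c; have [y <-] := CokQ_pr_surj c.
  rewrite [j _]jE => /CokQ_prP[t tE].
  have t0 : tens_map M (hom_X p) t = 0.
    by apply: f2i; rewrite -hom_f_tens tE pi linear0.
  have [s sE] := (tex t).1 t0.
  apply/CokQ_prP; exists s; apply: iYi.
  by rewrite hom_f_tens sE tE.
- move=> c; have [y <-] := CokQ_pr_surj c.
  split=> [e|[c0 c0E]].
    rewrite [k _]kE in e; have /CokQ_prP[t tE] := e.
    have [t' tE'] := tens_map_surj (M := M) pXs t.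
    have /exY[z zE] : hom_Y p (y - quad_f q1 t') = 0.
      by rewrite linearB hom_f_tens tE' tE subrr.
    exists (CokQ_pr q0 z); apply: etrans (jE z) _.
    by rewrite /= zE linearB CokQ_pr0 subr0.
  have [z zE] := CokQ_pr_surj c0.
  rewrite -c0E -zE [X in k X]jE.
  exact: etrans (kE (hom_Y i z)) (dE z).
- move=> c; have [y <-] := CokQ_pr_surj c; have [z <-] := pYs y.
  by exists (CokQ_pr q1 z); exact: kE.
Qed.

Lemma quad_pushout (E F X : lmodType (morita_ring K)) q (i : {linear E -> F}) (p : {linear F -> X})
    (h : {linear E -> quad_mod q}) : short_exact i p ->
  exists e (i' : {linear quad_mod q -> quad_mod e}) (p' : {linear quad_mod e -> X})
      (h' : {linear F -> quad_mod e}),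
    [/\ short_exact i' p', forall k, h' (i k) = i' (h k),
        forall x, p' (h' x) = p x
      & forall x, exists v y, x = i' v + h' y].
Proof.
move=> es; have [E' [i' [p' [h' [es' hi ph sur]]]]] := pushout h es.
have [f /linv[g fg gf]] := quad_of_iso E'.
exists (quad_of E'), (lcomp f i'), (lcomp p' g), (lcomp f h').
split; first exact: short_exact_middle.
- by move=> k; rewrite /= hi.
- by move=> x; rewrite /= fg ph.
- move=> x; have [v [y xE]] := sur (g x); exists v, y.
  by rewrite /= -linearD -xE gf.
Qed.

(** The pushout of T(X) -> T(V) along T(X) -> q, which is the identity on first components; hence
    its first component is [V]. *)
Lemma special_sub_X (V : lmodType A) (U : lmodType A) q (i : {linear quad_X q -> V})
    (p : {linear V -> U}) : Tor1_vanishes M U -> short_exact i p ->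
  exists e, lmod_iso V (quad_X e) /\
    exists (j : {linear quad_mod q -> quad_mod e})
      (r : {linear quad_mod e -> quad_mod (tens_quad K U)}), short_exact j r.
Proof.
move=> tor es; have [ii ex ps] := es.
have [i' [p' [es' iX pX]]] := ses_Tmap K tor es.
have [c cE] := tens_quad_lift (idfun : {linear quad_X q -> quad_X q}).
have [e [j [r [h [esj hi rh sur]]]]] := quad_pushout c es'.
have [[jXi _ _] _] := (ses_quad j r).1 esj.
have hX x : hom_X h (i x) = hom_X j x.
  rewrite -iX; have := hi (x, 0); rewrite !hom_XY => -[-> _].
  by rewrite [hom_X c x](hom_XYE cE).1.
exists e; split; last by exists j, r.
exists (hom_X h); apply: inj_surj_bij.
- apply: linear_inj => v v0; have pv : p v = 0.
    rewrite -[p v]pX; have := rh (v, 0); rewrite !hom_XY => -[<- _].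
    by rewrite [hom_X h v]v0 linear0.
  have /ex[x xE] := pv; move: v0; rewrite -xE hX => jx.
  by have -> : x = 0; [apply: jXi; rewrite jx linear0|rewrite linear0].
- move=> x; have [[v y] [[w z]]] := sur (x, 0); rewrite !hom_XY => -[-> _].
  by exists (i v + w); rewrite linearD hX.
Qed.

(** A sum of copies of T(N) -> Λ e_B, one for each map N -> X, is pushed out along these maps, so
    that each of them acquires a preimage under g~. *)
Lemma special_sub_epi q : injective (phi K) ->
  exists (e : quadruple K) (I : choiceType)
      (j : {linear quad_mod q -> quad_mod e})
      (r : {linear quad_mod e -> dsum I (quad_mod (zero_quad (CokQ (proj_quad K))))}),
    [/\ short_exact j r, bijective (hom_X j) & epi_g e].
Proof.
move=> phi_inj; have [i [p [es iX]]] := ses_T (q := proj_quad K) phi_inj.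
pose I : choiceType := lhom N (quad_X q).
have [i' [p' [es' i'E p'E]]] := ses_dsum I es.
have lft (h : I) := tens_quad_lift (lhom_fun h : {linear bimod_lmod N -> quad_X q}).
have [u uE] := choice lft.
have [c cE] := dsum_lift u.
have [e [j [r [h [esj hi rh sur]]]]] := quad_pushout c es'.
have [ji exj rs] := esj.
have jXi : injective (hom_X j).
  apply: linear_inj => x x0; have : j (x, 0) = j 0 by rewrite hom_XY x0 !linear0.
  by move=> /ji[].
have jXs : surjective (hom_X j).
  move=> x; have /exj[[y z]] : r (x, 0) = 0.
    apply: dsum_ext => k.
    rewrite -[LHS]/(lcomp (dsum_proj _ k) r (x, 0)) hom_XY linear0.
    by congr (_, _); exact: zero_modE.
  by rewrite hom_XY => -[yx _]; exists y.
have jb := inj_surj_bij jXi jXs.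
exists e, I, j, r; split=> //; apply/epi_gP => a.
have [b _ jbK] := linv jb.
(* [hom_X j] is bijective, so a map from N to the new first component is already indexed by [I]. *)
pose a0 : I := (lcomp b a : lhom N (quad_X q)).
pose k := lcomp h (dsum_inc a0).
exists (hom_Y k (1 : B^o)) => n; rewrite -hom_g.
have -> : quad_g (proj_quad K) (pure n (1 : B^o)) = n by rewrite /= tens_homE ractr1.
have ki : k (i (n, 0)) = j (u a0 (n, 0)).
  rewrite /= -cE -hi; congr (h _); apply: dsum_ext => l.
  by rewrite i'E /= /dsum_inc_fun; case: eqP => // _; rewrite linear0.
rewrite -[n in LHS]iX; move: ki; rewrite !hom_XY => -[-> _].
by rewrite [hom_X (u a0) n](hom_XYE (uE a0)).1; exact: jbK.
Qed.

(** The pushout of Z(Ker g~) -> Z(V) along Z(Ker g~) -> q. The first component is unchanged, so g~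
    stays epi, and the leg from Z(V) identifies [V] with the new kernel. *)
Lemma special_sub_KerQ (V U : lmodType S) q (i : {linear KerQ q -> V})
    (p : {linear V -> U}) : short_exact i p -> epi_g q ->
  exists (e : quadruple K) (j : {linear quad_mod q -> quad_mod e})
      (r : {linear quad_mod e -> quad_mod (zero_quad U)}),
    [/\ short_exact j r, bijective (hom_X j), epi_g e & lmod_iso V (KerQ e)].
Proof.
move=> es gs; have [ii ex ps] := es.
have [i' [p' [es' i'Y p'Y]]] := ses_Zmap es.
have [|c cE] := zero_quad_in (q := q) (b := KerQ_in q); first by move=> n w; exact: KerQ_in0.
have [e [j [r [h [esj hi rh sur]]]]] := quad_pushout c es'.
have [[jXi exX _] [jYi exY _]] := (ses_quad j r).1 esj.
have jXs : surjective (hom_X j) by move=> x; apply/exX; exact: zero_modE.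
have jb := inj_surj_bij jXi jXs.
have hX x : hom_X h x = 0 by rewrite [x]zero_modE linear0.
have hY w : hom_Y h (i w) = hom_Y j (KerQ_in q w).
  rewrite -i'Y; have := hi (0, w); rewrite !hom_XY => -[_ ->].
  by rewrite [hom_Y c w](hom_XYE cE).2.
exists e, j, r; split=> //.
  apply/epi_gP => a; have [b _ jbK] := linv jb.
  have [y yE] := (epi_gP q).1 gs (lcomp b a).
  by exists (hom_Y j y) => n; rewrite -hom_g yE; exact: jbK.
have [|k kE] := KerQ_lift (q := e) (b := (hom_Y h : {linear res V -> quad_Y e})).
  move=> n w; rewrite -[LHS](hom_g h n w); exact: hX.
exists k; apply: inj_surj_bij.
- apply: linear_inj => v v0.
  have hv : hom_Y h v = 0 by rewrite -[LHS]kE v0 linear0.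
  have pv : p v = 0.
    rewrite -[p v]p'Y; have := rh (0, v); rewrite !hom_XY => -[_ <-].
    by rewrite [hom_Y h v]hv linear0.
  have /ex[w wE] := pv; move: hv; rewrite -wE hY => jw.
  have -> : w = 0; last exact: linear0.
  by apply: KerQ_in_inj; apply: jYi; rewrite jw !linear0.
- move=> w; have [[x y] [[z v]]] := sur (0, KerQ_in e w); rewrite !hom_XY.
  move=> [_ wE0]; have wE : KerQ_in e w = hom_Y j y + hom_Y h v by exact: wE0.
  (* Both [KerQ_in e w] and the image of [v] are killed by g, hence so is [y]. *)
  have [s sE] : exists s, KerQ_in q s = y.
    apply/KerQ_inP => n; apply: jXi; rewrite linear0 hom_g.
    have -> : hom_Y j y = KerQ_in e w - hom_Y h v by rewrite wE addrK.
    have -> : KerQ_in e w - hom_Y h v = KerQ_in e (w - k v).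
      by rewrite linearB [X in _ = _ - X]kE.
    exact: KerQ_in0.
  exists (i s + v); apply: KerQ_in_inj; rewrite [LHS]kE wE -sE -hY.
  exact: (linearD (hom_Y h)).
Qed.
End Approximations.

(** * The cotorsion pairs of a Morita ring *)

Section MoritaPairs.
Variables (A B : pzRingType) (M : bimodType B A) (N : bimodType A B).
Variable K : morita_context M N.
Notation S := (quo_ring K).
Variables (U' V' : mod_class S) (U'' V'' : mod_class A).
Hypothesis UV' : cotorsion_pair U' V'.
Hypothesis UV'' : cotorsion_pair U'' V''.
Hypothesis phi_inj : injective (phi K).
Implicit Types q e : quadruple K.

Notation classMU := (classM U' U'').
Notation classNV := (classN V' V'').
Definition tor_hyp := forall X, U'' X -> Tor1_vanishes M X.
Definition ext_hyp := forall X, V'' X -> Ext1_vanishes N X.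

(** The defining conditions with the tensor product removed through [CokQ_iso], and likewise
    [KerQ_iso] for [condN]. *)
Definition condM q := [/\ U' (CokQ q), U'' (quad_X q) & injective (quad_f q)].
Definition condN q := [/\ V' (KerQ q), V'' (quad_X q) & epi_g q].

Lemma classMP L : classMU L <-> exists q, condM q /\ lmod_iso L (quad_mod q).
Proof.
split=> -[q [[Uc Ux fi] Lq]]; exists q; split=> //; split=> //.
  exact: (cotorsion_iso_left UV' (CokQ_iso q)).
exact: (cotorsion_iso_left UV' (lmod_iso_sym (CokQ_iso q))).
Qed.
Lemma classNP L : classNV L <-> exists q, condN q /\ lmod_iso L (quad_mod q).
Proof.
split=> -[q [[Vk Vx gs] Lq]]; exists q; split=> //; split=> //.
  exact: (cotorsion_iso_right UV' (KerQ_iso q)).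
exact: (cotorsion_iso_right UV' (lmod_iso_sym (KerQ_iso q))).
Qed.

Lemma classM_quad q : condM q -> classMU (quad_mod q).
Proof. by move=> cq; apply/classMP; exists q; split=> //; exact: lmod_iso_refl. Qed.
Lemma classN_quad q : condN q -> classNV (quad_mod q).
Proof. by move=> cq; apply/classNP; exists q; split=> //; exact: lmod_iso_refl. Qed.

Lemma ext1_T_classN U L : U'' U -> classNV L -> ext1_zero (quad_mod (tens_quad K U)) L.
Proof.
move=> UU /classNP[q [[_ Vx _] Lq]].
apply: ext1_iso (lmod_iso_refl _) (lmod_iso_sym Lq) _.
exact/ext1_T/(cotorsion_ext UV'').
Qed.
Lemma ext1_Z_classN U L : U' U -> classNV L -> ext1_zero (quad_mod (zero_quad U)) L.
Proof.
move=> UU /classNP[q [[Vk _ gs] Lq]].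
apply: ext1_iso (lmod_iso_refl _) (lmod_iso_sym Lq) _.
by apply: ext1_Z_left => //; exact: (cotorsion_ext UV').
Qed.
Lemma ext1_classM_H V L : V'' V -> classMU L -> ext1_zero L (quad_mod (hom_quad K V)).
Proof.
move=> VV /classMP[q [[_ Ux _] Lq]].
apply: ext1_iso (lmod_iso_sym Lq) (lmod_iso_refl _) _.
exact/ext1_H/(cotorsion_ext UV'').
Qed.
Lemma ext1_classM_Z V L : V' V -> classMU L -> ext1_zero L (quad_mod (zero_quad V)).
Proof.
move=> VV /classMP[q [[Uc _ fi] Lq]].
apply: ext1_iso (lmod_iso_sym Lq) (lmod_iso_refl _) _.
by apply: ext1_Z_right => //; exact: (cotorsion_ext UV').
Qed.

Lemma U'_CokQ_proj_quad : U' (CokQ (proj_quad K)).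
Proof.
by apply: (cotorsion_left UV') => Y _; apply/ext1_projective/projective_CokQ_proj_quad.
Qed.
Lemma V'_KerQ_char_quad : V' (KerQ (char_quad K)).
Proof. by apply: (cotorsion_right UV') => X _; exact: ext1_KerQ_char_quad. Qed.

Lemma classN_of_ext1 L : tor_hyp ->
  (forall U, U'' U -> ext1_zero (quad_mod (tens_quad K U)) L) ->
  (forall U, U' U -> ext1_zero (quad_mod (@zero_quad _ _ _ _ K U)) L) -> classNV L.
Proof.
move=> tor hT hZ; have Lq := quad_of_iso L.
apply/classNP; exists (quad_of L); split=> //; split.
- apply: (cotorsion_right UV') => U UU; apply: ext1_Z_left_inv.
  exact: ext1_iso (lmod_iso_refl _) Lq (hZ _ UU).
- apply: (cotorsion_right UV'') => U UU; apply: ext1_T_inv; first exact: tor.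
  exact: ext1_iso (lmod_iso_refl _) Lq (hT _ UU).
- apply: epi_g_of_ext1 => //.
  exact: ext1_iso (lmod_iso_refl _) Lq (hZ _ U'_CokQ_proj_quad).
Qed.

Lemma classM_of_ext1 L : ext_hyp ->
  (forall V, V'' V -> ext1_zero L (quad_mod (hom_quad K V))) ->
  (forall V, V' V -> ext1_zero L (quad_mod (@zero_quad _ _ _ _ K V))) -> classMU L.
Proof.
move=> ext hH hZ; have Lq := quad_of_iso L.
apply/classMP; exists (quad_of L); split=> //; split.
- apply: (cotorsion_left UV') => V VV; apply: ext1_Z_right_inv.
  exact: ext1_iso Lq (lmod_iso_refl _) (hZ _ VV).
- apply: (cotorsion_left UV'') => V VV; apply: ext1_H_inv; first exact/Ext1P/ext.
  exact: ext1_iso Lq (lmod_iso_refl _) (hH _ VV).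
- apply: mono_f_of_ext1 => //.
  exact: ext1_iso Lq (lmod_iso_refl _) (hZ _ V'_KerQ_char_quad).
Qed.

(** The modules T(U) and Z(U) that detect the class already lie in its left orthogonal, so the
    double orthogonal adds nothing. *)
Lemma cotorsion_classN : tor_hyp -> cotorsion_pair (perp_left classNV) classNV.
Proof.
move=> tor; split=> [L|//]; split=> [/perp_rightP h|NL V]; last exact.
apply: classN_of_ext1 => // U UU; apply: h; apply/perp_leftP => V NV.
  exact: ext1_T_classN.
exact: ext1_Z_classN.
Qed.

Lemma cotorsion_classM : ext_hyp -> cotorsion_pair classMU (perp_right classMU).
Proof.
move=> ext; split=> [//|L]; split=> [/perp_leftP h|ML V]; last exact.
apply: classM_of_ext1 => // V VV; apply: h; apply/perp_rightP => U MU.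
  exact: ext1_classM_H.
exact: ext1_classM_Z.
Qed.

Lemma ext1_classM_classN L L' : classMU L -> classNV L' -> ext1_zero L L'.
Proof.
move=> /classMP[q [[Uc Ux fi] Lq]] NL'.
have [i [p [es _]]] := ses_T fi.
apply: ext1_iso (lmod_iso_sym Lq) (lmod_iso_refl _) _.
exact: ext1_ext es (ext1_T_classN Ux NL') (ext1_Z_classN Uc NL').
Qed.

Lemma classM_T U : U'' U -> classMU (quad_mod (tens_quad K U)).
Proof.
move=> UU; apply: classM_quad; split=> //.
apply: (cotorsion_left0 UV') => c; have [t <-] := CokQ_pr_surj c.
by apply/CokQ_prP; exists t.
Qed.

Lemma tens_zero_mod (t : tens M (zero_mod A)) : t = 0.
Proof.
apply: (@tens_hom_ext _ _ _ _ _ idfun (zero_map _ _)) => m x /=.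
by rewrite [x]zero_modE pure0r.
Qed.

Lemma classM_Z U : U' U -> classMU (quad_mod (zero_quad U)).
Proof.
move=> UU; apply: classM_quad; split.
- apply: (cotorsion_iso_left UV') UU.
  exists (unres_hom (CokQ_pr (zero_quad U) : {linear res U -> res (CokQ (zero_quad U))})).
  apply: inj_surj_bij; last exact: CokQ_pr_surj.
  by apply: linear_inj => u /CokQ_prP[t <-].
- by apply: (cotorsion_left0 UV''); exact: zero_modE.
- by move=> t u _; rewrite [t]tens_zero_mod [u]tens_zero_mod.
Qed.

Lemma classN_H V : V'' V -> classNV (quad_mod (hom_quad K V)).
Proof.
move=> VV; apply: classN_quad; split=> //.
- apply: (cotorsion_right0 UV') => c; apply: KerQ_in_inj; rewrite linear0.
  apply: linear_ext => n; rewrite -hom_mod_gE; exact: (KerQ_in0 n c).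
- by apply/epi_gP => h; exists (h : lhom N V) => n; exact: hom_mod_gE.
Qed.

Lemma classN_Z V : V' V -> classNV (quad_mod (zero_quad V)).
Proof.
move=> VV; apply: classN_quad; split.
- apply: (cotorsion_iso_right UV') VV; apply: lmod_iso_sym.
  exists (unres_hom (KerQ_in (zero_quad V) : {linear res (KerQ (zero_quad V)) -> res V})).
  by apply: inj_surj_bij => [|v]; [exact: KerQ_in_inj|exact/KerQ_inP].
- by apply: (cotorsion_right0 UV''); exact: zero_modE.
- by apply/epi_gP => h; exists 0 => n; rewrite [RHS]zero_modE; exact: zero_modE.
Qed.

(** The test modules T(U) and Z(U) of one class lie in the other, and so do H(V) and Z(V); with
    mutual orthogonality this gives both equalities. *)
Lemma cotorsion_classM_classN : tor_hyp -> ext_hyp -> cotorsion_pair classMU classNV.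
Proof.
move=> tor ext; split=> L; split.
- move=> /perp_rightP h; apply: classN_of_ext1 => // U UU; apply: h.
    exact: classM_T.
  exact: classM_Z.
- by move=> NL; apply/perp_rightP => X MX; exact: ext1_classM_classN.
- move=> /perp_leftP h; apply: classM_of_ext1 => // U UU; apply: h.
    exact: classN_H.
  exact: classN_Z.
- by move=> ML; apply/perp_leftP => X NX; exact: ext1_classM_classN.
Qed.

(** The order of the pushouts matters: the last two are isomorphisms on first components and keep X
    in V'', and the last one keeps g~ epi. *)
Lemma special_sub_classN L : tor_hyp ->
    complete_pair U' V' -> complete_pair U'' V'' ->
  exists2 Y, classNV Y & special_sub (perp_left classNV) L Y.
Proof.
move=> tor cp' cp''; have [f /linv[g fg gf]] := quad_of_iso L.
have [_ [X1 [U1 [i1 [p1 [VX1 UU1 es1]]]]]] := cp'' (quad_X (quad_of L)).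
have [e1 [iso1 [j1 [r1 esj1]]]] := special_sub_X (tor _ UU1) es1.
have [e2 [I [j2 [r2 [esj2 bj2 epi2]]]]] := special_sub_epi e1 phi_inj.
have [_ [X3 [U3 [i3 [p3 [VX3 UU3 es3]]]]]] := cp' (KerQ e2).
have [e3 [j3 [r3 [esj3 bj3 epi3 iso3]]]] := special_sub_KerQ es3 epi2.
exists (quad_mod e3).
  apply: classN_quad; split=> //; first exact: (cotorsion_iso_right UV' iso3).
  apply: (cotorsion_iso_right UV'') VX1.
  apply: lmod_iso_trans iso1 _; apply: (@lmod_iso_trans _ _ (quad_X e2)).
    by exists (hom_X j2).
  by exists (hom_X j3).
have s1 : special_sub (perp_left classNV) (quad_mod (quad_of L)) (quad_mod e1).
  exists (quad_mod (tens_quad K U1)), j1, r1; split=> //.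
  by apply/perp_leftP => V NV; exact: ext1_T_classN.
have s2 : special_sub (perp_left classNV) (quad_mod e1) (quad_mod e2).
  exists (dsum I (quad_mod (zero_quad (CokQ (proj_quad K))))), j2, r2; split=> //.
  apply/perp_leftP => V NV; apply: ext1_dsum.
  by apply: ext1_Z_classN NV; exact: U'_CokQ_proj_quad.
have s3 : special_sub (perp_left classNV) (quad_mod e2) (quad_mod e3).
  exists (quad_mod (zero_quad U3)), j3, r3; split=> //.
  by apply/perp_leftP => V NV; apply: ext1_Z_classN NV.
have [Z [j [r [[ji exj rs] pZ]]]] := special_sub_trans (special_sub_trans s1 s2) s3.
exists Z, (lcomp j f), r; split=> //; split=> //.
  by move=> x y /ji /(can_inj fg).
move=> x; rewrite exj; split=> [[y <-]|[y <-]]; last by exists (f y).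
by exists (g y); rewrite /= gf.
Qed.

(** For the kernel, f is mono because M ⊗ X_0 -> M ⊗ X_1 is, by the vanishing of Tor_1 on X_2, and f
    of the middle term is. The other conditions pass to the kernels of X_1 -> X_2 and of Coker f_1
    -> Coker f_2. *)
Lemma classM_ker (V W : lmodType (morita_ring K)) (p : {linear V -> W}) : tor_hyp ->
    hereditary_pair U' V' -> hereditary_pair U'' V'' ->
  surjective p -> classMU V -> classMU W -> classMU (ker p).
Proof.
move=> tor [her' _] [her'' _] ps /classMP[q1 [[Uc1 Ux1 f1] [a ab]]].
move=> /classMP[q2 [[Uc2 Ux2 f2] [c cb]]].
have [a' aa' a'a] := linv ab.
have Lq := quad_of_iso (ker p); set q0 := quad_of _ in Lq.
have [d [d' dd' d'd]] := Lq.
have [u [u' uu' u'u]] := lmod_iso_sym Lq.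
have ub : bijective u by exists u'.
(* The kernel sequence is rewritten in terms of quadruples, so that it can be read on components. *)
have es := ses_transport (ses_ker ps) ub aa' a'a cb.
apply/classMP; exists q0; split=> //.
have [esX esY] := (ses_quad _ _).1 es.
have [j [k esQ]] := ses_CokQ es f2.
have [[iXi exX pXs] [iYi exY pYs]] := (esX, esY).
split.
- apply: (cotorsion_iso_left UV' (ses_left_iso esQ)).
  by apply: her' => //; case: esQ.
- apply: (cotorsion_iso_left UV'' (ses_left_iso esX)).
  exact: her''.
- apply: linear_inj => t t0; apply: (Tor1_inj (tor _ Ux2) esX).
  rewrite linear0; apply: f1; rewrite linear0.
  by rewrite -hom_f_tens t0 linear0.
Qed.
End MoritaPairs.

Theorem corollary4p6 (A B : pzRingType) (M : bimodType B A) (N : bimodType A B)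
    (K : morita_context M N)
    (U' V' : mod_class (quo_ring K)) (U'' V'' : mod_class A) :
  cotorsion_pair U' V' -> cotorsion_pair U'' V'' ->
  injective (phi K) ->
  [/\ (forall X, U'' X -> Tor1_vanishes M X) ->
        cotorsion_pair (perp_left (classN V' V'')) (classN V' V''),
      (forall X, V'' X -> Ext1_vanishes N X) ->
        cotorsion_pair (classM U' U'') (perp_right (classM U' U''))
    & (forall X, U'' X -> Tor1_vanishes M X) ->
      (forall X, V'' X -> Ext1_vanishes N X) ->
        cotorsion_pair (classM U' U'') (classN V' V'') /\
        ((complete_pair U' V' /\ hereditary_pair U' V') ->
         (complete_pair U'' V'' /\ hereditary_pair U'' V'') ->
         complete_pair (classM U' U'') (classN V' V'') /\
         hereditary_pair (classM U' U'') (classN V' V''))].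
Proof.
move=> UV' UV'' phi_inj; split=> [tor|ext|tor ext].
- exact: (cotorsion_classN UV' UV'' phi_inj).
- exact: (cotorsion_classM UV' UV'' phi_inj).
- have MN := cotorsion_classM_classN UV' UV'' phi_inj tor ext.
  split=> // -[cp' her'] [cp'' her'']; split.
    apply: salce => // L.
    (* The cokernel is only known to lie in the left orthogonal of N, which is M by the pair just
       established. *)
    have [Y NY [Z [i [p [es pZ]]]]] := special_sub_classN UV' UV'' phi_inj L tor cp' cp''.
    by exists Y => //; exists Z, i, p; split=> //; apply/MN.2.
  apply: hereditary_of_kernels => // V W p ps MV MW.
  exact: (classM_ker UV' UV'' tor her' her'').
Qed.
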